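(* Let $N\ge1$ be an integer and let $m>1$, $q\in(0,1)$, $\sigma>\frac{2(1-q)}{m-1}$. The function $$U(x)=A|x|^{(\sigma+2)/(m-q)},\qquad A=\left[\frac{(m-q)^2}{m(\sigma+2)[m(\sigma+N)-q(N-2)]}\right]^{1/(m-q)},\qquad x\in\mathbb{R}^N,$$ is an explicit but unbounded stationary solution to the equation $$\partial_t u-\Delta u^m+|x|^\sigma u^q=0\quad\text{in }(0,\infty)\times\mathbb{R}^N,$$ with $U(0)=0$. Moreover, if $u_0\in L_+^\infty(\mathbb{R}^N)$ satisfies $u_0(x)\le U(x)$ for any $x\in\mathbb{R}^N$ and $u$ is the non-negative weak solution to the Cauchy problem for this equation with initial condition $u(0)=u_0$, then $$u(t,0)=0\qquad\text{for any } t>0.$$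
   Context: $L_+^\infty(\mathbb{R}^N)$ is the set of $z\in L^\infty(\mathbb{R}^N)$ with $z\ge 0$ a.e. Weak solution: given $u_0\in L_+^\infty(\mathbb{R}^N)$, a non-negative weak solution is a function $u\in L_+^\infty((0,\infty)\times\mathbb{R}^N)$ such that, for all $T>0$, $u^m\in L^2((0,T),H^1_{\mathrm{loc}}(\mathbb{R}^N))$ and $$\int_0^T\int_{\mathbb{R}^N}\Big[(u_0-u)\,\partial_t\zeta+\nabla u^m\cdot\nabla\zeta+|x|^\sigma u^q\zeta\Big]\,dx\,ds=0$$ for all $\zeta\in C_c^1([0,T)\times\mathbb{R}^N)$. Such a weak solution exists and is unique. The pointwise value $u(t,0)$ refers to the continuous representative of $u$ in $(0,\infty)\times\mathbb{R}^N$. *)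

(* Defs.v *)
From HB Require Import structures.
From mathcomp Require Import all_boot all_order all_algebra.
From mathcomp Require Import all_classical all_reals all_analysis.
Import Order.TTheory GRing.Theory Num.Def Num.Theory.
Import numFieldNormedType.Exports.

Set Implicit Arguments.
Unset Strict Implicit.
Unset Printing Implicit Defensive.

Local Open Scope classical_set_scope.
Local Open Scope ring_scope.

(* The sigma-algebra on ['rV[R]_n] generated by the coordinates, that is, the
   Borel sigma-algebra of R^n. *)
Definition rV_display : measure_display.
Proof. exact. Qed.

Section measurable_rV.
Context {R : realType} (n : nat).

Let coord (i : 'I_n) (x : 'rV[R]_n) : R := x ord0 i.

Let rV_set0 : g_sigma_preimage coord set0.
Proof. exact: sigma_algebra0. Qed.

Let rV_setC A : g_sigma_preimage coord A -> g_sigma_preimage coord (~` A).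
Proof. exact: sigma_algebraC. Qed.

Let rV_bigcup (F : _^nat) : (forall i, g_sigma_preimage coord (F i)) ->
  g_sigma_preimage coord (\bigcup_i (F i)).
Proof. exact: sigma_algebra_bigcup. Qed.

HB.instance Definition _ := @isMeasurable.Build rV_display
  'rV[R]_n (g_sigma_preimage coord) rV_set0 rV_setC rV_bigcup.

Lemma measurable_coord (i : 'I_n) : measurable_fun [set: 'rV[R]_n] (coord i).
Proof.
move=> _ Y mY; rewrite setTI; apply: sub_sigma_algebra => /=.
rewrite -bigcup_seq/=; exists i => /=; first by rewrite mem_index_enum.
by exists Y => //; rewrite setTI.
Qed.

Lemma measurable_fun_coordP d (T : measurableType d) (f : T -> 'rV[R]_n) :
  (forall i, measurable_fun [set: T] (fun t => f t ord0 i)) ->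
  measurable_fun [set: T] f.
Proof.
move=> mf _ A mA; rewrite setTI.
have: g_sigma_preimage (fun i => coord i \o f) (f @^-1` A).
  by rewrite g_sigma_preimage_comp; exists A; rewrite ?setTI.
apply: smallest_sub; first exact: sigma_algebra_measurable.
rewrite -bigcup_seq; apply: bigcup_sub => i _ _ [B mB <-].
exact: mf.
Qed.

End measurable_rV.

Section cons_rV.
Context {R : realType} (n : nat).

Definition cons_rV (p : measurableTypeR R * 'rV[R]_n) : 'rV[R]_n.+1 :=
  \row_i oapp (fun j => p.2 ord0 j) p.1 (unlift ord0 i).

Definition uncons_rV (x : 'rV[R]_n.+1) : measurableTypeR R * 'rV[R]_n :=
  (x ord0 ord0, \row_j x ord0 (lift ord0 j)).

Lemma cons_rVK : cancel cons_rV uncons_rV.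
Proof.
move=> [a y]; rewrite /uncons_rV /cons_rV mxE unlift_none/=; congr pair.
by apply/rowP => j; rewrite !mxE liftK.
Qed.

Lemma measurable_cons_rV : measurable_fun setT cons_rV.
Proof.
apply: measurable_fun_coordP => i; rewrite /cons_rV.
under eq_fun do rewrite mxE.
case: unliftP => [j|] _ /=; last exact: measurable_fst.
exact: measurableT_comp (measurable_coord j) measurable_snd.
Qed.

Lemma measurable_uncons_rV : measurable_fun setT uncons_rV.
Proof.
apply/measurable_fun_pairP; split; first exact: measurable_coord.
apply: measurable_fun_coordP => i /=.
under eq_fun do rewrite mxE.
exact: measurable_coord.
Qed.

End cons_rV.

Section lebesgue_cons.
Context {R : realType} (n : nat).
Variable mu : {sigma_finite_measure set 'rV[R]_n -> \bar R}.

Definition lebesgue_cons : set 'rV[R]_n.+1 -> \bar R :=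
  pushforward (@lebesgue_measure R \x mu)%E (@cons_rV R n).

Let mcons (A : set 'rV[R]_n.+1) :
  measurable A -> measurable (@cons_rV R n @^-1` A).
Proof. by move=> mA; rewrite -[X in measurable X]setTI; exact: measurable_cons_rV. Qed.

Let lebesgue_cons0 : lebesgue_cons set0 = 0%E.
Proof. by rewrite /lebesgue_cons/pushforward preimage_set0 measure0. Qed.

Let lebesgue_cons_ge0 A : (0 <= lebesgue_cons A)%E.
Proof. by rewrite /lebesgue_cons/pushforward measure_ge0. Qed.

Let lebesgue_cons_sigma_additive : semi_sigma_additive lebesgue_cons.
Proof.
move=> F mF tF mUF; rewrite /lebesgue_cons/pushforward preimage_bigcup.
apply: measure_semi_sigma_additive.
- by move=> k; exact: mcons.
- apply/trivIsetP => /= i j _ _ ij; rewrite -preimage_setI.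
  by move/trivIsetP : tF => /(_ _ _ _ _ ij) ->//; rewrite preimage_set0.
- by rewrite -preimage_bigcup; exact: mcons.
Qed.

HB.instance Definition _ := isMeasure.Build _ _ _ lebesgue_cons
  lebesgue_cons0 lebesgue_cons_ge0 lebesgue_cons_sigma_additive.

Let lebesgue_cons_sigma_finite : sigma_finite setT lebesgue_cons.
Proof.
have /sigma_finiteP[F [FT ndF Foo]] := sigma_finiteT (@lebesgue_measure R).
have /sigma_finiteP[G [GT ndG Goo]] := sigma_finiteT mu.
exists (fun k => @uncons_rV R n @^-1` (F k `*` G k)).
  rewrite -preimage_bigcup [X in _ @^-1` X](_ : _ = setT) ?preimage_setT//.
  apply/seteqP; split=> // -[x y] _.
  have [k _ Fkx] : (\bigcup_i F i) x by rewrite -FT.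
  have [l _ Gly] : (\bigcup_i G i) y by rewrite -GT.
  exists (maxn k l) => //; split => /=.
  - by move: x Fkx; exact/subsetPset/ndF/leq_maxl.
  - by move: y Gly; exact/subsetPset/ndG/leq_maxr.
move=> k; have [mF Fk] := Foo k; have [mG Gk] := Goo k; split.
  rewrite -[X in measurable X]setTI; apply: measurable_uncons_rV => //.
  exact: measurableX.
rewrite /lebesgue_cons/pushforward -comp_preimage.
rewrite (_ : _ \o _ = id) ?preimage_id; last first.
  by apply/funext => p /=; rewrite cons_rVK.
by rewrite product_measure1E// lte_mul_pinfty// ge0_fin_numE.
Qed.

HB.instance Definition _ := Measure_isSigmaFinite.Build _ _ _ lebesgue_cons
  lebesgue_cons_sigma_finite.

End lebesgue_cons.

(* Lebesgue measure on R^n: the n-fold product of [lebesgue_measure]. *)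
Fixpoint lebesgue_rV (R : realType) (n : nat) :
    {sigma_finite_measure set 'rV[R]_n -> \bar R} :=
  match n with
  | 0 => \d_(0 : 'rV[R]_0)
  | n'.+1 => lebesgue_cons (lebesgue_rV R n')
  end.

Lemma lebesgue_rV_box (R : realType) (n : nat) (A : 'I_n -> set R) :
  (forall i, measurable (A i)) ->
  lebesgue_rV R n [set x | forall i, A i (x ord0 i)] =
  (\prod_(i < n) lebesgue_measure (A i))%E.
Proof.
elim: n A => [|n IHn] A mA.
  by rewrite big_ord0 /= diracE mem_set// => -[].
rewrite big_ord_recl -IHn//.
rewrite -(@product_measure1E _ _ _ _ _ lebesgue_measure (lebesgue_rV R n))//.
  rewrite /= /lebesgue_cons /pushforward; congr ((_ \x _)%E _).
  apply/seteqP; split=> -[a y] /=.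
    move=> Ay; split; first by have := Ay ord0; rewrite mxE unlift_none.
    by move=> j; have := Ay (lift ord0 j); rewrite mxE liftK.
  by move=> [Aa Ay] i; rewrite mxE; case: unliftP => [j|] -> //=.
  exact: mA.
rewrite [X in measurable X](_ : _ =
  \bigcap_(i in [set: 'I_n]) (fun x : 'rV[R]_n => x ord0 i) @^-1` A (lift ord0 i)).
  apply: fin_bigcap_measurable => [|i _]; first exact: finite_finset.
  rewrite -[X in measurable X]setTI.
  by apply: (measurable_coord i) => //; exact: mA.
by apply/seteqP; split=> x /= Ax i; [move=> _; exact: Ax|exact: Ax].
Qed.

Section calculus.
Context {R : realType}.

Fixpoint Ck (V : normedModType R) (k : nat) (f : V -> R) : Prop :=
  match k with
  | 0 => continuous f
  | k'.+1 => (forall x, differentiable f x) /\ forall v, Ck k' ('D_v f)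
  end.

Definition Cinfty (V : normedModType R) (f : V -> R) := forall k, Ck k f.

Definition tsupport (V : normedModType R) (f : V -> R) : set V :=
  closure [set x | f x != 0].

Variable N : nat.

(* The norm [`|x|] of ['rV[R]_N] is the sup norm; the equation involves the
   Euclidean one. *)
Definition enorm (x : 'rV[R]_N) : R := Num.sqrt (\sum_(i < N) x ord0 i ^+ 2).

Definition basis_rV (i : 'I_N) : 'rV[R]_N := delta_mx ord0 i.

Definition partial (i : 'I_N) (f : 'rV[R]_N -> R) : 'rV[R]_N -> R :=
  'D_(basis_rV i) f.

Definition laplacian (f : 'rV[R]_N -> R) (x : 'rV[R]_N) : R :=
  \sum_(i < N) partial i (partial i f) x.

Definition time_partial (f : R * 'rV[R]_N -> R) : R * 'rV[R]_N -> R :=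
  'D_((1, 0) : R * 'rV[R]_N) f.

Definition space_partial (i : 'I_N) (f : R * 'rV[R]_N -> R) :
    R * 'rV[R]_N -> R :=
  'D_((0, basis_rV i) : R * 'rV[R]_N) f.

End calculus.

Section function_spaces.
Context {R : realType} (N : nat).

Definition spacetime_measure : {measure set (measurableTypeR R * 'rV[R]_N) -> \bar R} :=
  (@lebesgue_measure R \x lebesgue_rV R N)%E.

Definition positive_times : set (R * 'rV[R]_N) := [set z | 0 < z.1].

Definition Linfty_pos d (T : measurableType d) (mu : {measure set T -> \bar R})
    (D : set T) (f : T -> R) : Prop :=
  (f \_ D \in Lfun mu +oo%E) /\ {ae mu, forall x, D x -> 0 <= f x}.

Definition weak_gradient (f : 'rV[R]_N -> R) (g : 'rV[R]_N -> 'rV[R]_N) : Prop :=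
  forall (i : 'I_N) (phi : 'rV[R]_N -> R),
    Cinfty phi -> compact (tsupport phi) ->
    (\int[lebesgue_rV R N]_x (f x * partial i phi x)%:E =
     - \int[lebesgue_rV R N]_x (g x ord0 i * phi x)%:E)%E.

(* [g] is the weak gradient of [f]; it is determined by [f] almost everywhere. *)
Definition H1loc (f : 'rV[R]_N -> R) (g : 'rV[R]_N -> 'rV[R]_N) : Prop :=
  [/\ measurable_fun setT f,
      measurable_fun setT g,
      forall K : set 'rV[R]_N, compact K ->
        (\int[lebesgue_rV R N]_(x in K) (f x ^+ 2 + enorm (g x) ^+ 2)%:E < +oo)%E
    & weak_gradient f g].

(* [f] belongs to L^2((0, T), H^1_loc(R^N)) and [g] is its gradient in [x]. The
   local H^1 norms are squared and integrated in time over each compact set. *)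
Definition L2_H1loc (T : R) (f : R * 'rV[R]_N -> R)
    (g : R * 'rV[R]_N -> 'rV[R]_N) : Prop :=
  [/\ measurable_fun (`]0, T[ `*` setT) f,
      measurable_fun (`]0, T[ `*` setT) g,
      {ae @lebesgue_measure R, forall s, s \in `]0, T[ ->
        H1loc (fun x => f (s, x)) (fun x => g (s, x))}
    & forall K : set 'rV[R]_N, compact K ->
        (\int[@lebesgue_measure R]_(s in `]0%R, T[)
          \int[lebesgue_rV R N]_(x in K)
            (f (s, x) ^+ 2 + enorm (g (s, x)) ^+ 2)%:E < +oo)%E].

(* [C_c^1([0, T) x R^N)], as the restrictions to [t >= 0] of the functions in
   [C_c^1((-oo, T) x R^N)], extended by 0 to all times. *)
Definition test_function (T : R) (zeta : R * 'rV[R]_N -> R) : Prop :=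
  [/\ Ck 1 zeta, compact (tsupport zeta) & tsupport zeta `<=` [set z | z.1 < T]].

Definition weak_solution (m q sigma : R) (u0 : 'rV[R]_N -> R)
    (u : R * 'rV[R]_N -> R) : Prop :=
  Linfty_pos spacetime_measure positive_times u /\
  forall T : R, 0 < T -> exists g : R * 'rV[R]_N -> 'rV[R]_N,
    L2_H1loc T (fun z => u z `^ m) g /\
    forall zeta, test_function T zeta ->
      (\int[@lebesgue_measure R]_(s in `]0%R, T[)
        \int[lebesgue_rV R N]_x
          ((u0 x - u (s, x)) * time_partial zeta (s, x)
           + \sum_(i < N) g (s, x) ord0 i * space_partial i zeta (s, x)
           + enorm x `^ sigma * u (s, x) `^ q * zeta (s, x))%R%:E = 0)%E.

(* Classical sense: as in the equation, the second order space derivatives are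
   those of u^m, not of u. No boundedness is required. *)
Definition classical_solution (m q sigma : R) (u : R * 'rV[R]_N -> R) : Prop :=
  forall t : R, 0 < t ->
    Ck 2 (fun y : 'rV[R]_N => u (t, y) `^ m) /\
    forall x : 'rV[R]_N,
      [/\ {for (t, x), continuous u},
          derivable u (t, x) ((1, 0) : R * 'rV[R]_N),
          0 <= u (t, x)
        & time_partial u (t, x) - laplacian (fun y => u (t, y) `^ m) x
          + enorm x `^ sigma * u (t, x) `^ q = 0].

Definition profile_coef (m q sigma : R) : R :=
  ((m - q) ^+ 2 /
   (m * (sigma + 2) * (m * (sigma + N%:R) - q * (N%:R - 2)))) `^ (m - q)^-1.

Definition profile (m q sigma : R) (x : 'rV[R]_N) : R :=
  profile_coef m q sigma * enorm x `^ ((sigma + 2) / (m - q)).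

Definition continuous_representative (u v : R * 'rV[R]_N -> R) : Prop :=
  (forall z, positive_times z -> {for z, continuous v}) /\
  {ae spacetime_measure, forall z, positive_times z -> v z = u z}.

End function_spaces.

(* Main.v *)
(* Compare U^m with the exponential time average of u^m,
     F(t,x) = e^(-t/h) (U(x)^m + (1/h) int_0^t e^(s/h) u(s,x)^m ds),
   which, unlike u^m, is differentiable in time: h F' = u^m - F. Testing the weak
   form with approximations of e^(s/h) 1_(s < t) rho(x) gives a lower bound for the
   distributional Laplacian of F(t,.), and mollification shows that this bound
   holds at a maximum point of F(t,.) - U^m with the Laplacian of U^m instead.
   Together with a tangent line inequality for r |-> r - c r^q in terms of r^m,
   averaged over the probability measure that defines F, this yields u^m <= F at
   such a point where F > U^m, as soon as h |x|^sigma (m - q) <= (m - 1) U^(1-q).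
   On bounded sets the latter holds for small h, since sigma > 2(1-q)/(m-1); far
   away F <= U^m because U is unbounded and u is bounded. So a positive maximum of
   F - U^m cannot grow in time, whence F <= U^m; at x = 0 this reads
   int_0^t e^(s/h) u(s,0)^m ds <= 0. *)
From HB Require Import structures.
Require Import Defs.
From mathcomp Require Import all_boot all_order all_algebra.
From mathcomp Require Import ring lra.
From mathcomp Require Import all_classical all_reals all_analysis measurable_realfun.
Import Order.TTheory GRing.Theory Num.Def Num.Theory.
Import numFieldNormedType.Exports.

Set Implicit Arguments.
Unset Strict Implicit.
Unset Printing Implicit Defensive.

Local Open Scope classical_set_scope.
Local Open Scope ring_scope.

(** * Borel sets and Lebesgue measure on R^n *)

(** [U] is unbounded, hence not itself an admissible weak solution, and [u] has no time derivative,
    so the two are not compared directly. With the weight [e^(s/h)] cut at time [t], the weak form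
    becomes, at each fixed [t], an elliptic inequality with continuous coefficients, to which the
    maximum principle applies; the cut produces the undifferentiated term [e^(t/h) u(t,x)], the
    quantity to be bounded. The integrated initial term is bounded through [U(x)] with weight 1, and
    this is why [F] carries the atom [U(x)^m]: atom and density [e^(s/h)/h] on []0, t[] have total
    mass [e^(t/h)], so [F] is a true mean. The difficulty is that the averaged inequality contains
    means of [u] and of [u^q], whereas [F] only knows the mean of [u^m]. They occur in the
    combination [r - c r^q] with [c = h |x|^sigma], which is not monotone near [r = 0]; it lies
    below its tangent line in the variable [r^m] once [c] is small compared with [U^(1-q)]. This
    fixes [h], which never tends to 0. *)

Section rV_norm.
Context {R : realType} {n : nat}.
Implicit Types x : 'rV[R]_n.

Lemma rV_norm_leP x e : 0 <= e ->
  reflect (forall i, `|x ord0 i| <= e) (`|x| <= e).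
Proof.
move=> e0; rewrite [in X in reflect _ X]/normr/= mx_normrE.
apply: (iffP (bigmax_leP _ _ _ _)) => [[_ H] i|H]; first exact: (H (ord0, i)).
by split => // -[i j] _ /=; rewrite ord1.
Qed.

Lemma rV_norm_ltP x e : 0 < e ->
  reflect (forall i, `|x ord0 i| < e) (`|x| < e).
Proof.
move=> e0; rewrite [in X in reflect _ X]/normr/= mx_normrE.
apply: (iffP (bigmax_ltP _ _ _ _)) => [[_ H] i|H]; first exact: (H (ord0, i)).
by split => // -[i j] _ /=; rewrite ord1.
Qed.

Lemma rV_coord_le x i : `|x ord0 i| <= `|x|.
Proof. by move: i; apply/rV_norm_leP. Qed.

End rV_norm.

Section borel_rV.
Context {R : realType} {n : nat}.

Let box (c : rat * 'rV[rat]_n * nat) : set (measurableTypeR R * 'rV[R]_n) :=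
  ball (ratr c.1.1 : R) c.2.+1%:R^-1 `*`
  \bigcap_(i in [set: 'I_n])
    ((fun x : 'rV[R]_n => x ord0 i) @^-1` ball (ratr (c.1.2 ord0 i) : R) c.2.+1%:R^-1).

Let measurable_box c : measurable (box c).
Proof.
apply: measurableX; first exact: measurable_ball.
apply: fin_bigcap_measurable => [|i _]; first exact: finite_finset.
rewrite -[X in measurable X]setTI; apply: (measurable_coord i) => //.
exact: measurable_ball.
Qed.

(** The countably many [box]es with rational centre and radius [1/(k+1)] form a base of the
    topology, because balls of the sup norm are products; an open set is the union of the boxes that
    it contains. *)
Lemma open_measurable_prod (O : set (R * 'rV[R]_n)) :
  open O -> measurable (O : set (measurableTypeR R * 'rV[R]_n)).
Proof.
move=> oO.
rewrite (_ : O = \bigcup_c (if asbool (box c `<=` O) then box c else set0)).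
  apply: countable_bigcupT_measurable => [|c]; first exact: countableP.
  by case: ifPn.
apply/seteqP; split => [[a x] Oax|z [c _]]; last by case: asboolP => // + zc; apply.
have /nbhs_ballP[e /= e0 aO] : nbhs (a, x) O by apply: open_nbhs_nbhs.
have [k ke] : exists k : nat, k.+1%:R^-1 < e / 2.
  have [k _ /(_ _ (leqnn _))] := near_infty_natSinv_lt (PosNum (divr_gt0 e0 (ltr0n _ 2))).
  by exists k.
pose d : R := k.+1%:R^-1.
have d0 : 0 < d by rewrite invr_gt0.
have app (y : R) : exists r : rat, ball (ratr r : R) d y.
  have [r] : exists r : rat, ratr r \in `]y - d, y + d[ by apply: rat_in_itvoo; lra.
  by rewrite in_itv/= => ?; exists r; rewrite /ball/= ltr_norml; lra.
pose q y := projT1 (cid (app y)).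
have qP y : ball (ratr (q y) : R) d y := projT2 (cid (app y)).
(* Each coordinate is within [d < e / 2] of the rational centre, so any two points of the box are
   less than [e] apart. *)
exists (q a, \row_i q (x ord0 i), k) => //=.
case: asboolP => [_|[]]; first by split => //= i _; rewrite /= mxE; exact: qP.
move=> -[b y] [/= b1 y1]; apply: aO.
have tri (u v w : R) : ball u d v -> ball u d w -> `|v - w| < e.
  rewrite /ball/= !ltr_norml.
  by move=> /andP[? ?] /andP[? ?]; move: ke; rewrite -/d => ?; apply/andP; split; lra.
split => /=; first exact: (tri _ _ _ (qP a)).
rewrite -ball_normE /=; apply/rV_norm_ltP => // i; rewrite !mxE.
have := y1 i I; rewrite /= mxE; apply: tri; exact: qP.
Qed.

Lemma continuous_measurable_prod (D : set (R * 'rV[R]_n)) (f : R * 'rV[R]_n -> R) :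
  open D -> (forall z, D z -> {for z, continuous f}) ->
  measurable_fun (D : set (measurableTypeR R * 'rV[R]_n)) f.
Proof.
move=> oD cf; apply: (measurability _ (RGenOpens.measurableE R)).
move=> _ [_ [a [b ->] <-]]; apply: open_measurable_prod.
rewrite openE => z [Dz fz].
apply: filterI; first exact: open_nbhs_nbhs.
by apply: cf => //; apply: open_nbhs_nbhs; split => //; exact: interval_open.
Qed.

(** Borel facts on ['rV[R]_n] are read off from those on the product by slicing at first coordinate
    0. *)
Lemma continuous_measurable_rV (f : 'rV[R]_n -> R) :
  continuous f -> measurable_fun setT f.
Proof.
move=> cf.
have mf : measurable_fun (setT : set (measurableTypeR R * 'rV[R]_n)) (f \o snd).
  apply: continuous_measurable_prod; first exact: openT.
  by move=> z _; apply: continuous_comp; [exact: cvg_snd | exact: cf].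
rewrite (_ : f = (f \o snd) \o (fun x => (0 : measurableTypeR R, x))) //.
exact: measurableT_comp mf (measurable_pair1 _).
Qed.

Lemma open_measurable_rV (O : set 'rV[R]_n) : open O -> measurable O.
Proof.
move=> oO.
have mO := @open_measurable_prod (snd @^-1` O) _.
rewrite (_ : O = (fun x => (0 : measurableTypeR R, x)) @^-1` (snd @^-1` O)) //.
rewrite -[X in measurable X]setTI; apply: measurable_pair1 => //.
apply: mO; apply: open_comp => // z _; exact: cvg_snd.
Qed.

Lemma closed_measurable_rV (C : set 'rV[R]_n) : closed C -> measurable C.
Proof.
move=> cC; rewrite -[C]setCK; apply: measurableC; apply: open_measurable_rV.
exact: closed_openC.
Qed.

End borel_rV.

Section lebesgue_rV_facts.
Context {R : realType}.

Lemma rV_ballE n (a : 'rV[R]_n) (e : R) : 0 < e ->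
  ball a e = [set x : 'rV[R]_n | forall i, ball (a ord0 i) e (x ord0 i)].
Proof.
move=> e0; apply/seteqP; split => x /=.
  by rewrite -ball_normE/= => /(rV_norm_ltP _ e0) h i; have := h i; rewrite !mxE.
by move=> h; rewrite -ball_normE/=; apply/rV_norm_ltP => // i; rewrite !mxE; exact: h.
Qed.

Lemma lebesgue_rV_ball n (a : 'rV[R]_n) (e : R) : 0 < e ->
  lebesgue_rV R n (ball a e) = ((e *+ 2) ^+ n)%:E.
Proof.
move=> e0; rewrite rV_ballE// (@lebesgue_rV_box _ _ (fun i => ball (a ord0 i) e)); last first.
  by move=> i; exact: measurable_ball.
under eq_bigr do rewrite lebesgue_measure_ball ?(ltW e0)//.
by rewrite prodEFin prodr_const card_ord.
Qed.

Lemma bounded_lebesgue_rV n (K : set 'rV[R]_n) :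
  measurable K -> bounded_set K -> (lebesgue_rV R n K < +oo)%E.
Proof.
move=> mK [M [Mr KM]].
have M0 : 0 < `|M| + 2 by rewrite ltr_wpDl.
apply: (@le_lt_trans _ _ (lebesgue_rV R n (ball 0 (`|M| + 2)))); last first.
  by rewrite lebesgue_rV_ball // ltry.
apply: le_measure; rewrite ?inE //.
  by apply: open_measurable_rV; exact: ball_open.
move=> x Kx; rewrite -ball_normE/= sub0r normrN.
apply: (@le_lt_trans _ _ (`|M| + 1)); last by rewrite ltrD2l ltr1n.
by apply: KM => //; rewrite (le_lt_trans (ler_norm _)) // ltrDl.
Qed.

Lemma compact_lebesgue_rV n (K : set 'rV[R]_n) :
  compact K -> (lebesgue_rV R n K < +oo)%E.
Proof.
move=> cK; apply: bounded_lebesgue_rV; last exact: compact_bounded.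
apply: closed_measurable_rV; exact: compact_closed.
Qed.

(** The image of Lebesgue measure under a translation gives every half-open interval its length,
    hence is Lebesgue measure by uniqueness. *)
Lemma ge0_integral_lebesgue_shift (c : R) (f : R -> \bar R) :
  measurable_fun setT f -> (forall x, 0 <= f x)%E ->
  (\int[@lebesgue_measure R]_x f (x + c)%R = \int[@lebesgue_measure R]_x f x)%E.
Proof.
move=> mf f0.
pose s (x : measurableTypeR R) : measurableTypeR R := x + c.
have ms : measurable_fun setT s by exact: measurable_funD.
transitivity (\int[pushforward (@lebesgue_measure R) s]_x f x)%E.
  by rewrite ge0_integral_pushforward.
apply: eq_measure_integral => A mA _ /=.
apply/esym; apply: lebesgue_measure_unique => // X.
move=> /ocitvP[->|[[a b] /= ab ->]]; first by rewrite !measure0.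
rewrite /pushforward (_ : _ @^-1` _ = `]a - c, b - c]%classic).
  by rewrite !lebesgue_measure_itv/= !lte_fin ltrD2r ab -!EFinB opprB addrA subrK.
by apply/seteqP; split => y /=; rewrite !in_itv/= /s; lra.
Qed.

Lemma cons_rVD n (a b : R) (x y : 'rV[R]_n) :
  cons_rV (a, x) + cons_rV (b, y) = cons_rV (a + b, x + y).
Proof.
apply/rowP => i; rewrite !mxE; case: unliftP => [j|] _ //=.
by rewrite !mxE.
Qed.

Lemma uncons_rVK n : cancel (@uncons_rV R n) (@cons_rV R n).
Proof.
move=> x; apply/rowP => i; rewrite !mxE; case: unliftP => [j ->|->] //=.
by rewrite mxE.
Qed.

Lemma ge0_integral_cons n (f : 'rV[R]_n.+1 -> \bar R) :
  measurable_fun setT f -> (forall x, 0 <= f x)%E ->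
  (\int[lebesgue_rV R n.+1]_x f x =
   \int[@lebesgue_measure R]_a \int[lebesgue_rV R n]_y f (cons_rV (a, y)))%E.
Proof.
move=> mf f0.
have mg : measurable_fun setT (f \o @cons_rV R n).
  by apply: measurableT_comp mf _; exact: measurable_cons_rV.
rewrite /= /lebesgue_cons ge0_integral_pushforward //.
  rewrite preimage_setT.
  exact: (@fubini_tonelli1 _ _ _ _ _ lebesgue_measure (lebesgue_rV R n) _ mg (fun z => f0 _)).
exact: measurable_cons_rV.
Qed.

(** Tonelli splits off the first coordinate, which is translated by the one-dimensional case; the
    remaining ones follow by induction. *)
Lemma ge0_integral_rV_shift n (c : 'rV[R]_n) (f : 'rV[R]_n -> \bar R) :
  measurable_fun setT f -> (forall x, 0 <= f x)%E ->
  (\int[lebesgue_rV R n]_x f (x + c)%R = \int[lebesgue_rV R n]_x f x)%E.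
Proof.
elim: n c f => [c f _ _|n IHn c f mf f0].
  by apply: eq_integral => x _; congr f; apply/rowP => -[].
have ms : measurable_fun setT (fun x : 'rV[R]_n.+1 => x + c).
  apply: measurable_fun_coordP => i; under eq_fun do rewrite mxE.
  by apply: measurable_funD => //; exact: measurable_coord.
rewrite ge0_integral_cons //; last exact: measurableT_comp ms.
rewrite ge0_integral_cons //.
rewrite -[c]uncons_rVK; case: (uncons_rV c) => c0 c'.
have mg : measurable_fun setT (f \o @cons_rV R n).
  by apply: measurableT_comp mf _; exact: measurable_cons_rV.
under eq_integral => a _.
  under eq_integral do rewrite cons_rVD.
  rewrite (IHn c' (fun y => f (cons_rV (a + c0, y)))) //; last first.
    exact: (measurableT_comp mg (measurable_pair1 _)).
  over.
rewrite (ge0_integral_lebesgue_shift c0 (f := fun a => \int[lebesgue_rV R n]_y f (cons_rV (a, y)))%E) //.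
  exact: (@measurable_fun_fubini_tonelli_F _ _ _ _ _ (lebesgue_rV R n) _ mg (fun z => f0 _)).
by move=> a; apply: integral_ge0 => y _.
Qed.

End lebesgue_rV_facts.

(** * Calculus *)

Section Ck_theory.
Context {R : realType} {V : normedModType R}.
Implicit Types (f g p : V -> R) (k : nat).

Lemma Ck_continuous k f : Ck k f -> continuous f.
Proof. by case: k => [//|k [df _]] x; exact: differentiable_continuous. Qed.

Lemma CkS k f : Ck k.+1 f -> Ck k f.
Proof.
elim: k f => [|k IH] f [df Df]; first by move=> x; exact: differentiable_continuous.
by split=> // v; exact: IH (Df v).
Qed.

Lemma Ck_cst k (c : R) : Ck k (cst c : V -> R).
Proof.
elim: k c => [|k IH] c; first by move=> x; exact: cst_continuous.
split=> [x|v]; first exact: differentiable_cst.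
rewrite (_ : 'D_v _ = cst 0); first exact: IH.
by apply/funext => x; rewrite derive_cst.
Qed.

Lemma CkD k f g : Ck k f -> Ck k g -> Ck k (f + g).
Proof.
elim: k f g => [|k IH] f g; first by move=> cf cg x; apply: cvgD; [exact: cf|exact: cg].
move=> [df Df] [dg Dg]; split=> [x|v]; first exact: differentiableD.
rewrite (_ : 'D_v _ = 'D_v f + 'D_v g); first by apply: IH; [exact: Df|exact: Dg].
by apply/funext => x; rewrite deriveD//; exact: diff_derivable.
Qed.

Lemma CkM k f g : Ck k f -> Ck k g -> Ck k (f * g).
Proof.
elim: k f g => [|k IH] f g; first by move=> cf cg x; apply: cvgM; [exact: cf|exact: cg].
move=> Cf Cg; have cf := CkS Cf; have cg := CkS Cg; case: Cf Cg => df Df [dg Dg].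
split=> [x|v]; first exact: differentiableM.
rewrite (_ : 'D_v _ = f * 'D_v g + g * 'D_v f); first by apply: CkD; apply: IH => //; [exact: Dg|exact: Df].
by apply/funext => x; rewrite deriveM//; exact: diff_derivable.
Qed.

Lemma Ck_sum k n (f : 'I_n -> V -> R) :
  (forall i, Ck k (f i)) -> Ck k (\sum_(i < n) f i).
Proof.
by move=> cf; apply: (big_ind (Ck k)) => //; [exact: Ck_cst|exact: CkD].
Qed.

Lemma Ck_linear k (l : {linear V -> R}) : continuous l -> Ck k l.
Proof.
move=> cl; case: k => // k; split=> [x|v]; first exact: linear_differentiable.
rewrite (_ : 'D_v l = cst (l v)); first exact: Ck_cst.
by apply/funext => x; rewrite deriveE ?diff_lin//; exact: linear_differentiable.
Qed.

Lemma differentiable_comp1 (b : R -> R) (db : R) p x :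
  differentiable p x -> is_derive (p x) 1 b db ->
  differentiable (b \o p) x /\ forall v, 'D_v (b \o p) x = db * 'D_v p x.
Proof.
move=> dp [/derivable1_diffP dvb eb].
have dbp : differentiable (b \o p) x by exact: differentiable_comp.
split=> // v; rewrite !deriveE//= diff_comp//= diff1E// derive1E eb.
by rewrite /= mulrC.
Qed.

(** A smooth outer function is given as the sequence of its successive derivatives. The induction
    runs over all [j] at once because differentiating [b j \o p] produces [b j.+1 \o p]. *)
Lemma Ck_comp (b : nat -> R -> R) :
  (forall j (s : R), is_derive s (1 : R) (b j) (b j.+1 s)) ->
  forall k j p, Ck k p -> Ck k (b j \o p).
Proof.
move=> db; elim=> [|k IH] j p /=.
  move=> cp x; apply: continuous_comp; first exact: cp.
  by apply/differentiable_continuous/derivable1_diffP; case: (db j (p x)).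
move=> [dp Dp]; split=> [x|v].
  by have [] := differentiable_comp1 (dp x) (db j (p x)).
rewrite (_ : 'D_v _ = (b j.+1 \o p) * 'D_v p).
  by apply: CkM => //; apply: IH; exact: CkS.
by apply/funext => x; have [_ ->] := differentiable_comp1 (dp x) (db j (p x)).
Qed.

(** Serves at the points where the differentiation rules break down: the origin for powers of the
    norm, and 0 for [expinv] and for [pos]. *)
Lemma differentiable_littleo0 f x :
  (forall e, 0 < e -> \forall y \near 0, `|f (y + x) - f x| <= e * `|y|) ->
  differentiable f x /\ forall v, 'D_v f x = 0.
Proof.
move=> fo.
have c0 : continuous (0 : V -> R) by exact: cst_continuous.
have E : f \o shift x = cst (f x) + \0 +o_ (0 : V) id.
  apply/eqaddoP => e e0; near=> y => /=; rewrite /= addr0.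
  by near: y; exact: fo.
have df0 : 'd f x = \0 :> (V -> R) by exact: (diff_unique (df := \0)).
have df : differentiable f x by apply/diff_locallyP; rewrite df0.
by split=> // v; rewrite deriveE// df0.
Unshelve. all: by end_near. Qed.

End Ck_theory.

(** * Smooth bump functions built from [exp(-1/s)] *)

Section bump.
Context {R : realType}.
Implicit Types (p : {poly R}) (s : R).

(** The functions [p(1/s) exp(-1/s)], extended by 0 to [s <= 0], form a family closed under
    differentiation, which is what [Ck_comp] asks for. *)
Definition expinv p s : R := if 0 < s then p.[s^-1] * expR (- s^-1) else 0.

(** For [s > 0] the derivative of [p(1/s) exp(-1/s)] is [s^-2 (p - p')(1/s) exp(-1/s)]. *)
Definition expinv_step p : {poly R} := 'X^2 * (p - p^`()).

(** From [y^(i+2) / (i+2)! <= exp y] at [y = 1/s]. A quadratic bound is just enough for a zero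
    derivative at [s = 0], the point where the two branches meet. *)
Lemma expinv_bound p : exists C : R, forall s, `|expinv p s| <= C * `|s| ^+ 2.
Proof.
exists (\sum_(i < size p) `|p`_i| * (i.+2)`!%:R) => s.
rewrite /expinv; case: ifPn => s0; last first.
  by rewrite normr0 mulr_ge0// sumr_ge0// => i _; rewrite mulr_ge0.
rewrite (gtr0_norm s0) horner_coef mulr_suml mulr_suml.
apply: (le_trans (ler_norm_sum _ _ _)); apply: ler_sum => i _.
have y0 : 0 < s^-1 by rewrite invr_gt0.
rewrite -mulrA normrM -mulrA ler_wpM2l//.
have s2 : s ^+ 2 = (s^-1 ^+ 2)^-1 by rewrite exprVn invrK.
rewrite ger0_norm ?mulr_ge0 ?expR_ge0 ?exprn_ge0 ?(ltW y0)// expRN s2.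
rewrite ler_pdivlMr ?exprn_gt0// mulrAC -exprD addn2 ler_pdivrMr ?expR_gt0//.
rewrite mulrC -ler_pdivrMr ?ltr0n ?fact_gt0//.
by apply: le_trans (expR_ge1Dxn i.+1 (ltW y0)); rewrite lerDr.
Qed.

Lemma is_derive_expinv p s : is_derive s 1 (expinv p) (expinv (expinv_step p) s).
Proof.
have [s0|s0|->] := ltrgt0P s.
- have E : \forall t \near s, p.[t^-1] * expR (- t^-1) = expinv p t.
    by near=> t; rewrite /expinv ifT//; near: t; exact: lt_nbhsr.
  apply: near_eq_is_derive E _.
  have s_neq0 : s != 0 by rewrite gt_eqF.
  have dV : is_derive s (1 : R) (fun t : R => t^-1) (- s ^- 2 *: 1).
    exact: is_deriveV.
  have dp : is_derive s 1 (horner p \o (fun t : R => t^-1)) (p^`().[s^-1] * (- s ^- 2 *: 1)).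
    by apply: is_derive1_comp.
  have de : is_derive s 1 (expR \o (fun t : R => - t^-1)) (expR (- s^-1) * (- (- s ^- 2 *: 1))).
    by apply: is_derive1_comp.
  apply: (is_derive_eq (is_deriveM dp de)).
  rewrite /expinv s0 /expinv_step !hornerE /=.
  by rewrite /GRing.scale/= -!exprVn; ring.
- have E : \forall t \near s, cst 0 t = expinv p t.
    near=> t; rewrite /expinv ltNge ltW//=; near: t; exact: lt_nbhsl.
  apply: near_eq_is_derive E _; rewrite /expinv ltNge ltW//=.
  exact: is_derive_cst.
- have [C hC] := expinv_bound p.
  have [|df D0] := @differentiable_littleo0 _ R (expinv p) 0.
    move=> e e0; near=> y; rewrite addr0 [expinv p 0]/expinv ltxx subr0.
    apply: (le_trans (hC y)); rewrite expr2 mulrA ler_wpM2r//.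
    apply: (@le_trans _ _ (`|C| * `|y|)); first by rewrite ler_wpM2r// ler_norm.
    apply: (@le_trans _ _ ((`|C| + 1) * `|y|)); first by rewrite ler_wpM2r// lerDl.
    rewrite mulrC -ler_pdivlMr ?ltr_wpDl//.
    by apply/ltW; near: y; apply: (@nbhs0_lt R R); rewrite divr_gt0// ltr_wpDl.
  rewrite /expinv ltxx; split; last by rewrite D0.
  exact/derivable1_diffP.
Unshelve. all: by end_near. Qed.

Definition expinv_iter j : {poly R} := iter j expinv_step 1.

Lemma expinv_iterP j s :
  is_derive s 1 (expinv (expinv_iter j)) (expinv (expinv_iter j.+1) s).
Proof. exact: is_derive_expinv. Qed.

Definition bump0 := expinv 1.

Lemma bump0_ge0 s : 0 <= bump0 s.
Proof.
by rewrite /bump0/expinv; case: ifP => // _; rewrite hornerE mul1r expR_ge0.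
Qed.

Lemma bump0_gt0 s : (0 < bump0 s) = (0 < s).
Proof.
by rewrite /bump0/expinv; case: ifP => // _; rewrite hornerE mul1r expR_gt0.
Qed.

Lemma Cinfty_bump0 (V : normedModType R) (p : V -> R) :
  Cinfty p -> Cinfty (bump0 \o p).
Proof.
move=> cp k.
exact: (@Ck_comp _ _ (fun j => expinv (expinv_iter j)) expinv_iterP k 0 p (cp k)).
Qed.

End bump.

Section powR_continuity.
Context {R : realType}.

Lemma continuous_at0P (T : topologicalType) (f : T -> R) (x : T) : f x = 0 ->
  {for x, continuous f} <-> forall e, 0 < e -> \forall y \near x, `|f y| < e.
Proof.
move=> fx0; split.
  move=> cf; have : f y @[y --> x] --> f x by [].
  by rewrite fx0 => /cvgr0Pnorm_lt.
by move=> h; suff: f y @[y --> x] --> f x by []; rewrite fx0; apply/cvgr0Pnorm_lt.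
Qed.

(** Where [f x > 0] the power is differentiable. At a zero of [f] it need not be when [a < 1], and
    there [f y < e^(1/a)] is used instead. *)
Lemma continuous_powR (T : topologicalType) (f : T -> R) (a : R) (x : T) :
  0 < a -> (\forall y \near x, 0 <= f y) -> {for x, continuous f} ->
  {for x, continuous (fun y => f y `^ a)}.
Proof.
move=> a0 f0 cf; have := nbhs_singleton f0; rewrite le_eqVlt => /predU1P[fx0|fx0].
  suff: f y `^ a @[y --> x] --> f x `^ a by [].
  rewrite -fx0 powR0 ?gt_eqF//; apply/cvgr0Pnorm_lt => e e0.
  have ea0 : 0 < e `^ a^-1 by rewrite powR_gt0.
  have fe : \forall y \near x, `|f y| < e `^ a^-1.
    have : f y @[y --> x] --> f x by [].
    by rewrite -fx0 => /cvgr0Pnorm_lt; exact.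
  near=> y; rewrite ger0_norm ?powR_ge0//.
  rewrite (_ : e = (e `^ a^-1) `^ a); last by rewrite -powRrM mulVf ?gt_eqF// powRr1// ltW.
  have fy0 : 0 <= f y by near: y.
  apply: gt0_ltr_powR; rewrite // ?nnegrE ?powR_ge0//.
  by rewrite -(ger0_norm fy0); near: y.
apply: (@continuous_comp _ _ _ f (@powR R ^~ a)) => //.
apply/differentiable_continuous/derivable1_diffP.
by have [] := is_derive1_powR a fx0.
Unshelve. all: by end_near. Qed.

End powR_continuity.

(** * Powers of the Euclidean norm up to second order *)

Section euclidean_norm.
Context {R : realType} {N : nat}.
Implicit Types (x v w : 'rV[R]_N).

Definition dot v x : R := \sum_(i < N) v ord0 i * x ord0 i.

(** The square of [enorm] is a polynomial, hence smooth also at the origin; [enorm_powR] turns all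
    powers of the norm into powers of [sqn]. *)
Definition sqn x : R := \sum_(i < N) x ord0 i ^+ 2.

Lemma dot_is_linear v : linear (dot v).
Proof.
move=> a x y; rewrite /dot scaler_sumr -big_split/=; apply: eq_bigr => i _.
by rewrite !mxE mulrDr mulrCA.
Qed.

HB.instance Definition _ v :=
  GRing.isLinear.Build R 'rV[R]_N R _ (dot v) (dot_is_linear v).

Lemma dot_continuous v : continuous (dot v).
Proof.
rewrite (_ : dot v = \sum_(i < N) (fun x : 'rV[R]_N => v ord0 i * x ord0 i)); last first.
  by apply/funext => x; rewrite fct_sumE.
apply: (big_ind (fun f : 'rV[R]_N -> R => continuous f)) => [x|f g cf cg x|i _ x]; first exact: cst_continuous.
- by apply: continuousD; [exact: cf|exact: cg].
- by apply: continuousM; [exact: cst_continuous|exact: coord_continuous].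
Qed.

Lemma sqnE x : sqn x = dot x x.
Proof. by apply: eq_bigr => i _; rewrite expr2. Qed.

Lemma sqn_ge0 x : 0 <= sqn x.
Proof. by apply: sumr_ge0 => i _; rewrite sqr_ge0. Qed.

Lemma sqn0 : sqn 0 = 0.
Proof. by rewrite sqnE linear0. Qed.

Lemma coord_sqn x i : x ord0 i ^+ 2 <= sqn x.
Proof.
by rewrite /sqn (bigD1 i)//= lerDl; apply: sumr_ge0 => j _; rewrite sqr_ge0.
Qed.

Lemma sqn_eq0 x : (sqn x == 0) = (x == 0).
Proof.
apply/eqP/eqP => [s0|->]; last exact: sqn0.
apply/rowP => i; rewrite mxE; apply/eqP; rewrite -sqrf_eq0 eq_le sqr_ge0 andbT.
by rewrite -s0 coord_sqn.
Qed.

Lemma sqn_gt0 x : (0 < sqn x) = (x != 0).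
Proof. by rewrite lt_def sqn_eq0 sqn_ge0 andbT. Qed.

Lemma normr_sqn x : `|x| ^+ 2 <= sqn x.
Proof.
rewrite -ler_sqrt ?sqn_ge0// sqrtr_sqr normr_id.
apply/rV_norm_leP => [|i]; first exact: sqrtr_ge0.
by rewrite -sqrtr_sqr ler_sqrt ?sqn_ge0// coord_sqn.
Qed.

Lemma sqn_normr x : sqn x <= N%:R * `|x| ^+ 2.
Proof.
apply: (@le_trans _ _ (\sum_(i < N) `|x| ^+ 2)).
  by apply: ler_sum => i _; rewrite -real_normK ?num_real// lerXn2r ?nnegrE ?rV_coord_le.
by rewrite sumr_const card_ord mulr_natl.
Qed.

Lemma dot_basis x i : dot (basis_rV i) x = x ord0 i.
Proof.
rewrite /dot (bigD1 i)//= mxE !eqxx mul1r big1 ?addr0// => j ji.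
by rewrite mxE eqxx/= (negbTE ji) mul0r.
Qed.

Lemma sqn_fun : sqn = \sum_(i < N) ((dot (basis_rV i) : 'rV[R]_N -> R) * dot (basis_rV i)).
Proof.
apply/funext => x; rewrite fct_sumE; apply: eq_bigr => i _.
by rewrite expr2 -dot_basis.
Qed.

Lemma Cinfty_dot v : Cinfty (dot v).
Proof. by move=> k; apply: Ck_linear; exact: dot_continuous. Qed.

Lemma Cinfty_sqn : Cinfty sqn.
Proof.
by move=> k; rewrite sqn_fun; apply: Ck_sum => i; apply: CkM; exact: Cinfty_dot.
Qed.

Lemma derive_dot v w x : 'D_w (dot v) x = dot v w.
Proof.
rewrite deriveE ?diff_lin//; first exact: dot_continuous.
by apply: linear_differentiable; exact: dot_continuous.
Qed.

Lemma derive_sqn v x : 'D_v sqn x = 2 * dot v x.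
Proof.
rewrite sqn_fun.
have df i y : derivable (dot (basis_rV i) : 'rV[R]_N -> R) y v.
  by apply: diff_derivable; apply: linear_differentiable; exact: dot_continuous.
rewrite derive_sum; last by move=> i; apply: derivableM.
under eq_bigr do rewrite deriveM// derive_dot !dot_basis.
rewrite /dot mulr_sumr; apply: eq_bigr => i _.
by rewrite /GRing.scale/= mulrC -mulr2n mulr_natl mulrC.
Qed.

Lemma sqn_continuous : continuous sqn.
Proof. exact: (Ck_continuous (Cinfty_sqn 0)). Qed.

Lemma continuous_sqn_powR (a : R) : 0 < a -> continuous (fun x => sqn x `^ a).
Proof.
move=> a0 x; apply: continuous_powR => //; last exact: sqn_continuous.
near=> y; exact: sqn_ge0.
Unshelve. all: by end_near. Qed.

Lemma near0_sqn_powR (a e : R) : 0 < a -> 0 < e ->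
  \forall y \near (0 : 'rV[R]_N), `|sqn y `^ a| < e.
Proof.
move=> a0; apply: (continuous_at0P _).1; first by rewrite sqn0 powR0 ?gt_eqF.
exact: continuous_sqn_powR.
Qed.

Lemma enormE x : enorm x = Num.sqrt (sqn x). Proof. by []. Qed.

Lemma enorm_powR x a : enorm x `^ a = sqn x `^ (a / 2).
Proof. by rewrite enormE -powR12_sqrt ?sqn_ge0// -powRrM mulrC. Qed.

Lemma dot_bound v : exists C : R, 0 <= C /\ forall x, `|dot v x| <= C * sqn x `^ 2^-1.
Proof.
exists (\sum_(i < N) `|v ord0 i|); split; first exact: sumr_ge0.
move=> x; rewrite powR12_sqrt ?sqn_ge0// mulr_suml.
apply: (le_trans (ler_norm_sum _ _ _)); apply: ler_sum => i _.
by rewrite normrM ler_wpM2l// -sqrtr_sqr ler_sqrt ?sqn_ge0// coord_sqn.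
Qed.

(** [sqn] is comparable to the square of the norm, so an exponent above 1/2 makes the bound a
    little-o of the norm at 0. *)
Lemma sqn_powR_littleo (f : 'rV[R]_N -> R) (C b : R) : 2^-1 < b ->
  (forall x, `|f x| <= C * sqn x `^ b) ->
  differentiable f 0 /\ forall v, 'D_v f 0 = 0.
Proof.
move=> b2 fC; apply: differentiable_littleo0 => e e0.
have f0 : f 0 = 0.
  apply/eqP; rewrite -normr_le0; apply: (le_trans (fC 0)).
  by rewrite sqn0 powR0 ?mulr0// gt_eqF// (lt_trans _ b2).
have bb : 0 < b - 2^-1 by rewrite subr_gt0.
pose K : R := `|C| * Num.sqrt N%:R + 1.
have K0 : 0 < K by rewrite ltr_wpDl// mulr_ge0// sqrtr_ge0.
have near_s : \forall y \near (0 : 'rV[R]_N), `|sqn y `^ (b - 2^-1)| < e / K.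
  by apply: near0_sqn_powR => //; exact: divr_gt0.
near=> y; rewrite addr0 f0 subr0; apply: (le_trans (fC y)).
have -> : sqn y `^ b = sqn y `^ (b - 2^-1) * sqn y `^ 2^-1.
  by rewrite -powRD ?subrK// gt_eqF// (lt_trans _ b2).
have s1 : sqn y `^ (b - 2^-1) <= e / K.
  rewrite -(ger0_norm (powR_ge0 (sqn y) (b - 2^-1))); apply/ltW; near: y; exact: near_s.
have s2 : sqn y `^ 2^-1 <= Num.sqrt N%:R * `|y|.
  rewrite powR12_sqrt ?sqn_ge0// -[in leRHS](normr_id y) -sqrtr_sqr -sqrtrM ?ler0n//.
  by rewrite ler_sqrt ?sqn_normr// mulr_ge0 ?sqr_ge0.
apply: (@le_trans _ _ (`|C| * (e / K * (Num.sqrt N%:R * `|y|)))).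
  apply: (@le_trans _ _ (`|C| * (sqn y `^ (b - 2^-1) * sqn y `^ 2^-1))).
    by rewrite ler_wpM2r ?mulr_ge0 ?powR_ge0// ler_norm.
  by rewrite ler_wpM2l// ler_pM ?powR_ge0.
have -> : `|C| * (e / K * (Num.sqrt N%:R * `|y|)) = e * `|y| * (`|C| * Num.sqrt N%:R / K).
  by ring.
by rewrite ler_piMr ?mulr_ge0 ?(ltW e0)// ler_pdivrMr// mul1r lerDl.
Unshelve. all: by end_near. Qed.

(** At the origin both sides vanish, the right one through [dot v 0 = 0], whatever value the power
    has there; elsewhere this is the chain rule. *)
Lemma derive_sqn_powR (p : R) v x : 2^-1 < p ->
  differentiable (fun y => sqn y `^ p) x /\
  'D_v (fun y => sqn y `^ p) x = 2 * p * sqn x `^ (p - 1) * dot v x.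
Proof.
move=> p2; have [->|x0] := eqVneq x 0.
  have [|df Df] := @sqn_powR_littleo (fun y => sqn y `^ p) 1 p p2.
    by move=> y; rewrite mul1r ger0_norm// powR_ge0.
  by split=> //; rewrite Df (linear0 (dot v)) mulr0.
have s0 : 0 < sqn x by rewrite sqn_gt0.
have [ds _] := Cinfty_sqn 1.
have [? ->] := differentiable_comp1 (ds x) (is_derive1_powR p s0).
by split=> //; rewrite derive_sqn; ring.
Qed.

Lemma derive_sqn_powR_dot (a : R) v w x : 0 < a ->
  differentiable (fun y => sqn y `^ a * dot v y) x /\
  'D_w (fun y => sqn y `^ a * dot v y) x =
    sqn x `^ a * dot v w + 2 * a * sqn x `^ (a - 1) * dot w x * dot v x.
Proof.
move=> a0; have [->|x0] := eqVneq x 0.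
  have [C [C0 hC]] := dot_bound v.
  have [||df Df] := @sqn_powR_littleo (fun y => sqn y `^ a * dot v y) C (a + 2^-1).
  - by rewrite ltrDr.
  - move=> y; rewrite normrM ger0_norm ?powR_ge0// powRD; last first.
      by rewrite gt_eqF// addr_gt0.
    by rewrite mulrCA ler_wpM2l ?powR_ge0.
  by split=> //; rewrite Df sqn0 powR0 ?gt_eqF// (linear0 (dot v)) mul0r mulr0 addr0.
have s0 : 0 < sqn x by rewrite sqn_gt0.
have [ds _] := Cinfty_sqn 1.
have [dp Dp] := differentiable_comp1 (ds x) (is_derive1_powR a s0).
have [dv _] := Cinfty_dot v 1.
split; first exact: (differentiableM dp (dv x)).
rewrite (deriveM (diff_derivable dp) (diff_derivable (dv x))).
by rewrite Dp derive_sqn derive_dot /GRing.scale/=; ring.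
Qed.

(** The singular factor [sqn y ^ (a - 1)] is compensated by the two linear ones, each at most a
    constant times the norm: the product is bounded by a multiple of [sqn y ^ a], which tends to
    0. *)
Lemma continuous_sqn_powR_dot2 (a : R) v w : 0 < a ->
  continuous (fun y => sqn y `^ (a - 1) * dot w y * dot v y).
Proof.
move=> a0 x; have [->|x0] := eqVneq x 0.
  have [C [C0 hC]] := dot_bound v.
  have [D [D0 hD]] := dot_bound w.
  apply: (continuous_at0P _).2 => [|e e0]; first by rewrite (linear0 (dot v)) mulr0.
  have CD0 : 0 < C * D + 1 by rewrite ltr_wpDl ?mulr_ge0.
  have near_s : \forall y \near (0 : 'rV[R]_N), `|sqn y `^ a| < e / (C * D + 1).
    by apply: near0_sqn_powR => //; exact: divr_gt0.
  near=> y.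
  have : `|sqn y `^ a| < e / (C * D + 1) by near: y; exact: near_s.
  rewrite ger0_norm ?powR_ge0// ltr_pdivlMr//; apply: le_lt_trans.
  rewrite !normrM ger0_norm ?powR_ge0//.
  apply: (@le_trans _ _ (sqn y `^ (a - 1) * (D * sqn y `^ 2^-1) * (C * sqn y `^ 2^-1))).
    by rewrite ler_pM ?mulr_ge0 ?powR_ge0// ler_wpM2l ?powR_ge0.
  have -> : sqn y `^ (a - 1) * (D * sqn y `^ 2^-1) * (C * sqn y `^ 2^-1) =
      (sqn y `^ 2^-1) ^+ 2 * sqn y `^ (a - 1) * (C * D) by ring.
  rewrite powR12_sqrt ?sqn_ge0// sqr_sqrtr ?sqn_ge0// mulr_powRB1 ?sqn_ge0//.
  by rewrite ler_wpM2l ?powR_ge0// lerDl.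
have sx0 : 0 < sqn x by rewrite sqn_gt0.
have c1 : {for x, continuous (fun y => sqn y `^ (a - 1))}.
  apply: (@continuous_comp _ _ _ sqn (@powR R ^~ (a - 1))); first exact: sqn_continuous.
  apply/differentiable_continuous/derivable1_diffP.
  by have [] := is_derive1_powR (a - 1) sx0.
have cw : {for x, continuous (dot w)} by exact: dot_continuous.
have cv : {for x, continuous (dot v)} by exact: dot_continuous.
exact: (continuousM (continuousM c1 cw) cv).
Unshelve. all: by end_near. Qed.

Lemma Ck2_sqn_powR (c p : R) : 1 < p -> Ck 2 (fun y => c * sqn y `^ p).
Proof.
move=> p1; have p2 : 2^-1 < p by rewrite (lt_trans _ p1)// invf_lt1 ?ltr1n.
suff h : Ck 2 (fun y => sqn y `^ p) by exact: (CkM (@Ck_cst _ _ _ c) h).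
split=> [x|v]; first by have [] := @derive_sqn_powR p 0 x p2.
have -> : 'D_v (fun y => sqn y `^ p) =
    cst (2 * p) * (fun y => sqn y `^ (p - 1) * dot v y).
  apply/funext => x; have [_ ->] := @derive_sqn_powR p v x p2.
  by rewrite -[RHS]/(2 * p * (sqn x `^ (p - 1) * dot v x)) mulrA.
apply: CkM; first exact: Ck_cst.
have p1' : 0 < p - 1 by rewrite subr_gt0.
split=> [x|w]; first by have [] := derive_sqn_powR_dot v 0 x p1'.
rewrite (_ : 'D_w _ = (fun x => sqn x `^ (p - 1)) * cst (dot v w) +
   cst (2 * (p - 1)) * (fun x => sqn x `^ (p - 1 - 1) * dot w x * dot v x)).
  move=> x; apply: continuousD.
    by apply: continuousM; [exact: continuous_sqn_powR|exact: cst_continuous].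
  by apply: continuousM; [exact: cst_continuous|exact: continuous_sqn_powR_dot2].
apply/funext => x; have [_ ->] := derive_sqn_powR_dot v w x p1'.
rewrite -[RHS]/(sqn x `^ (p - 1) * dot v w + 2 * (p - 1) * (sqn x `^ (p - 1 - 1) * dot w x * dot v x)).
by ring.
Qed.

Lemma laplacian_sqn_powR (c p : R) x : 1 < p ->
  laplacian (fun y => c * sqn y `^ p) x =
  c * (2 * p * (N%:R + 2 * p - 2)) * sqn x `^ (p - 1).
Proof.
move=> p1; have p2 : 2^-1 < p by rewrite (lt_trans _ p1)// invf_lt1 ?ltr1n.
have p1' : 0 < p - 1 by rewrite subr_gt0.
rewrite /laplacian /partial.
have D1 i : 'D_(basis_rV i) (fun y => c * sqn y `^ p) =
    cst (2 * p * c) * (fun y => sqn y `^ (p - 1) * dot (basis_rV i) y).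
  apply/funext => y; have [d D] := @derive_sqn_powR p (basis_rV i) y p2.
  rewrite -[LHS]/('D_(basis_rV i) (cst c * (fun y => sqn y `^ p)) y).
  rewrite deriveM//; last exact: diff_derivable.
  by rewrite D derive_cst scaler0 addr0 /GRing.scale/=; rewrite -[RHS]/(2 * p * c * (sqn y `^ (p - 1) * dot (basis_rV i) y)); ring.
have D2 i : 'D_(basis_rV i) ('D_(basis_rV i) (fun y => c * sqn y `^ p)) x =
   2 * p * c * (sqn x `^ (p - 1) + 2 * (p - 1) * sqn x `^ (p - 1 - 1) * x ord0 i ^+ 2).
  rewrite D1; have [d D] := derive_sqn_powR_dot (basis_rV i) (basis_rV i) x p1'.
  rewrite deriveM//; last exact: diff_derivable.
  rewrite D derive_cst scaler0 addr0 /GRing.scale/= !dot_basis mxE !eqxx.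
  by rewrite /= expr2; ring.
under eq_bigr do rewrite D2.
rewrite -mulr_sumr big_split/= sumr_const card_ord -mulr_sumr -/(sqn x).
rewrite -(mulrA _ (sqn x `^ _)).
have -> : sqn x `^ (p - 1 - 1) * sqn x = sqn x `^ (p - 1).
  by rewrite mulrC mulr_powRB1// sqn_ge0.
by rewrite -mulr_natr; ring.
Qed.

End euclidean_norm.

(** * Young's inequality and tangent lines to powers *)

Section young.
Context {R : realType}.
Implicit Types (m q a b c r x y : R).

Lemma powRD_gt0 x a b : 0 < x -> x `^ (a + b) = x `^ a * x `^ b.
Proof. by move=> x0; rewrite powRD // (gt_eqF x0) implybT. Qed.

(* Weighted AM-GM, through the tangent line to [exp]. *)
Lemma young_powR m q r : 0 <= q -> q < 1 -> 1 < m -> 0 <= r ->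
  (m - q) * r <= (m - 1) * r `^ q + (1 - q) * r `^ m.
Proof.
move=> q0 q1 m1; rewrite le_eqVlt => /predU1P[<-|r0].
  by rewrite mulr0 addr_ge0// mulr_ge0 ?powR_ge0// subr_ge0 ltW.
have E a : r `^ a = r * expR ((a - 1) * ln r).
  rewrite {1}/powR gt_eqF// -{2}[r]lnK ?posrE// -expRD; congr expR.
  by rewrite mulrBl mul1r addrC subrK.
rewrite !E; set L := ln r.
have h1 : 0 <= (m - 1) * (expR ((q - 1) * L) - (1 + (q - 1) * L)).
  by rewrite mulr_ge0// subr_ge0 ?expR_ge1Dx// ltW.
have h2 : 0 <= (1 - q) * (expR ((m - 1) * L) - (1 + (m - 1) * L)).
  by rewrite mulr_ge0// subr_ge0 ?expR_ge1Dx// ltW.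
rewrite -subr_ge0; apply: (le_trans (mulr_ge0 (ltW r0) (addr_ge0 h1 h2))).
by rewrite le_eqVlt; apply/orP; left; apply/eqP; ring.
Qed.

(* With [k = c x^(q-1)] and [t = r/x], the defect [1 - t - k (1 - t^q) -
   (1 - q k)/m (1 - t^m)] is affine in [k], and it is nonnegative for [k = 0]
   and for [k = (m-1)/(m-q)] by Young's inequality. *)
Lemma tangent_powR m q c x r : 0 <= q -> q < 1 -> 1 < m ->
  0 < x -> 0 <= c -> c * (m - q) <= (m - 1) * x `^ (1 - q) -> 0 <= r ->
  (1 - q * (c * x `^ (q - 1))) * x / m * (1 - (r / x) `^ m) <=
    x - r - c * (x `^ q - r `^ q).
Proof.
move=> q0 q1 m1 x0 c0 ck r0.
have xq0 : 0 < x `^ (q - 1) by rewrite powR_gt0.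
have xV : x `^ (1 - q) * x `^ (q - 1) = 1.
  by rewrite -powRD_gt0// (_ : 1 - q + (q - 1) = 0) ?powRr0//; ring.
have xq : x `^ q = x * x `^ (q - 1).
  by rewrite -{2}[x]powRr1 ?(ltW x0)// -powRD_gt0//; congr powR; ring.
set k := c * x `^ (q - 1); set t := r / x.
have t0 : 0 <= t by rewrite divr_ge0// ltW.
have rE : r = x * t by rewrite /t mulrCA divff ?mulr1 // gt_eqF.
have k0 : 0 <= k by rewrite mulr_ge0// ltW.
have kk : 0 <= (m - 1) - k * (m - q).
  rewrite subr_ge0 /k mulrAC -ler_pdivlMr//.
  apply: (le_trans ck); rewrite ler_pdivlMr//.
  by rewrite -mulrA xV mulr1.
have Y1 := @young_powR m 0 t (lexx _) ltr01 m1 t0; rewrite powRr0 in Y1.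
have Y2 := @young_powR m q t q0 q1 m1 t0.
have m0 : 0 < m by rewrite (lt_trans _ m1).
have -> : x - r - c * (x `^ q - r `^ q) = x * (1 - t - k * (1 - t `^ q)).
  rewrite rE powRM ?(ltW x0)// xq /k; ring.
have -> : (1 - q * k) * x / m * (1 - t `^ m) = x * ((1 - q * k) * (1 - t `^ m) / m).
  by ring.
rewrite ler_pM2l// ler_pdivrMr//.
rewrite -subr_ge0 -(pmulr_rge0 _ (_ : 0 < m - 1)) ?subr_gt0//.
have h1 : 0 <= ((m - 1) - k * (m - q)) * ((m - 1) + t `^ m - m * t).
  by rewrite mulr_ge0//; lra.
have h2 : 0 <= m * (k * ((m - 1) * t `^ q + (1 - q) * t `^ m - (m - q) * t)).
  by rewrite mulr_ge0 ?(ltW m0)// mulr_ge0//; lra.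
apply: (le_trans (addr_ge0 h1 h2)).
by rewrite le_eqVlt; apply/orP; left; apply/eqP; ring.
Qed.

End young.

(** * The stationary profile *)

Section stationary_profile.
Context {R : realType} (N : nat) (m q sigma : R).
Hypotheses (m1 : 1 < m) (q0 : 0 < q) (q1 : q < 1).
Hypothesis (sigmaP : 2 * (1 - q) / (m - 1) < sigma).

Local Notation U := (@profile R N m q sigma).
Local Notation A := (@profile_coef R N m q sigma).
Local Notation gam := ((sigma + 2) / (m - q)).

Lemma profile_sigma_gt0 : 0 < sigma.
Proof.
by apply: lt_trans sigmaP; rewrite divr_gt0 ?mulr_gt0 ?subr_gt0.
Qed.
Let sigma0 := profile_sigma_gt0.

Let mq0 : 0 < m - q.
Proof. by rewrite subr_gt0 (lt_trans q1). Qed.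

Let m0 : 0 < m.
Proof. exact: lt_trans m1. Qed.

Let gam0 : 0 < gam.
Proof. by rewrite divr_gt0// addr_gt0. Qed.

Let sigma_mq : 2 * (1 - q) < sigma * (m - 1).
Proof. by rewrite -ltr_pdivrMr// subr_gt0. Qed.

Let den0 : 0 < m * (sigma + 2) * (m * (sigma + N%:R) - q * (N%:R - 2)).
Proof.
apply: mulr_gt0; first by rewrite mulr_gt0// addr_gt0.
have -> : m * (sigma + N%:R) - q * (N%:R - 2) = m * sigma + 2 * q + N%:R * (m - q) by ring.
by rewrite ltr_wpDr ?addr_gt0 ?mulr_gt0 ?mulr_ge0 ?(ltW mq0).
Qed.

Lemma profile_coef_gt0 : 0 < A.
Proof. by rewrite /profile_coef powR_gt0// divr_gt0// exprn_gt0. Qed.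
Let A0 := profile_coef_gt0.

Lemma profileE x : U x = A * sqn x `^ (gam / 2).
Proof. by rewrite /profile enorm_powR. Qed.

Lemma profile_ge0 x : 0 <= U x.
Proof. by rewrite profileE mulr_ge0 ?powR_ge0// ltW. Qed.

Lemma profile0 : U 0 = 0.
Proof. by rewrite profileE sqn0 powR0 ?mulr0// gt_eqF// divr_gt0. Qed.

Lemma profile_continuous : continuous U.
Proof.
move=> x; rewrite (_ : U = cst A \* (fun x => sqn x `^ (gam / 2))); last first.
  by apply/funext => y; rewrite profileE.
apply: continuousM; first exact: cst_continuous.
by apply: continuous_sqn_powR; rewrite divr_gt0.
Qed.

Lemma profile_powR a x : U x `^ a = A `^ a * sqn x `^ (gam * a / 2).
Proof.
rewrite profileE powRM ?powR_ge0 ?(ltW A0)// -powRrM.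
by congr (_ * powR _ _); ring.
Qed.

(** Amounts to [0 < sigma * m + 2 * q]; it is the exponent condition that makes [U^m] twice
    continuously differentiable at the origin. *)
Let p1 : 1 < gam * m / 2.
Proof.
rewrite ltr_pdivlMr// mul1r mulrAC ltr_pdivlMr//.
by rewrite mulrBr mulrDl; move: (mulr_gt0 sigma0 m0) q0 => ? ?; lra.
Qed.

Lemma profile_powRm_fun : (fun x => U x `^ m) = (fun x => A `^ m * sqn x `^ (gam * m / 2)).
Proof. by apply/funext => x; rewrite profile_powR. Qed.

Lemma Ck2_profile_powR : Ck 2 (fun x => U x `^ m).
Proof. by rewrite profile_powRm_fun; exact: Ck2_sqn_powR. Qed.

(** The exponent [gam] solves [gam * m - 2 = sigma + gam * q], so the powers of the norm agree on
    both sides; the coefficient [A] is the one with [A^(m-q) * K = 1]. *)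
Lemma laplacian_profile x :
  laplacian (fun y => U y `^ m) x = enorm x `^ sigma * U x `^ q.
Proof.
rewrite profile_powRm_fun laplacian_sqn_powR; last exact: p1.
rewrite (profile_powR q) enorm_powR.
have pE : gam * m / 2 - 1 = sigma / 2 + gam * q / 2.
  by field; rewrite gt_eqF.
have -> : sqn x `^ (gam * m / 2 - 1) = sqn x `^ (sigma / 2) * sqn x `^ (gam * q / 2).
  by rewrite pE powRD// -pE gt_eqF// subr_gt0.
have -> : A `^ m = A `^ (m - q) * A `^ q by rewrite -powRD_gt0// subrK.
set K := 2 * _ * _.
suff key : A `^ (m - q) * K = 1.
  transitivity (A `^ (m - q) * K * (A `^ q * sqn x `^ (sigma / 2) * sqn x `^ (gam * q / 2))).
    by ring.
  by rewrite key; ring.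
rewrite /profile_coef -powRrM mulVf ?gt_eqF// powRr1; last first.
  by rewrite divr_ge0 ?sqr_ge0// ltW.
have := den0; set D := (m * (sigma + N%:R) - q * (N%:R - 2)) => dd.
have -> : K = m * (sigma + 2) * D / (m - q) ^+ 2.
  by rewrite /K /D; field; rewrite gt_eqF.
by rewrite mulrA divfK ?divff ?expf_neq0 ?gt_eqF.
Qed.

Lemma profile_coercive (B : R) : exists2 r : R, 0 < r & forall x : 'rV[R]_N, r <= `|x| -> B <= U x.
Proof.
(* The solution of [A * r^gam = |B| + 1]; the sup norm used for [x] is at most the Euclidean norm in
   [U]. *)
pose r := ((`|B| + 1) / A) `^ gam^-1.
have r0 : 0 < r by rewrite powR_gt0// divr_gt0// ltr_wpDl.
exists r => // x rx.
apply: (@le_trans _ _ (A * r `^ gam)).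
  rewrite /r -powRrM mulVf ?gt_eqF// powRr1 ?divr_ge0 ?addr_ge0 ?(ltW A0)//.
  rewrite mulrCA divff ?gt_eqF// mulr1.
  by rewrite (le_trans (ler_norm _))// lerDl.
rewrite ler_wpM2l ?(ltW A0)//.
apply: ge0_ler_powR; rewrite ?(ltW gam0) ?nnegrE ?(ltW r0)// ?sqrtr_ge0//.
apply: (le_trans rx); rewrite enormE -(normr_id x) -sqrtr_sqr ler_sqrt ?sqn_ge0//.
exact: normr_sqn.
Qed.

Lemma profile_unbounded : (0 < N)%N -> ~ bounded_fun U.
Proof.
move=> N0 [M [Mr HM]].
have [r r0 hr] := profile_coercive (`|M| + 2).
pose x : 'rV[R]_N := const_mx r.
have rx : r <= `|x|.
  apply: le_trans (rV_coord_le x (Ordinal N0)).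
  by rewrite mxE ler_norm.
have : `|U x| <= `|M| + 1 by apply: HM => //; rewrite (le_lt_trans (ler_norm _))// ltrDl.
rewrite ger0_norm ?profile_ge0// => /(le_trans (hr _ rx)).
by rewrite lerD2l leNgt ltr1n.
Qed.

(** The norm to the power [sigma] is the norm to the power [gam * (1 - q)], which [U^(1-q)]
    supplies, times [sqn x ^ d]. The lower bound on [sigma] says exactly that [d > 0], so the extra
    factor stays bounded down to the origin. *)
Lemma profile_absorption (r : R) : exists2 h : R, 0 < h &
  forall x : 'rV[R]_N, `|x| <= r ->
    h * enorm x `^ sigma * (m - q) <= (m - 1) * U x `^ (1 - q).
Proof.
pose d := sigma / 2 - gam * (1 - q) / 2.
have d0 : 0 < d.
  have -> : d = (sigma * (m - 1) - 2 * (1 - q)) / (2 * (m - q)).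
    by rewrite /d; field; rewrite gt_eqF.
  by rewrite divr_gt0 ?mulr_gt0// subr_gt0.
pose S : R := N%:R * r ^+ 2.
have S0 : 0 <= S by rewrite mulr_ge0 ?sqr_ge0.
pose K := (m - q) * (S `^ d + 1).
have K0 : 0 < K by rewrite mulr_gt0// ltr_wpDl// powR_ge0.
have m10 : 0 < m - 1 by rewrite subr_gt0.
exists ((m - 1) * A `^ (1 - q) / K) => [|x xr].
  by rewrite divr_gt0// mulr_gt0// powR_gt0.
rewrite profile_powR enorm_powR.
have -> : sigma / 2 = gam * (1 - q) / 2 + d by rewrite /d; ring.
rewrite (powRD (x := sqn x)); last first.
  by rewrite gt_eqF// addr_gt0// divr_gt0// mulr_gt0// subr_gt0.
have sS : sqn x `^ d <= S `^ d + 1.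
  apply: (@le_trans _ _ (S `^ d)); last by rewrite lerDl.
  apply: ge0_ler_powR; rewrite ?(ltW d0) ?nnegrE ?sqn_ge0//.
  apply: (le_trans (sqn_normr x)); rewrite ler_wpM2l// lerXn2r ?nnegrE//.
  by rewrite (le_trans _ xr).
have -> : (m - 1) * A `^ (1 - q) / K * (sqn x `^ (gam * (1 - q) / 2) * sqn x `^ d) * (m - q) =
  (m - 1) * (A `^ (1 - q) * sqn x `^ (gam * (1 - q) / 2)) * (sqn x `^ d * (m - q) / K) by ring.
rewrite ler_piMr ?mulr_ge0 ?powR_ge0 ?(ltW m10)// ler_pdivrMr// mul1r /K mulrC.
by rewrite ler_wpM2l// ltW.
Qed.

Lemma profile_classical : classical_solution m q sigma (fun z : R * 'rV[R]_N => U z.2).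
Proof.
move=> t t0; split=> [|x]; first exact: Ck2_profile_powR.
have E : (fun h : R => h^-1 *: (((fun z => U z.2) \o shift (t, x)) (h *: ((1, 0) : R * 'rV[R]_N)) - U x)) = cst 0.
  by apply/funext => h /=; rewrite scaler0 add0r subrr scaler0.
split.
- by apply: continuous_comp; [exact: cvg_snd|exact: profile_continuous].
- by rewrite /derivable /= E; exact: is_cvg_cst.
- exact: profile_ge0.
- rewrite /time_partial /derive /= E lim_cst//= laplacian_profile.
  by rewrite sub0r addNr.
Qed.

End stationary_profile.

Section Rintegral_extra.
Context d (T : measurableType d) (R : realType) (mu : {measure set T -> \bar R}).

Lemma cvg_Rintegral (D : set T) (f_ : nat -> T -> R) (f g : T -> R) :
  measurable D -> (forall n, measurable_fun D (f_ n)) -> measurable_fun D f ->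
  {ae mu, forall x, D x -> f_ ^~ x @ \oo --> f x} -> mu.-integrable D (EFin \o g) ->
  (forall n x, D x -> `|f_ n x| <= g x) ->
  (\int[mu]_(x in D) f_ n x) @[n --> \oo] --> \int[mu]_(x in D) f x.
Proof.
move=> mD mf_ mf fcv ig fg.
have mE n : measurable_fun D (EFin \o f_ n) by exact/measurable_EFinP.
have mfE : measurable_fun D (EFin \o f) by exact/measurable_EFinP.
have cE : {ae mu, forall x, D x -> (EFin \o f_ n) x @[n --> \oo] --> (EFin \o f) x}.
  move: fcv; apply: filterS => x h Dx; apply/fine_cvgP.
  by split; [exact: nearW|exact: h].
have gE : {ae mu, forall x n, D x -> (`|(EFin \o f_ n) x| <= (EFin \o g) x)%E}.
  by apply: aeW => x n Dx; rewrite /= lee_fin fg.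
have [fi _ h] := dominated_convergence mD mE mfE cE ig gE.
rewrite /Rintegral; apply: fine_cvg; rewrite fineK//.
exact: integrable_fin_num.
Qed.

End Rintegral_extra.

Section near_continuous.
Context {R : realType} {T : topologicalType}.

Lemma near_gt_continuous (f : T -> R) x a :
  {for x, continuous f} -> a < f x -> \forall y \near x, a < f y.
Proof. by move=> cf ax; apply: (cf [set s | a < s]); exact: lt_nbhsr. Qed.

Lemma near_lt_continuous (f : T -> R) x a :
  {for x, continuous f} -> f x < a -> \forall y \near x, f y < a.
Proof. by move=> cf ax; apply: (cf [set s | s < a]); exact: lt_nbhsl. Qed.

Lemma near_dist_continuous (f : T -> R) x :
  {for x, continuous f} <-> forall e, 0 < e -> \forall y \near x, `|f x - f y| <= e.
Proof.
split=> [cf e e0|h]; first by have /cvgrPdist_le := cf : f y @[y --> x] --> f x; exact.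
by suff: f y @[y --> x] --> f x by []; apply/cvgrPdist_le.
Qed.

End near_continuous.

(** * Test functions and integrals against them *)

Section test_space.
Context {R : realType} {N : nat}.
Implicit Types (f rho : 'rV[R]_N -> R) (x y v : 'rV[R]_N) (r : R).
Local Notation mu := (lebesgue_rV R N).

Lemma closed_norm_le r : closed [set x : 'rV[R]_N | `|x| <= r].
Proof.
rewrite (_ : mkset _ = normr @^-1` [set s : R | s <= r]) //.
by apply: closed_comp => [x _|]; [exact: norm_continuous|exact: closed_le].
Qed.

Lemma compact_norm_sub_le y r : compact [set x : 'rV[R]_N | `|x - y| <= r].
Proof.
apply: bounded_closed_compact.
  exists (r + `|y|); split; first exact: num_real.
  move=> s rs x /= xr; rewrite (le_trans _ (ltW rs))// -[x](subrK y).
  by rewrite (le_trans (ler_normD _ _))// lerD2r.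
rewrite (_ : mkset _ = (fun x => `|x - y|) @^-1` [set s : R | s <= r]) //.
apply: closed_comp => [x _|]; last exact: closed_le.
apply: continuous_comp; last exact: norm_continuous.
by apply: differentiable_continuous; apply: differentiableB.
Qed.

Lemma compact_norm_le r : compact [set x : 'rV[R]_N | `|x| <= r].
Proof.
apply: bounded_closed_compact; last exact: closed_norm_le.
exists r; split; first exact: num_real.
by move=> s rs x xr; apply: (le_trans xr); exact: ltW.
Qed.

Lemma measurable_norm_le r : measurable [set x : 'rV[R]_N | `|x| <= r].
Proof. by apply: closed_measurable_rV; exact: closed_norm_le. Qed.

Lemma norm_le_finite r : (mu [set x : 'rV[R]_N | (`|x| <= r)%R] < +oo)%E.
Proof. by apply: compact_lebesgue_rV; exact: compact_norm_le. Qed.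

Lemma integrable_bounded_supp f r C : measurable_fun setT f ->
  (forall x, `|f x| <= C) -> (forall x, r < `|x| -> f x = 0) ->
  mu.-integrable setT (EFin \o f).
Proof.
move=> mf fC fr.
have fi : mu.-integrable [set x : 'rV[R]_N | `|x| <= r] (EFin \o f).
  apply: measurable_bounded_integrable.
  - exact: measurable_norm_le.
  - exact: norm_le_finite.
  - exact: measurable_funTS.
  - exists C; split; first exact: num_real.
    by move=> c Cc x _ /=; rewrite (le_trans (fC x))// ltW.
have := (integrable_mkcond (EFin \o f) (measurable_norm_le r)).1 fi.
rewrite (_ : _ \_ _ = EFin \o f)//; apply/funext => x.
rewrite patchE; case: ifPn => //; rewrite notin_setE/= => /negP.
by rewrite -ltNge => /fr ->.
Qed.

Lemma continuous_bounded_norm_le f r : continuous f ->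
  exists C, 0 <= C /\ forall x, `|x| <= r -> `|f x| <= C.
Proof.
move=> cf.
have : compact (f @` [set x : 'rV[R]_N | `|x| <= r]).
  by apply: continuous_compact; [exact: continuous_subspaceT|exact: compact_norm_le].
move=> /compact_bounded[M [_ HM]]; exists (`|M| + 1); split; first by rewrite addr_ge0.
move=> x xr; apply: HM; last by exists x.
by rewrite (le_lt_trans (ler_norm _))// ltrDl.
Qed.

Lemma continuous_shift f v : continuous f -> continuous (fun x => f (x + v)).
Proof.
move=> cf x; apply: continuous_comp; last exact: cf.
by apply: differentiable_continuous; apply: differentiableD.
Qed.

Lemma measurable_shift f v : continuous f -> measurable_fun setT (fun x => f (x + v)).
Proof. by move=> cf; apply: continuous_measurable_rV; exact: continuous_shift. Qed.

Lemma integrable_cst_norm_le (c r : R) :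
  mu.-integrable setT (EFin \o (cst c \_ [set x : 'rV[R]_N | `|x| <= r])).
Proof.
rewrite (_ : EFin \o _ = (EFin \o cst c) \_ [set x : 'rV[R]_N | `|x| <= r]); last first.
  by apply/funext => x; rewrite /= !patchE; case: ifP.
apply: (integrable_mkcond _ (measurable_norm_le r)).1.
apply: measurable_bounded_integrable => //.
- exact: measurable_norm_le.
- exact: norm_le_finite.
- exists `|c|; split; first exact: num_real.
  by move=> d Cc x _; exact: ltW.
Qed.

Lemma continuous_supp_bounded f r : continuous f ->
  (forall x, r < `|x| -> f x = 0) -> exists C, 0 <= C /\ forall x, `|f x| <= C.
Proof.
move=> cf fr; have [C [C0 HC]] := continuous_bounded_norm_le r cf.
exists C; split=> // x; have [xr|/fr ->] := leP `|x| r; last by rewrite normr0.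
exact: HC.
Qed.

Lemma integrable_continuous_supp f r : continuous f ->
  (forall x, r < `|x| -> f x = 0) -> mu.-integrable setT (EFin \o f).
Proof.
move=> cf fr; have [C [_ fC]] := continuous_supp_bounded cf fr.
by apply: (integrable_bounded_supp _ fC fr); exact: continuous_measurable_rV.
Qed.

(** Compact support is encoded by an explicit radius, from which integrability and uniform bounds
    are immediate; [is_test_compact] recovers the compact [tsupport] required by [weak_gradient]. *)
Definition is_test rho := Cinfty rho /\ exists r, forall x, r < `|x| -> rho x = 0.

Lemma tsupport_sub rho r : (forall x, r < `|x| -> rho x = 0) ->
  tsupport rho `<=` [set x | `|x| <= r].
Proof.
move=> h; rewrite [X in _ `<=` X](closure_id _).1; last exact: closed_norm_le.
apply: closure_subset => x /= rx; rewrite leNgt; apply/negP => /h rx0.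
by rewrite rx0 eqxx in rx.
Qed.

Lemma is_test_compact rho : is_test rho -> compact (tsupport rho).
Proof.
move=> [_ [r h]]; have cl : closed (tsupport rho) by exact: closed_closure.
by apply: subclosed_compact cl _ (tsupport_sub h); exact: compact_norm_le.
Qed.

Lemma derive_supp rho r v : (forall x, r < `|x| -> rho x = 0) ->
  forall x, r < `|x| -> 'D_v rho x = 0.
Proof.
move=> h x rx; have E : \forall y \near x, cst 0 y = rho y.
  near=> y; rewrite h//; near: y.
  have cn : {for x, continuous (fun y : 'rV[R]_N => `|y|)} by exact: norm_continuous.
  exact: near_gt_continuous cn rx.
have : is_derive x v rho 0 by apply: near_eq_is_derive E _; exact: is_derive_cst.
by case.
Unshelve. all: by end_near. Qed.

Lemma is_test_derive rho v : is_test rho -> is_test ('D_v rho).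
Proof.
move=> [cr [r h]]; split; last by exists r; exact: derive_supp.
by move=> k; have [_] := cr k.+1; exact.
Qed.

Lemma is_test_continuous rho : is_test rho -> continuous rho.
Proof. by move=> [cr _]; exact: (Ck_continuous (cr 0%N)). Qed.

Lemma integrable_test f rho : continuous f -> is_test rho ->
  mu.-integrable setT (EFin \o (fun x => f x * rho x)).
Proof.
move=> cf tr; have [_ [r h]] := tr.
apply: (@integrable_continuous_supp _ r) => [x|x rx]; last by rewrite h ?mulr0.
apply: continuousM; [exact: cf|exact: is_test_continuous].
Qed.

Lemma is_test_laplacian rho : is_test rho -> is_test (laplacian rho).
Proof.
move=> tr; split.
  move=> k; rewrite (_ : laplacian rho = \sum_(i < N) partial i (partial i rho)).
    by apply: Ck_sum => i; have [] := is_test_derive (basis_rV i) (is_test_derive (basis_rV i) tr).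
  by apply/funext => x; rewrite fct_sumE.
have [_ [r h]] := tr; exists r => x rx; rewrite /laplacian big1// => i _.
exact: (derive_supp _ (derive_supp _ h)).
Qed.

(** Positive exactly on the open Euclidean ball of radius [e > 0] about [y]. Its dependence on
    [x - y] alone lets derivatives and differences in [y] be traded for those in [x]. *)
Definition bump (y : 'rV[R]_N) (e : R) x : R := bump0 (e ^+ 2 - sqn (x - y)).

Lemma sqnB x y : sqn (x - y) = sqn x - 2 * dot y x + sqn y.
Proof.
rewrite /sqn /dot mulr_sumr -sumrB -big_split/=; apply: eq_bigr => i _.
by rewrite !mxE; ring.
Qed.

Lemma Cinfty_sqn_shift y : Cinfty (fun x => sqn (x - y)).
Proof.
rewrite (_ : (fun x => _) = cst (sqn y) + (sqn + cst (- 2) * dot y)).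
  move=> k; apply: CkD; first exact: Ck_cst.
  by apply: CkD; [exact: Cinfty_sqn|apply: CkM; [exact: Ck_cst|exact: Cinfty_dot]].
apply/funext => x.
by rewrite -[RHS]/(sqn y + (sqn x + - 2 * dot y x)) sqnB; ring.
Qed.

Lemma derive_shift f v y x : 'D_v (fun z => f (z - y)) x = 'D_v f (x - y).
Proof.
rewrite /derive (_ : (fun h => _) = (fun h : R => h^-1 *: (f (h *: v + (x - y)) - f (x - y))))//.
by apply/funext => h /=; rewrite addrA.
Qed.

Lemma bump_ge0 y e x : 0 <= bump y e x. Proof. exact: bump0_ge0. Qed.

Lemma bump_gt0 y e : 0 < e -> 0 < bump y e y.
Proof. by move=> e0; rewrite bump0_gt0 subrr sqn0 subr0 exprn_gt0. Qed.

Lemma bump_supp y e x : 0 < e -> bump y e x != 0 -> `|x - y| < e.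
Proof.
move=> e0; have := bump_ge0 y e x; rewrite le_eqVlt eq_sym => /orP[->//|].
rewrite bump0_gt0 subr_gt0 => xe _.
by rewrite -(ltr_pXn2r (n := 2)) ?nnegrE ?(ltW e0)// (le_lt_trans (normr_sqn _)).
Qed.

Lemma is_test_bump y e : 0 < e -> is_test (bump y e).
Proof.
move=> e0; split.
  have : Cinfty (fun x : 'rV[R]_N => e ^+ 2 - sqn (x - y)).
    rewrite (_ : (fun x => _) = cst (e ^+ 2) + cst (-1) * (fun x => sqn (x - y))).
      move=> k; apply: CkD; first exact: Ck_cst.
      by apply: CkM; [exact: Ck_cst|exact: Cinfty_sqn_shift].
    apply/funext => x.
    by rewrite -[RHS]/(e ^+ 2 + (- 1 * sqn (x - y))) mulN1r.
  exact: Cinfty_bump0.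
exists (`|y| + e) => x xe; apply/eqP; apply: contraTT xe => /(bump_supp e0) xe.
by rewrite -leNgt -[x](subrK y) (le_trans (ler_normD _ _))// addrC lerD2l ltW.
Qed.

Lemma bump_shift y e x : bump y e x = bump 0 e (x - y).
Proof. by rewrite /bump subr0. Qed.

Lemma integral_bump_gt0 e : 0 < e -> 0 < \int[mu]_x bump 0 e x.
Proof.
move=> e0; have tb := is_test_bump 0 e0.
have cb := is_test_continuous tb.
set b := bump 0 e 0; have b0 : 0 < b by exact: bump_gt0.
have /nbhs_ballP[d /= d0 hd] : \forall x \near (0 : 'rV[R]_N), b / 2 < bump 0 e x.
  have c0 : {for 0, continuous (bump 0 e)} by exact: cb.
  by apply: near_gt_continuous c0 _; rewrite ltr_pdivrMr// ltr_pMr// ltr1n.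
have [_ [r hr]] := tb.
have mb : measurable (ball (0 : 'rV[R]_N) d) by apply: open_measurable_rV; exact: ball_open.
have ballfin : (mu (ball (0%R : 'rV[R]_N) d) < +oo)%E.
  by rewrite lebesgue_rV_ball// ltry.
have ib := integrable_continuous_supp cb hr.
apply: (@lt_le_trans _ _ (\int[mu]_(x in ball 0 d) (b / 2))).
  rewrite Rintegral_cst// mulr_gt0// ?divr_gt0//.
  suff: 0 < fine (lebesgue_rV R N (ball 0 d)) by [].
  by rewrite lebesgue_rV_ball//= exprn_gt0// mulrn_wgt0.
apply: (@le_trans _ _ (\int[mu]_(x in ball (0 : 'rV[R]_N) d) bump 0 e x)).
  apply: le_Rintegral => //.
  - apply: measurable_bounded_integrable => //.
    exists `|b / 2|; split; first exact: num_real.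
    by move=> c Cc x _; exact: ltW.
  - exact: (integrableS measurableT).
  - by move=> x /hd /ltW.
rewrite [leLHS]Rintegral_mkcond; apply: le_Rintegral => //.
  rewrite (_ : EFin \o _ = (EFin \o bump 0 e) \_ (ball 0 d)).
    by apply: (integrable_mkcond _ mb).1; apply: (integrableS measurableT mb _ ib).
  by apply/funext => x; rewrite /= !patchE; case: ifP.
by move=> x _; rewrite patchE; case: ifP => // _; exact: bump_ge0.
Qed.

Lemma Rintegral_shift f y : measurable_fun setT f -> (forall x, 0 <= f x) ->
  \int[mu]_x f (x + y) = \int[mu]_x f x.
Proof.
move=> mf f0; rewrite /Rintegral; congr fine.
apply: (@ge0_integral_rV_shift _ _ y (EFin \o f)) => [|x]; last by rewrite lee_fin.
exact/measurable_EFinP.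
Qed.

End test_space.

(** * Second differences in place of second derivatives *)

Section second_differences.
Context {R : realType}.

Lemma MVT_le (f df : R -> R) (a b B : R) : a <= b ->
  (forall s, is_derive s (1 : R) f (df s)) ->
  (forall s, a <= s <= b -> df s <= B) -> f b - f a <= B * (b - a).
Proof.
move=> ab fdf dfB.
have [|c] := MVT_segment ab (fun x _ => fdf x).
  apply: continuous_subspaceT => x.
  by apply/differentiable_continuous/derivable1_diffP; case: (fdf x).
rewrite in_itv/= => cab ->; rewrite ler_wpM2r ?subr_ge0//; exact: dfB.
Qed.

Lemma is_derive_compN (a : R -> R) (s da : R) :
  is_derive (- s) (1 : R) a da -> is_derive s (1 : R) (fun t => a (- t)) (- da).
Proof.
move=> h; have hN : is_derive s (1 : R) (fun t : R => - t) (- 1) by exact: is_deriveNid.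
by have := is_derive1_comp (f := a) (g := fun t => - t) h hN; rewrite mulrN1.
Qed.

(** The mean value theorem is used twice: the bound on [a2] gives [a1 s - a1 (- s) <= 2 * B * s], so
    [a s + a (- s) - B * s^2] does not increase on [[0, d]]. *)
Lemma second_difference_le (a a1 a2 : R -> R) (d B : R) : 0 <= d ->
  (forall s, is_derive s (1 : R) a (a1 s)) ->
  (forall s, is_derive s (1 : R) a1 (a2 s)) ->
  (forall s, `|s| <= d -> a2 s <= B) ->
  a d + a (- d) - 2 * a 0 <= B * d ^+ 2.
Proof.
move=> d0 da da1 a2B.
pose k s := a s + a (- s) - B * (s * s).
pose k1 s := a1 s - a1 (- s) - 2 * B * s.
have dk (s : R) : is_derive s (1 : R) k (k1 s).
  have dsq : is_derive s (1 : R) (fun t : R => t * t) (2 * s).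
    by apply: (is_derive_eq (is_deriveM (is_derive_id s 1) (is_derive_id s 1))); rewrite /GRing.scale/=; ring.
  have h := is_deriveB (is_deriveD (da s) (is_derive_compN (da (- s)))) (is_deriveZ B dsq).
  by apply: (is_derive_eq h); rewrite /k1 /GRing.scale/=; ring.
have k1le s : 0 <= s <= d -> k1 s <= 0.
  move=> /andP[s0 sd]; have := @MVT_le a1 a2 (- s) s B _ da1 _.
  rewrite /k1 => h; rewrite subr_le0 (le_trans (h _ _))//; first by lra.
    by move=> t /andP[? ?]; apply: a2B; rewrite ler_norml; lra.
  by rewrite opprK le_eqVlt; apply/orP; left; apply/eqP; ring.
have := @MVT_le k k1 0 d 0 d0 dk k1le.
by rewrite /k oppr0 expr2 !mul0r mulr0; lra.
Qed.

Lemma second_difference_dist (a a1 a2 : R -> R) (d L e : R) : 0 <= d ->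
  (forall s, is_derive s (1 : R) a (a1 s)) ->
  (forall s, is_derive s (1 : R) a1 (a2 s)) ->
  (forall s, `|s| <= d -> `|a2 s - L| <= e) ->
  `|a d + a (- d) - 2 * a 0 - L * d ^+ 2| <= e * d ^+ 2.
Proof.
move=> d0 da da1 a2L.
have up := @second_difference_le a a1 a2 d (L + e) d0 da da1.
have lo := @second_difference_le (- a) (- a1) (- a2) d (- L + e) d0
  (fun s => is_deriveN (da s)) (fun s => is_deriveN (da1 s)).
rewrite ler_norml; apply/andP; split.
  suff : (- a) d + (- a) (- d) - 2 * (- a) 0 <= (- L + e) * d ^+ 2.
    by rewrite -[(- a) d]/(- a d) -[(- a) (- d)]/(- a (- d)) -[(- a) 0]/(- a 0); lra.
  by apply: lo => s /a2L; rewrite ler_norml -[(- a2) s]/(- a2 s); lra.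
suff : a d + a (- d) - 2 * a 0 <= (L + e) * d ^+ 2 by lra.
by apply: up => s /a2L; rewrite ler_norml; lra.
Qed.

Lemma differentiable_line (V : normedModType R) (y v : V) (s : R) :
  is_diff s (fun t : R => y + t *: v) ( *:%R^~ v).
Proof.
have h : is_diff s (cst y + ( *:%R^~ v)) (0 + ( *:%R^~ v)) by exact: is_diffD.
by rewrite add0r in h.
Qed.

Lemma derive_line (V : normedModType R) (f : V -> R) (y v : V) (s : R) :
  differentiable f (y + s *: v) ->
  is_derive s (1 : R) (fun t => f (y + t *: v)) ('D_v f (y + s *: v)).
Proof.
move=> df; pose l t : V := y + t *: v.
have [dl dlE] := differentiable_line y v s.
have dfl : differentiable (f \o l) s by apply: differentiable_comp.
apply: DeriveDef; first exact/derivable1_diffP.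
have -> : 'D_1 (f \o l) s = 'd (f \o l) s 1 by exact: deriveE.
rewrite diff_comp//= [X in 'd f _ X](_ : _ = v); first by rewrite deriveE.
by rewrite dlE scale1r.
Qed.

Lemma second_difference_Ck2 (V : normedModType R) (f : V -> R) (y v : V) (L e d : R) :
  Ck 2 f -> 0 <= d ->
  (forall s : R, `|s| <= d -> `|'D_v ('D_v f) (y + s *: v) - L| <= e) ->
  `|f (y + d *: v) + f (y - d *: v) - 2 * f y - L * d ^+ 2| <= e * d ^+ 2.
Proof.
move=> [df Df] d0 fB; have [d2f _] := Df v.
pose a t := f (y + t *: v); pose a1 t := 'D_v f (y + t *: v).
pose a2 t := 'D_v ('D_v f) (y + t *: v).
have da (s : R) : is_derive s (1 : R) a (a1 s) by exact: derive_line.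
have da1 (s : R) : is_derive s (1 : R) a1 (a2 s) by exact: derive_line.
have := second_difference_dist d0 da da1 fB.
by rewrite /a scale0r addr0 scaleNr.
Qed.

End second_differences.

Section second_difference_limit.
Context {R : realType} {N : nat}.
Implicit Types (f rho : 'rV[R]_N -> R) (x y v : 'rV[R]_N).
Local Notation mu := (lebesgue_rV R N).

(** Symmetric second difference: it is nonpositive at a maximum without any differentiability, and
    for a mollification it can be moved onto the kernel. *)
Definition sdiff v (d : R) f y : R := f (y + d *: v) + f (y - d *: v) - 2 * f y.

Lemma sdiff_dist f v y (L e d : R) : Ck 2 f -> 0 < d ->
  (forall s : R, `|s| <= d -> `|'D_v ('D_v f) (y + s *: v) - L| <= e) ->
  `|sdiff v d f y / d ^+ 2 - L| <= e.
Proof.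
move=> cf d0 h; have := second_difference_Ck2 cf (ltW d0) h.
have d2 : 0 < d ^+ 2 by rewrite exprn_gt0.
rewrite -ler_pdivrMr// -[X in _ / X](gtr0_norm d2) -normf_div mulrBl mulfK//.
by rewrite gt_eqF.
Qed.

Lemma sdiff_lim f v y : Ck 2 f ->
  (sdiff v n.+1%:R^-1 f y / n.+1%:R^-1 ^+ 2) @[n --> \oo] --> 'D_v ('D_v f) y.
Proof.
move=> cf; apply/cvgrPdist_le => e e0.
have [_ /(_ v)[_ /(_ v) cD2]] := cf.
have cl : {for (0 : R), continuous (fun s : R => 'D_v ('D_v f) (y + s *: v))}.
  apply: (@continuous_comp _ _ _ (fun s : R => y + s *: v) ('D_v ('D_v f))).
    by have [dl _] := differentiable_line y v 0; exact: differentiable_continuous.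
  exact: cD2.
have := (cvgrPdist_le _ _).1 cl e e0; rewrite scale0r addr0 => /(_ (nbhs_filter _)).
move=> /nbhs_ballP[d /= d0 hd].
have [k _ hk] := near_infty_natSinv_lt (PosNum d0).
exists k => //= n kn; have := hk n kn; rewrite /= => nd.
have n0 : 0 < n.+1%:R^-1 :> R by rewrite invr_gt0.
rewrite distrC; apply: sdiff_dist => // s sn; rewrite distrC; apply: hd.
by rewrite /ball/= sub0r normrN; exact: le_lt_trans nd.
Qed.

(** Dominated convergence. The steps are at most 1, so all the quotients vanish outside the ball of
    radius [r + |v|], where [f] is bounded. *)
Lemma cvg_integral_sdiff f rho v : continuous f -> is_test rho ->
  (\int[mu]_x (f x * (sdiff v n.+1%:R^-1 rho x / n.+1%:R^-1 ^+ 2))) @[n --> \oo] -->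
   \int[mu]_x (f x * 'D_v ('D_v rho) x).
Proof.
move=> cf tr; have [cr [r hr]] := tr.
have trv := is_test_derive v (is_test_derive v tr).
have [_ [r2 hr2]] := trv.
have [C [C0 hC]] := continuous_supp_bounded (is_test_continuous trv) hr2.
pose K := [set x : 'rV[R]_N | `|x| <= r + `|v|].
have [Cf [Cf0 hCf]] := continuous_bounded_norm_le (r + `|v|) cf.
apply: (@cvg_Rintegral _ _ _ _ _ _ _ (cst (Cf * C) \_ K)) => //.
- move=> n; apply: measurable_funM; first exact: continuous_measurable_rV.
  apply: measurable_funM => //; apply: measurable_funB.
    by apply: measurable_funD; apply: measurable_shift; exact: is_test_continuous.
  by apply: measurable_funM => //; apply: continuous_measurable_rV; exact: is_test_continuous.
- apply: measurable_funM; first exact: continuous_measurable_rV.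
  by apply: continuous_measurable_rV; exact: is_test_continuous.
- by apply: aeW => x _; apply: cvgM; [exact: cvg_cst|exact: sdiff_lim (cr 2%N)].
- exact: integrable_cst_norm_le.
move=> n x _; rewrite patchE; case: ifPn => [|].
  rewrite inE => /= Kx; rewrite normrM; apply: ler_pM => //; first exact: hCf.
  (* Taking [L = 0] in [sdiff_dist] bounds the quotient, uniformly in [n], by the supremum [C] of
     the second derivative. *)
  rewrite -[X in `|X|]subr0; apply: sdiff_dist => // s _.
  by rewrite subr0.
rewrite notin_setE => /= /negP; rewrite -ltNge => xr.
have nv : `|n.+1%:R^-1 *: v| <= `|v|.
  rewrite normrZ ger0_norm// ler_piMl// invf_le1 ?ler1n//.
rewrite /sdiff !hr ?addr0 ?mulr0 ?subr0 ?mul0r ?mulr0 ?normr0//.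
- by rewrite (le_lt_trans _ xr)// lerDl.
- have : `|x| <= `|x - n.+1%:R^-1 *: v| + `|n.+1%:R^-1 *: v|.
    by rewrite -{1}[x](subrK (n.+1%:R^-1 *: v)) ler_normD.
  by move: nv xr; lra.
- have : `|x| <= `|x + n.+1%:R^-1 *: v| + `|n.+1%:R^-1 *: v|.
    by rewrite -{1}[x](addrK (n.+1%:R^-1 *: v)) ler_normB.
  by move: nv xr; lra.
Qed.

End second_difference_limit.

(** * Mollification and the maximum principle for distributional subsolutions *)

Section mollification.
Context {R : realType} {N : nat}.
Implicit Types (F psi W rho f g : 'rV[R]_N -> R) (x y v : 'rV[R]_N).
Local Notation mu := (lebesgue_rV R N).

(** Heine-Cantor in a form where only [x] is confined to the ball: [y] may leave it, as the points
    of a bump centred near its boundary do. *)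
Lemma uniformly_continuous_norm_le F (r tau : R) : continuous F -> 0 < tau ->
  exists2 d : R, 0 < d & forall x y, `|x| <= r -> `|y - x| < d -> `|F y - F x| <= tau.
Proof.
move=> cF tau0.
have /compact_near_coveringP cov := @compact_norm_le R N r.
have : \forall d \near (0 : R)^'+, [set x : 'rV[R]_N | `|x| <= r] `<=`
    [set x | forall y, `|y - x| < d -> `|F y - F x| <= tau].
  apply: cov => x _.
  have cx : {for x, continuous F} by exact: cF.
  have t2 : 0 < tau / 2 by rewrite divr_gt0.
  have [e /= e0 he] : exists2 e : R, 0 < e & forall y, `|y - x| < e -> `|F y - F x| <= tau / 2.
    have /nbhs_ballP[e /= e0 he] : \forall y \near x, `|F x - F y| < tau / 2.
      by have := (cvgrPdist_lt _ _).1 cx _ t2 => /(_ (nbhs_filter _)).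
    exists e => // y ye; rewrite distrC; apply/ltW/he.
    by rewrite -ball_normE/= distrC.
  exists (ball x (e / 2), [set d : R | d < e / 2]) => /=.
    split; first by apply: nbhsx_ballx; rewrite divr_gt0.
    by apply: nbhs_right_lt; rewrite divr_gt0.
  move=> [x' d] /= [xx' de] y yx'.
  move: xx'; rewrite -ball_normE/= distrC => xx'.
  have h1 : `|F x' - F x| <= tau / 2 by apply: he; lra.
  have h2 : `|F y - F x| <= tau / 2.
    apply: he; have := ler_normD (y - x') (x' - x); rewrite addrA subrK; lra.
  have := ler_normB (F y - F x) (F x' - F x); rewrite opprB addrA subrK; lra.
move=> hd; have [d d0 hd'] : exists2 d : R, 0 < d &
   forall x, `|x| <= r -> forall y, `|y - x| < d -> `|F y - F x| <= tau.
  have [d [d0 dh]] := filter_ex (filterI hd (nbhs_right_gt 0)).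
  by exists d.
by exists d => // x y xr; exact: hd'.
Qed.

Lemma integral_bump_shift y (e : R) : 0 < e ->
  \int[mu]_x bump y e x = \int[mu]_x bump 0 e x.
Proof.
move=> e0; rewrite -(Rintegral_shift (f := bump y e) y).
- by apply: eq_Rintegral => x _; rewrite bump_shift addrK.
- by apply: continuous_measurable_rV; apply: is_test_continuous; exact: is_test_bump.
- by move=> x; exact: bump_ge0.
Qed.

Lemma bump_average_le f y (e tau : R) : 0 < e ->
  mu.-integrable setT (EFin \o (fun x => f x * bump y e x)) ->
  (forall x, `|x - y| < e -> `|f x| <= tau) ->
  `|\int[mu]_x (f x * bump y e x)| <= tau * \int[mu]_x bump 0 e x.
Proof.
move=> e0 fi ft; apply: (le_trans (le_normr_Rintegral measurableT fi)).
have tb := is_test_bump y e0.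
have bi : mu.-integrable setT (EFin \o bump y e).
  by have [_ [r hr]] := tb; apply: integrable_continuous_supp hr; exact: is_test_continuous.
rewrite -(integral_bump_shift y e0) -RintegralZl//.
apply: le_Rintegral => //.
- exact: integrable_norm.
- exact: (integrableZl measurableT tau bi).
move=> x _; rewrite normrM (ger0_norm (bump_ge0 _ _ _)).
have [->|bx] := eqVneq (bump y e x) 0; first by rewrite !mulr0.
by rewrite ler_wpM2r ?bump_ge0//; apply: ft; exact: bump_supp.
Qed.

(** The division makes up for [bump] not having integral 1. The kernel carries the variable [y], so
    no regularity of [F] is asked when differences in [y] are taken. *)
Definition mollify F (e : R) y : R :=
  (\int[mu]_x (F x * bump y e x)) / \int[mu]_x bump 0 e x.

Lemma mollify_dist F y (e tau : R) : continuous F -> 0 < e ->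
  (forall x, `|x - y| < e -> `|F x - F y| <= tau) -> `|mollify F e y - F y| <= tau.
Proof.
move=> cF e0 ft; have c0 := integral_bump_gt0 (N := N) e0; have tb := is_test_bump y e0.
have i1 := integrable_test cF tb.
have i2 : mu.-integrable setT (EFin \o (fun x => F y * bump y e x)).
  by apply: integrable_test tb => x; exact: cst_continuous.
have bi : mu.-integrable setT (EFin \o bump y e).
  by have [_ [r hr]] := tb; apply: integrable_continuous_supp hr; exact: is_test_continuous.
have -> : mollify F e y - F y =
    (\int[mu]_x ((F x - F y) * bump y e x)) / \int[mu]_x bump 0 e x.
  have -> : \int[mu]_x ((F x - F y) * bump y e x) =
      (\int[mu]_x (F x * bump y e x)) - F y * \int[mu]_x bump 0 e x.
    rewrite -(integral_bump_shift y e0) -RintegralZl// -RintegralB//.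
    by apply: eq_Rintegral => x _; rewrite mulrBl.
  by rewrite mulrBl mulfK// gt_eqF.
rewrite normrM normfV (gtr0_norm c0) ler_pdivrMr//.
apply: bump_average_le => //.
by apply: integrable_test tb => x; apply: continuousB; [exact: cF|exact: cst_continuous].
Qed.

Lemma mollify_continuous F (e : R) : continuous F -> (forall x, 0 <= F x) -> 0 < e ->
  continuous (mollify F e).
Proof.
move=> cF F0 e0 y; have c0 := integral_bump_gt0 (N := N) e0.
(* A translation moves [z] from the kernel to [F], so that the uniform continuity of [F] on bounded
   sets applies. [Rintegral_shift] concerns nonnegative integrands, whence the sign condition on
   [F]. *)
have E z : mollify F e z = (\int[mu]_x (F (x + z) * bump 0 e x)) / \int[mu]_x bump 0 e x.
  rewrite /mollify -(Rintegral_shift (f := fun x => F x * bump z e x) z).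
  - by apply: (congr1 (fun a => a / _)); apply: eq_Rintegral => x _; rewrite (bump_shift z) addrK.
  - apply: measurable_funM; apply: continuous_measurable_rV => //.
    by apply: is_test_continuous; exact: is_test_bump.
  - by move=> x; rewrite mulr_ge0 ?bump_ge0.
apply/near_dist_continuous => tau tau0.
have [d d0 hd] := uniformly_continuous_norm_le (e + `|y|) cF tau0.
near=> z.
have zy : `|z - y| < d.
  by rewrite distrC; near: z; apply/nbhs_ballP; exists d => //= z; rewrite -ball_normE.
have ti w : mu.-integrable setT (EFin \o (fun x => F (x + w) * bump 0 e x)).
  by apply: integrable_test; [exact: continuous_shift|exact: is_test_bump].
rewrite distrC !E -mulrBl -(RintegralB measurableT (ti z) (ti y)).
rewrite normrM normfV (gtr0_norm c0) ler_pdivrMr//.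
have -> : \int[mu]_x (F (x + z) * bump 0 e x - F (x + y) * bump 0 e x) =
    \int[mu]_x ((F (x + z) - F (x + y)) * bump 0 e x).
  by apply: eq_Rintegral => x _; rewrite mulrBl.
apply: bump_average_le => //.
  apply: integrable_test; last exact: is_test_bump.
  by move=> x; apply: continuousB; exact: continuous_shift.
move=> x; rewrite subr0 => xe; apply: hd.
  by rewrite (le_trans (ler_normD _ _))// lerD2r ltW.
by rewrite opprD addrACA subrr add0r.
Unshelve. all: by end_near. Qed.

Lemma Rintegral_sum (I : Type) (s : seq I) (f : I -> 'rV[R]_N -> R) :
  (forall i, mu.-integrable setT (EFin \o f i)) ->
  \int[mu]_x (\sum_(i <- s) f i x) = \sum_(i <- s) \int[mu]_x f i x.
Proof.
move=> fi; rewrite /Rintegral.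
under eq_integral do rewrite -sumEFin.
rewrite (integral_sum measurableT fi).
rewrite (eq_bigr (fun i => (fine (\int[mu]_x (f i x)%:E))%:E)) ?sumEFin// => i _.
by rewrite fineK//; exact: (integrable_fin_num measurableT (fi i)).
Qed.

Lemma Ck2_partial_continuous W i : Ck 2 W -> continuous (partial i (partial i W)).
Proof. by move=> [_ /(_ (basis_rV i))[_ /(_ (basis_rV i))]]. Qed.

Lemma Ck2_laplacian_continuous W : Ck 2 W -> continuous (laplacian W).
Proof.
move=> cW; rewrite (_ : laplacian W = \sum_(i < N) partial i (partial i W)).
  by apply: (@Ck_continuous _ _ 0); apply: Ck_sum => i; exact: Ck2_partial_continuous.
by apply/funext => x; rewrite fct_sumE.
Qed.

Lemma partial_quadratic W (lam : R) x0 i x : Ck 2 W ->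
  partial i (partial i (fun x => W x + lam * sqn (x - x0))) x =
  partial i (partial i W) x + 2 * lam.
Proof.
move=> [dW /(_ (basis_rV i))[d2W _]].
have [dq _] := Cinfty_sqn_shift x0 1.
rewrite /partial.
have E : 'D_(basis_rV i) (fun x => W x + lam * sqn (x - x0)) =
   'D_(basis_rV i) W + cst (2 * lam) * (fun z => dot (basis_rV i) (z - x0)).
  apply/funext => y.
  rewrite -[LHS]/('D_(basis_rV i) (W + cst lam * (fun x => sqn (x - x0))) y).
  have dM : derivable (cst lam * (fun x => sqn (x - x0))) y (basis_rV i).
    by apply: derivableM; [exact: derivable_cst|exact: diff_derivable].
  rewrite deriveD//; last exact: diff_derivable.
  rewrite deriveM//; last exact: diff_derivable.
  rewrite derive_cst derive_shift derive_sqn.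
  rewrite -[RHS]/('D_(basis_rV i) W y + 2 * lam * dot (basis_rV i) (y - x0)).
  by rewrite /GRing.scale/=; ring.
have dl : derivable (fun z => dot (basis_rV i) (z - x0)) x (basis_rV i).
  apply: diff_derivable; apply: (@differentiable_comp _ _ _ _ (fun z => z - x0)) => //.
  by have [dd _] := @Cinfty_dot R N (basis_rV i) 1.
rewrite E deriveD; last 2 first.
- exact: diff_derivable.
- by apply: derivableM; [exact: derivable_cst|exact: dl].
rewrite deriveM// derive_cst derive_shift derive_dot dot_basis mxE !eqxx.
by rewrite /GRing.scale/=; ring.
Qed.

Lemma Ck2_quadratic W (lam : R) x0 : Ck 2 W -> Ck 2 (fun x => W x + lam * sqn (x - x0)).
Proof.
move=> cW; have h : Ck 2 (cst lam * (fun x => sqn (x - x0))).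
  by apply: CkM; [exact: Ck_cst|exact: Cinfty_sqn_shift].
exact: (CkD cW h).
Qed.

Lemma sdiffB (d : R) v f g y :
  sdiff v d (fun x => f x - g x) y = sdiff v d f y - sdiff v d g y.
Proof. by rewrite /sdiff; ring. Qed.

(** Moving [x] by [d *: v] is moving the centre by the opposite vector, and the symmetric difference
    does not see the sign. *)
Lemma sdiff_bump (e d : R) v y x : sdiff v d (bump y e) x =
  bump (y + d *: v) e x + bump (y - d *: v) e x - 2 * bump y e x.
Proof.
rewrite /sdiff.
have -> : bump (y + d *: v) e x = bump y e (x - d *: v).
  by rewrite /bump opprD addrA addrAC.
have -> : bump (y - d *: v) e x = bump y e (x + d *: v).
  by rewrite /bump opprB addrA.
by rewrite [in LHS]addrC addrA [in LHS]addrAC addrC addrA addrAC [in LHS]addrC; ring.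
Qed.

Lemma sdiff_integral_bump F (e d : R) v y : continuous F -> 0 < e ->
  mu.-integrable setT (EFin \o (fun x => F x * sdiff v d (bump y e) x)) /\
  \int[mu]_x (F x * sdiff v d (bump y e) x) =
  \int[mu]_x (F x * bump (y + d *: v) e x) + \int[mu]_x (F x * bump (y - d *: v) e x) -
  2 * \int[mu]_x (F x * bump y e x).
Proof.
move=> cF e0.
have i1 z : mu.-integrable setT (EFin \o (fun x => F x * bump z e x)).
  by apply: integrable_test => //; exact: is_test_bump.
pose b1 x := F x * bump (y + d *: v) e x + F x * bump (y - d *: v) e x.
pose b2 x := 2 * (F x * bump y e x).
have i2 : mu.-integrable setT (EFin \o b1).
  by have := integrableD measurableT (i1 (y + d *: v)) (i1 (y - d *: v)).
have i3 : mu.-integrable setT (EFin \o b2).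
  by have := integrableZl measurableT 2 (i1 y).
have E : (fun x => F x * sdiff v d (bump y e) x) = (fun x => b1 x - b2 x).
  by apply/funext => x; rewrite sdiff_bump /b1 /b2; ring.
split; first by rewrite E; have := integrableB measurableT i2 i3.
rewrite E RintegralB// /b1 /b2 (RintegralD measurableT (i1 _) (i1 _)).
by rewrite (RintegralZl _ measurableT (i1 _)).
Qed.

Lemma sdiff_mollify F (e d : R) v y : continuous F -> 0 < e ->
  sdiff v d (mollify F e) y =
  (\int[mu]_x (F x * sdiff v d (bump y e) x)) / \int[mu]_x bump 0 e x.
Proof.
move=> cF e0; have [_ ->] := sdiff_integral_bump d v y cF e0.
by rewrite {1}/sdiff /mollify mulrA -mulrDl -mulrBl.
Qed.

Lemma norm_basis_le1 (i : 'I_N) : `|basis_rV i : 'rV[R]_N| <= 1.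
Proof.
by apply/rV_norm_leP => // j; rewrite mxE; case: (_ && _); rewrite ?normr1 ?normr0.
Qed.

Let touch_arith (S tau Q Fy Wy F0 W0 My M0 : R) : S = 3 * tau -> S <= Q ->
  Fy - Wy <= F0 - W0 -> My - Fy <= tau -> - tau <= M0 - F0 ->
  M0 - W0 <= My - (Wy + Q) -> 0 < tau -> False.
Proof. by lra. Qed.

Let slope_arith (E P L : R) : 0 < E -> 4 * E = P - L -> P - E <= L + E + E -> False.
Proof. by lra. Qed.

(* The mollification of [F] is smooth, its Laplacian at [y] is the integral of
   [F] against the Laplacian of a bump centred at [y], and it touches a
   perturbation of [W] from below at some [y] close to [x0]. *)
Lemma viscosity_subsolution F psi W x0 :
  continuous F -> (forall x, 0 <= F x) -> continuous psi -> Ck 2 W ->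
  (forall x, F x - W x <= F x0 - W x0) ->
  (forall rho, is_test rho -> (forall x, 0 <= rho x) ->
    \int[mu]_x (psi x * rho x) <= \int[mu]_x (F x * laplacian rho x)) ->
  psi x0 <= laplacian W x0.
Proof.
move=> cF F0 cpsi cW Fmax Fsub; rewrite leNgt; apply/negP => h.
(* The contradiction loses three portions [eta]: [psi] drops by at most one near [x0], [laplacian W]
   rises by at most one, and the quadratic perturbation costs one. A quarter of the gap still leaves
   a strict inequality. *)
pose eta := (psi x0 - laplacian W x0) / 4.
have eta0 : 0 < eta by rewrite divr_gt0// subr_gt0.
have etaE : 4 * eta = psi x0 - laplacian W x0 by rewrite /eta; field.
(* The penalty adds [2 * N * lam] to the Laplacian, kept below [eta]; the [+ 1] keeps the
   denominator positive for every [N]. *)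
pose lam := eta / (2 * N%:R + 1).
have lam0 : 0 < lam by rewrite divr_gt0// ltr_wpDl// mulr_ge0.
have lamN : N%:R * (2 * lam) <= eta.
  rewrite (_ : _ * _ = eta * (2 * N%:R) / (2 * N%:R + 1)); last by rewrite /lam; ring.
  by rewrite ler_pdivrMr ?ltr_wpDl ?mulr_ge0// ler_wpM2l ?(ltW eta0)// lerDl.
have cL := Ck2_laplacian_continuous cW.
have [r r0 hr] : exists2 r : R, 0 < r & forall x, `|x - x0| < r ->
    psi x0 - eta < psi x /\ laplacian W x < laplacian W x0 + eta.
  have n1 : \forall x \near x0, psi x0 - eta < psi x.
    by apply: near_gt_continuous; [exact: cpsi|rewrite ltrBlDr ltrDl].
  have n2 : \forall x \near x0, laplacian W x < laplacian W x0 + eta.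
    by apply: near_lt_continuous; [exact: cL|rewrite ltrDl].
  have n12 : \forall x \near x0, psi x0 - eta < psi x /\ laplacian W x < laplacian W x0 + eta.
    exact: filterI.
  have /nbhs_ballP[r /= r0 hr] := n12.
  by exists r => // x xr; apply: hr; rewrite -ball_normE/= distrC.
pose s := r / 2; have s0 : 0 < s by rewrite divr_gt0.
pose tau := lam * s ^+ 2 / 3.
have tau0 : 0 < tau by rewrite divr_gt0// mulr_gt0// exprn_gt0.
have [d d0 hd] := uniformly_continuous_norm_le (`|x0| + s) cF tau0.
pose e := Num.min d s; have e0 : 0 < e by rewrite lt_min d0.
have c0 := integral_bump_gt0 (N := N) e0; set c := \int[mu]_x _ in c0.
pose W' x := W x + lam * sqn (x - x0).
have cW' : Ck 2 W' by exact: Ck2_quadratic.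
pose G x := mollify F e x - W' x.
have approx y : `|y - x0| <= s -> `|mollify F e y - F y| <= tau.
  move=> ys; apply: mollify_dist => // x xy; apply: hd.
    by rewrite -[y](subrK x0) (le_trans (ler_normD _ _))// addrC lerD2l.
  by rewrite (lt_le_trans xy)// ge_min lexx.
have [|||y By Gy] := @compact_EVT_max _ R G [set y | `|y - x0| <= s].
- by exists x0; rewrite /= subrr normr0 ltW.
- exact: compact_norm_sub_le.
- apply: continuous_subspaceT => y; apply: continuousB.
    exact: mollify_continuous.
  exact: (Ck_continuous cW').
move: By; rewrite inE/= => ys.
(* On the boundary the penalty is at least [lam * s^2 = 3 * tau], while mollifying changes [F] by at
   most [tau] at each of [y] and [x0]; hence [y] would not beat [x0]. *)
have ys' : `|y - x0| < s.
  rewrite lt_neqAle ys andbT; apply/eqP => yE.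
  have G0 : G x0 <= G y by apply: Gy; rewrite inE/= subrr normr0 ltW.
  have a1 := approx y ys; have a2 := approx x0.
  rewrite subrr normr0 in a2; have {}a2 := a2 (ltW s0).
  have q1 : lam * s ^+ 2 <= lam * sqn (y - x0).
    by rewrite ler_wpM2l ?(ltW lam0)// -yE normr_sqn.
  have F1 := Fmax y.
  rewrite /G /W' subrr sqn0 mulr0 addr0 in G0.
  have t3 : lam * s ^+ 2 = 3 * tau by rewrite /tau; field.
  move: a1 a2; rewrite !ler_norml => /andP[_ a1] /andP[a2 _].
  exact: touch_arith t3 q1 F1 a1 a2 G0 tau0.
have sd (i : 'I_N) : \forall n \near \oo, sdiff (basis_rV i) n.+1%:R^-1 G y <= 0.
  have sy : 0 < s - `|y - x0| by rewrite subr_gt0.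
  have [k _ hk] := near_infty_natSinv_lt (PosNum sy).
  exists k => //= n /hk /= nd.
  have n0 : 0 < n.+1%:R^-1 :> R by rewrite invr_gt0.
  have nb : `|n.+1%:R^-1 *: basis_rV i : 'rV[R]_N| <= n.+1%:R^-1.
    by rewrite normrZ ger0_norm// ler_piMr// norm_basis_le1.
  have G1 : G (y + n.+1%:R^-1 *: basis_rV i) <= G y.
    apply: Gy; rewrite inE/= addrAC (le_trans (ler_normD _ _))//.
    by rewrite -lerBrDl (le_trans nb)// ltW.
  have G2 : G (y - n.+1%:R^-1 *: basis_rV i) <= G y.
    apply: Gy; rewrite inE/= addrAC (le_trans (ler_normB _ _))//.
    by rewrite -lerBrDl (le_trans nb)// ltW.
  by rewrite /sdiff; lra.
have tb := is_test_bump y e0.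
(* At the interior maximum [y] the second differences of the mollification are at most those of
   [W']. Divided by the squared step they pass to the limit on both sides, on the left because the
   difference falls on the bump. *)
have key (i : 'I_N) : \int[mu]_x (F x * partial i (partial i (bump y e)) x) <=
    c * (partial i (partial i W) y + 2 * lam).
  have A := @cvg_integral_sdiff _ _ F (bump y e) (basis_rV i) cF tb.
  have B := @sdiff_lim _ _ W' (basis_rV i) y cW'.
  have B' : c * (sdiff (basis_rV i) n.+1%:R^-1 W' y / n.+1%:R^-1 ^+ 2) @[n --> \oo] -->
      c * (partial i (partial i W) y + 2 * lam).
    by rewrite -(@partial_quadratic W lam x0 i y cW); apply: cvgM; [exact: cvg_cst|exact: B].
  apply: ler_cvg_to A B' _; near=> n.
  have n2 : 0 < n.+1%:R^-1 ^+ 2 :> R by rewrite exprn_gt0// invr_gt0.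
  rewrite [leLHS](_ : _ = (\int[mu]_x (F x * sdiff (basis_rV i) n.+1%:R^-1 (bump y e) x)) / n.+1%:R^-1 ^+ 2); last first.
    rewrite -RintegralZr//; last by have [] := sdiff_integral_bump n.+1%:R^-1 (basis_rV i) y cF e0.
    by apply: eq_Rintegral => x _; rewrite mulrA.
  rewrite mulrA ler_pM2r ?invr_gt0//.
  rewrite mulrC -ler_pdivrMr// -sdiff_mollify// -subr_le0.
  by rewrite -sdiffB; near: n; exact: sd.
have lap : \int[mu]_x (F x * laplacian (bump y e) x) <= c * (laplacian W y + N%:R * (2 * lam)).
  rewrite (_ : \int[mu]_x _ = \sum_(i < N) \int[mu]_x (F x * partial i (partial i (bump y e)) x)); last first.
    rewrite -Rintegral_sum => [|i]; last first.
      by apply: integrable_test => //; do 2!apply: is_test_derive.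
    by apply: eq_Rintegral => x _; rewrite /laplacian mulr_sumr.
  apply: (le_trans (ler_sum _ (fun i _ => key i))).
  by rewrite -mulr_sumr big_split/= sumr_const card_ord -[(2 * lam) *+ N]mulr_natl.
(* The bump about [y] has radius at most [s = r / 2] and [|y - x0| <= s], so on its support [psi]
   exceeds [psi x0 - eta]. *)
have low : (psi x0 - eta) * c <= \int[mu]_x (psi x * bump y e x).
  have bi : mu.-integrable setT (EFin \o bump y e).
    by have [_ [r' hr']] := tb; apply: integrable_continuous_supp hr'; exact: is_test_continuous.
  rewrite /c -(integral_bump_shift y e0) -RintegralZl//.
  apply: le_Rintegral => //; first exact: (integrableZl measurableT (psi x0 - eta) bi).
    exact: integrable_test.
  move=> x _; have [->|bx] := eqVneq (bump y e x) 0; first by rewrite !mulr0.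
  rewrite ler_wpM2r ?bump_ge0//.
  have [|/ltW //] := hr x.
  have xy : `|x - y| < s by rewrite (lt_le_trans (bump_supp e0 bx))// ge_min lexx orbT.
  have := ler_normD (x - y) (y - x0); rewrite addrA subrK => /le_lt_trans; apply.
  by rewrite (splitr r) ltrD.
have := Fsub _ tb (bump_ge0 _ _); move=> fs.
have [|_ Wy] := hr y; first by rewrite (lt_trans ys')// /s ltr_pdivrMr// ltr_pMr// ltr1n.
have : (psi x0 - eta) * c <= c * (laplacian W x0 + eta + eta).
  apply: (le_trans low); apply: (le_trans fs); apply: (le_trans lap).
  by rewrite ler_pM2l//; apply: lerD => //; exact: ltW.
by rewrite mulrC ler_pM2l// => hE; exact: slope_arith eta0 etaE hE.
Unshelve. all: by end_near. Qed.

End mollification.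

(** * Time cut-offs and averages *)

Section time_cutoff.
Context {R : realType}.
Implicit Types (s t h T : R) (a : R -> R).
Local Notation leb := (@lebesgue_measure R).

Definition pos s : R := Num.max 0 s.

Lemma pos_continuous : continuous pos.
Proof.
rewrite (_ : pos = fun s => (s + `|s|) / 2); last first.
  by apply/funext => s; rewrite /pos maxr_absE add0r sub0r normrN.
move=> s; apply: cvgM; last exact: cvg_cst.
by apply: cvgD => //; exact: norm_continuous.
Qed.

Lemma is_derive_pos2 s : is_derive s (1 : R) (fun t => pos t ^+ 2) (2 * pos s).
Proof.
have [s0|s0|->] := ltrgt0P s.
- have E : \forall t \near s, t * t = pos t ^+ 2.
    near=> t; rewrite /pos max_r ?expr2//; apply/ltW; near: t; exact: lt_nbhsr.
  apply: near_eq_is_derive E _; rewrite /pos max_r ?(ltW s0)//.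
  by apply: (is_derive_eq (is_deriveM (is_derive_id s 1) (is_derive_id s 1))); rewrite /GRing.scale/=; ring.
- have E : \forall t \near s, cst 0 t = pos t ^+ 2.
    near=> t; rewrite /pos max_l ?expr0n//; apply/ltW; near: t; exact: lt_nbhsl.
  apply: near_eq_is_derive E _; rewrite /pos max_l ?(ltW s0)// mulr0.
  exact: is_derive_cst.
- have [|df D0] := @differentiable_littleo0 _ R (fun t => pos t ^+ 2) 0.
    move=> e e0; near=> y; rewrite addr0 /pos maxxx expr0n/= subr0.
    have y1 : `|y| < e by near: y; apply: (@nbhs0_lt R R).
    rewrite normrX expr2 ler_pM//; last first.
      by rewrite ger0_norm ?le_max ?lexx// ge_max normr_ge0 ler_norm.
    apply: le_trans (ltW y1).
    by rewrite ger0_norm ?le_max ?lexx// ge_max normr_ge0 ler_norm.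
  split; last by rewrite D0 /pos maxxx mulr0.
  exact/derivable1_diffP.
Unshelve. all: by end_near. Qed.

(* A C^1 interpolation of the Heaviside function between 0 and 1; [chi t n] tends
   to the indicator function of s < t, and [dchi t n] to the Dirac mass at t. *)
Definition step s : R := 2 * pos s ^+ 2 - 4 * pos (s - 2^-1) ^+ 2 + 2 * pos (s - 1) ^+ 2.

(** The hat function on [[0, 1]] with peak 2 at 1/2 and integral 1. *)
Definition dstep s : R := 4 * pos s - 8 * pos (s - 2^-1) + 4 * pos (s - 1).

Lemma step_le0 s : s <= 0 -> step s = 0.
Proof.
by move=> s0; rewrite /step /pos !max_l ?expr0n/= ?mulr0 ?subr0 ?addr0//; lra.
Qed.

Lemma step_ge1 s : 1 <= s -> step s = 1.
Proof.
by move=> s1; rewrite /step /pos !max_r; [field | lra | lra | lra].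
Qed.

Lemma dstep_out s : s <= 0 \/ 1 <= s -> dstep s = 0.
Proof.
move=> [s0|s1]; rewrite /dstep /pos.
  by rewrite !max_l ?mulr0 ?subr0 ?addr0//; lra.
by rewrite !max_r; [field | lra | lra | lra].
Qed.

Lemma dstep_ge0 s : 0 <= dstep s.
Proof.
have [s0|s0] := leP s 0; first by rewrite dstep_out//; left.
rewrite /dstep /pos (max_r (ltW s0)).
by case: (leP 0 (s - 2^-1)) => ?; case: (leP 0 (s - 1)) => ?; lra.
Qed.

Lemma is_derive_step s : is_derive s (1 : R) step (dstep s).
Proof.
have sh c : is_derive s (1 : R) (fun t => pos (t - c) ^+ 2) (2 * pos (s - c)).
  have hB : is_derive s (1 : R) (fun t : R => t - c) 1.
    by apply: (is_derive_eq (is_deriveB (is_derive_id s 1) (is_derive_cst c s 1))); rewrite subr0.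
  have := is_derive1_comp (f := fun t => pos t ^+ 2) (g := fun t => t - c) (is_derive_pos2 (s - c)) hB.
  by rewrite mulr1.
have h := is_deriveD (is_deriveB (is_deriveZ 2 (is_derive_pos2 s)) (is_deriveZ 4 (sh 2^-1)))
  (is_deriveZ 2 (sh 1)).
by apply: (is_derive_eq h); rewrite /GRing.scale/= /dstep; ring.
Qed.

Lemma dstep_continuous : continuous dstep.
Proof.
have sh c : continuous (fun s : R => pos (s - c)).
  move=> s; apply: cvg_comp; last exact: pos_continuous.
  by apply: cvgB => //; exact: cvg_cst.
move=> s; rewrite /dstep; apply: cvgD; first apply: cvgB.
- by apply: cvgM; [exact: cvg_cst|exact: pos_continuous].
- by apply: cvgM; [exact: cvg_cst|exact: sh].
- by apply: cvgM; [exact: cvg_cst|exact: sh].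
Qed.

Lemma step_nondecreasing : {homo step : s t / s <= t}.
Proof.
move=> s t st.
have := @MVT_le _ (- step) (fun s => - dstep s) s t 0 st
  (fun x => is_deriveN (is_derive_step x)).
rewrite mul0r -[(- step) t]/(- step t) -[(- step) s]/(- step s) => H.
suff : - step t - - step s <= 0 by lra.
by apply: H => x _; rewrite oppr_le0 dstep_ge0.
Qed.

Lemma step_ge0 s : 0 <= step s.
Proof.
have [s0|s0] := leP s 0; first by rewrite step_le0.
by rewrite -(step_le0 (lexx 0)); apply: step_nondecreasing; exact: ltW.
Qed.

Lemma step_le1 s : step s <= 1.
Proof.
have [s1|s1] := leP 1 s; first by rewrite step_ge1.
by rewrite -(step_ge1 (lexx 1)); apply: step_nondecreasing; exact: ltW.
Qed.

Definition chi t n s : R := step (n.+1%:R * (t - s)).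

Definition dchi t n s : R := n.+1%:R * dstep (n.+1%:R * (t - s)).

Lemma is_derive_chi t n s : is_derive s (1 : R) (chi t n) (- dchi t n s).
Proof.
have hB : is_derive s (1 : R) (fun s : R => n.+1%:R * (t - s)) (- n.+1%:R).
  apply: (is_derive_eq (is_deriveZ n.+1%:R (is_deriveB (is_derive_cst t s 1) (is_derive_id s 1)))).
  by rewrite /GRing.scale/=; ring.
have := is_derive1_comp (f := step) (g := fun s : R => n.+1%:R * (t - s)) (is_derive_step _) hB.
by move=> h; apply: (is_derive_eq h); rewrite /dchi; ring.
Qed.

Lemma dchi_continuous t n : continuous (dchi t n).
Proof.
move=> s; apply: cvgM; first exact: cvg_cst.
apply: cvg_comp; last exact: dstep_continuous.
by apply: cvgM; [exact: cvg_cst|apply: cvgB => //; exact: cvg_cst].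
Qed.

Lemma dchi_ge0 t n s : 0 <= dchi t n s.
Proof. by rewrite mulr_ge0// dstep_ge0. Qed.

Lemma chi_lim t s : (chi t n s) @[n --> \oo] --> ((s < t)%R%:R : R).
Proof.
have [st|st] := ltP s t; last first.
  rewrite (_ : (fun n => _) = cst 0); first exact: cvg_cst.
  by apply/funext => n; rewrite /chi step_le0// mulr_ge0_le0// subr_le0.
have ts : 0 < t - s by rewrite subr_gt0.
have [k _ hk] := near_infty_natSinv_lt (PosNum ts).
apply: cvg_near_cst; exists k => //= n /hk /= hn; apply/eqP; rewrite /chi step_ge1//.
by rewrite mulrC -ler_pdivrMr// mul1r ltW.
Qed.

Lemma chi_ge0 t n s : 0 <= chi t n s. Proof. exact: step_ge0. Qed.

Lemma chi_le1 t n s : chi t n s <= 1. Proof. exact: step_le1. Qed.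

Lemma chi_continuous t n : continuous (chi t n).
Proof.
move=> s; apply/differentiable_continuous/derivable1_diffP.
by have [] := is_derive_chi t n s.
Qed.

Lemma measurable_itv_continuous T a : (forall s, 0 < s -> {for s, continuous a}) ->
  measurable_fun (`]0, T[ : set R) a.
Proof.
move=> ca; apply: open_continuous_measurable_fun; first exact: interval_open.
by move=> s; rewrite inE/= in_itv/= => /andP[s0 _]; exact: ca.
Qed.

Lemma integrable_itv_bounded T a (M : R) : measurable_fun (`]0, T[ : set R) a ->
  (forall s, s \in `]0, T[ -> `|a s| <= M) -> leb.-integrable `]0, T[ (EFin \o a).
Proof.
move=> ma aM; apply: measurable_bounded_integrable => //.
  suff : (lebesgue_measure (`]0%R, T[%classic : set R) < +oo)%E by [].
  rewrite lebesgue_measure_itv/=; case: ifP => _; last exact: ltry.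
  by rewrite -EFinB ltry.
exists M; split; first exact: num_real.
by move=> c Mc s sT; apply: (le_trans (aM _ sT)); exact: ltW.
Qed.

Lemma dchi_bounded t n s : `|dchi t n s| <= n.+1%:R * 2.
Proof.
rewrite ger0_norm ?dchi_ge0// ler_pM2l//.
set x := _ * _; have [x0|x0] := leP x 0; first by rewrite dstep_out//; left.
have [x1|x1] := leP 1 x; first by rewrite dstep_out//; right.
rewrite /dstep /pos (max_r (ltW x0)) (max_l (_ : x - 1 <= 0)); last by lra.
by case: (leP 0 (x - 2^-1)) => ?; lra.
Qed.

Lemma integrable_dchi t n T : leb.-integrable `]0, T[ (EFin \o dchi t n).
Proof.
apply: (@integrable_itv_bounded _ _ (n.+1%:R * 2)) => [|s _]; last exact: dchi_bounded.
by apply: measurable_itv_continuous => s _; exact: dchi_continuous.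
Qed.

Lemma integral_dchi t n T : 0 < T -> t < T ->
  \int[leb]_(s in `]0, T[) dchi t n s = chi t n 0.
Proof.
move=> T0 tT.
have io := integrable_dchi t n T.
have md D : measurable_fun D (EFin \o dchi t n).
  apply/measurable_EFinP; apply: measurable_funTS.
  apply: continuous_measurable_fun; exact: dchi_continuous.
rewrite /Rintegral -(integral_itv_bndoo true false (md _)) (@continuous_FTC2 _ (dchi t n) (fun s => - chi t n s)) //=.
- rewrite opprK [chi t n T]/chi step_le0 ?oppr0 ?add0r//.
  by rewrite mulr_ge0_le0// subr_le0 ltW.
- by apply: continuous_subspaceT; exact: dchi_continuous.
- have cN : continuous (fun s => - chi t n s) by move=> s; apply: cvgN; exact: chi_continuous.
  split.
  + by move=> s _; have [] := is_deriveN (is_derive_chi t n s).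
  + exact/cvg_at_right_filter/cN.
  + exact/cvg_at_left_filter/cN.
- move=> s _; rewrite derive1E.
  by have [_ ->] := is_deriveN (is_derive_chi t n s); rewrite opprK.
Qed.

Lemma dchi_out t n s : s <= t - n.+1%:R^-1 \/ t <= s -> dchi t n s = 0.
Proof.
move=> h; rewrite /dchi dstep_out ?mulr0//; case: h => h; [right|left].
  by rewrite mulrC -ler_pdivrMr// mul1r lerBrDr -lerBrDl.
by rewrite mulr_ge0_le0// subr_le0.
Qed.

(** [dchi t n] is a nonnegative kernel supported in [[t - 1/(n+1), t]], a one-sided approximate
    identity. *)
Lemma cvg_integral_dchi t T a (M : R) : 0 < t -> t < T ->
  (forall s, 0 < s -> {for s, continuous a}) -> (forall s, s \in `]0, T[ -> `|a s| <= M) ->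
  (\int[leb]_(s in `]0, T[) (a s * dchi t n s)) @[n --> \oo] --> a t.
Proof.
move=> t0 tT ca aM; apply/cvgrPdist_le => e e0.
have ct := ca t t0; have /near_dist_continuous/(_ e e0) := ct.
move=> /nbhs_ballP[d /= d0 hd].
(* A support shorter than [d] gives closeness of [a s] to [a t]; shorter than [t] keeps the whole
   unit mass at positive times. *)
have td0 : 0 < Num.min d t by rewrite lt_min d0.
have [k _ hk] := near_infty_natSinv_lt (PosNum td0).
exists k => //= n /hk /=; rewrite lt_min => /andP[nd nt].
have i0 : \int[leb]_(s in `]0, T[) dchi t n s = 1.
  rewrite integral_dchi ?(lt_trans t0)// /chi subr0 step_ge1//.
  by rewrite mulrC -ler_pdivrMr// mul1r ltW.
have ma : measurable_fun (`]0, T[ : set R) a by exact: measurable_itv_continuous.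
have md : measurable_fun (`]0, T[ : set R) (dchi t n).
  by apply: measurable_itv_continuous => s _; exact: dchi_continuous.
have id := integrable_dchi t n T.
have iad : leb.-integrable `]0, T[ (EFin \o (fun s => a s * dchi t n s)).
  apply: (@integrable_itv_bounded _ _ (M * (n.+1%:R * 2))) => [|s sT].
    exact: measurable_funM.
  by rewrite normrM ler_pM ?dchi_bounded ?aM.
have -> : a t - \int[leb]_(s in `]0, T[) (a s * dchi t n s) =
    \int[leb]_(s in `]0, T[) ((a t - a s) * dchi t n s).
  rewrite -[a t in LHS]mulr1 -i0 -RintegralZl// -RintegralB//.
    by apply: eq_Rintegral => s _; rewrite mulrBl.
  exact: (integrableZl _ (a t) id).
have ie : leb.-integrable `]0, T[ (EFin \o (fun s => e * dchi t n s)).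
  exact: (integrableZl _ e id).
have ib : leb.-integrable `]0, T[ (EFin \o (fun s => (a t - a s) * dchi t n s)).
  apply: (@integrable_itv_bounded _ _ ((`|a t| + M) * (n.+1%:R * 2))) => [|s sT].
    by apply: measurable_funM => //; exact: measurable_funB.
  rewrite normrM ler_pM ?dchi_bounded// (le_trans (ler_normB _ _))//.
  by rewrite lerD2l aM.
apply: (le_trans (le_normr_Rintegral _ ib)) => //.
apply: (@le_trans _ _ (\int[leb]_(s in `]0, T[) (e * dchi t n s))); last first.
  by rewrite RintegralZl// i0 mulr1.
apply: le_Rintegral => //; first exact: integrable_norm.
move=> s _; rewrite normrM [`|dchi _ _ _|]ger0_norm ?dchi_ge0//.
have [st|st] := leP s (t - n.+1%:R^-1); first by rewrite dchi_out ?mulr0//; left.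
have [ts|ts] := leP t s; first by rewrite dchi_out ?mulr0//; right.
rewrite ler_wpM2r ?dchi_ge0//; apply: hd.
rewrite -ball_normE/= gtr0_norm ?subr_gt0//.
by apply: lt_trans nd; rewrite ltrBlDl -ltrBlDr.
Qed.

Lemma cvg_integral_chi t T a (M : R) :
  (forall s, 0 < s -> {for s, continuous a}) -> (forall s, s \in `]0, T[ -> `|a s| <= M) ->
  (\int[leb]_(s in `]0, T[) (a s * chi t n s)) @[n --> \oo] -->
  \int[leb]_(s in `]0, T[) (a s * (s < t)%R%:R).
Proof.
move=> ca aM; have ma : measurable_fun (`]0, T[ : set R) a by exact: measurable_itv_continuous.
have mc n : measurable_fun (`]0, T[ : set R) (chi t n).
  by apply: measurable_itv_continuous => s _; exact: chi_continuous.
apply: (@cvg_Rintegral _ _ _ _ _ _ _ (cst M)) => //.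
- by move=> n; exact: measurable_funM ma (mc n).
- apply: (measurable_funM ma).
  apply: (@measurable_fun_cvg _ _ _ _ (fun n => chi t n)) => // s _; exact: chi_lim.
- by apply: aeW => s _; apply: cvgM; [exact: cvg_cst|exact: chi_lim].
- by apply: (@integrable_itv_bounded _ _ `|M|) => //.
- move=> n s sT.
  by rewrite normrM -[leRHS]mulr1 ler_pM ?aM// ger0_norm ?chi_ge0// chi_le1.
Qed.

End time_cutoff.

(** Brings continuity of a parameter integral within reach of dominated convergence, which speaks of
    sequences. *)
Lemma seq_continuous {R : realType} (T : pseudoMetricType R) (f : T -> R) x :
  (forall u : nat -> T, u n @[n --> \oo] --> x -> f (u n) @[n --> \oo] --> f x) ->
  {for x, continuous f}.
Proof.
move=> H; apply/near_dist_continuous => e e0; apply: contrapT => h.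
have : forall n : nat, exists y, ball x n.+1%:R^-1 y /\ ~ (`|f x - f y| <= e).
  move=> n; apply: contrapT => hn; apply: h; apply/nbhs_ballP.
  exists n.+1%:R^-1 => /=; first by rewrite invr_gt0.
  by move=> y xy; apply: contrapT => fy; apply: hn; exists y.
move=> /choice[u Hu].
have ux : u n @[n --> \oo] --> x.
  apply/cvg_ballP => d d0; have [k _ hk] := near_infty_natSinv_lt (PosNum d0).
  by exists k => // n /hk /= nd; apply: (le_ball (ltW nd)); exact: (Hu n).1.
have := H u ux => /cvgrPdist_le/(_ e e0)[k _ hk].
by apply: (Hu k).2; apply: hk => /=.
Qed.

(** * Space and time averages of a bounded function, continuous at positive times *)

Section bounded_spacetime.
Context {R : realType} {N : nat}.
Local Notation mu := (lebesgue_rV R N).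
Local Notation leb := (@lebesgue_measure R).
Variables (w : R * 'rV[R]_N -> R) (M : R).
Hypothesis cw : forall s x, 0 < s -> {for (s, x), continuous w}.
Hypothesis w0 : forall s x, s <= 0 -> w (s, x) = 0.
Hypothesis wM : forall z, `|w z| <= M.

Let M0 : 0 <= M. Proof. exact: le_trans (wM (0, 0)). Qed.

Lemma open_positive_times : open (@positive_times R N).
Proof.
rewrite (_ : @positive_times R N = (fst : R * 'rV[R]_N -> R) @^-1` [set s : R | 0 < s])//.
by apply: open_comp => [z _|]; [exact: cvg_fst|exact: open_gt].
Qed.

Lemma measurable_spacetime :
  measurable_fun setT (w : measurableTypeR R * 'rV[R]_N -> R).
Proof.
have -> : (w : measurableTypeR R * 'rV[R]_N -> R) = w \_ (@positive_times R N).
  apply/funext => -[s x]; rewrite patchE; case: ifPn => // /negP h.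
  by apply: w0; rewrite leNgt; apply/negP => s0; apply: h; rewrite inE.
apply/(measurable_restrictT _ _).1.
  apply: open_measurable_prod; exact: open_positive_times.
apply: continuous_measurable_prod; first exact: open_positive_times.
by move=> -[s x] s0; exact: cw.
Qed.

Lemma continuous_slice s : continuous (fun x => w (s, x)).
Proof.
move=> x; have [s0|s0] := leP s 0.
  rewrite (_ : (fun x => _) = cst 0); first exact: cst_continuous.
  by apply/funext => y; rewrite w0.
apply: (@continuous_comp _ _ _ (fun x => (s, x)) w); last exact: cw.
exact: (@cvg_pair _ _ _ (nbhs x) (nbhs s) (nbhs x) _ _ _ (cst s) idfun (@cst_continuous _ _ s x) cvg_id).
Qed.

Lemma continuous_time s x : 0 < s -> {for s, continuous (fun s => w (s, x))}.
Proof.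
move=> s0; apply: (@continuous_comp _ _ _ (fun s => (s, x)) w); last exact: cw.
exact: (@cvg_pair _ _ _ (nbhs s) (nbhs s) (nbhs x) _ _ _ idfun (cst x) cvg_id (@cst_continuous _ _ x s)).
Qed.

Section space_average.
Variables (rho : 'rV[R]_N -> R) (r : R).
Hypothesis crho : continuous rho.
Hypothesis rho_supp : forall x, r < `|x| -> rho x = 0.

Definition space_average s : R := \int[mu]_x (w (s, x) * rho x).

Lemma integrable_space s : mu.-integrable setT (EFin \o (fun x => w (s, x) * rho x)).
Proof.
apply: (@integrable_continuous_supp _ _ _ r) => [x|x rx]; last by rewrite rho_supp ?mulr0.
exact: (continuousM (@continuous_slice s x) (@crho x)).
Qed.

Let dom := (fun x => M * `|rho x|).

Let idom : mu.-integrable setT (EFin \o dom).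
Proof.
apply: (@integrable_continuous_supp _ _ _ r) => [x|x rx]; last first.
  by rewrite /dom rho_supp ?normr0 ?mulr0.
have c1 : {for x, continuous (fun x => `|rho x|)}.
  by apply: continuous_comp; [exact: crho|exact: norm_continuous].
by apply: (continuousM _ c1); exact: cst_continuous.
Qed.

Lemma space_average_bounded s : `|space_average s| <= \int[mu]_x (M * `|rho x|).
Proof.
have wi := integrable_space s.
apply: (le_trans (le_normr_Rintegral measurableT wi)).
apply: le_Rintegral => //; first exact: integrable_norm.
by move=> x _; rewrite normrM ler_wpM2r.
Qed.

Lemma space_average_continuous s : 0 < s -> {for s, continuous space_average}.
Proof.
move=> s0; apply: seq_continuous => u us.
have mr : measurable_fun setT rho by exact: continuous_measurable_rV.
have ms t : measurable_fun setT (fun x => w (t, x)).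
  by apply: continuous_measurable_rV; exact: continuous_slice.
apply: (@cvg_Rintegral _ _ _ _ _ _ _ dom) => //.
- by move=> n; exact: measurable_funM (ms _) mr.
- exact: measurable_funM (ms _) mr.
- apply: aeW => x _; apply: cvgM; last exact: cvg_cst.
  exact: (cvg_comp _ (fun s => w (s, x)) us (@continuous_time s x s0)).
- by move=> n x _; rewrite normrM ler_wpM2r.
Qed.

(** Fubini: restricted in time to []0, T[] and in space to the support of [rho], the integrand is
    bounded and lives on a box of finite measure. *)
Lemma Rintegral_space_average T (k : R -> R) (K : R) :
  measurable_fun (`]0, T[ : set R) k -> (forall s, s \in `]0, T[ -> `|k s| <= K) ->
  \int[leb]_(s in `]0, T[) (space_average s * k s) =
  \int[mu]_x ((\int[leb]_(s in `]0, T[) (w (s, x) * k s)) * rho x).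
Proof.
move=> mk kK.
pose I : set (measurableTypeR R) := `]0%R, T[%classic.
have mI : measurable I by exact: measurable_itv.
have finI : (leb I < +oo)%E.
  suff : (lebesgue_measure (`]0%R, T[%classic : set R) < +oo)%E by [].
  rewrite lebesgue_measure_itv/=; case: ifP => _; last exact: ltry.
  by rewrite -EFinB ltry.
pose B := [set x : 'rV[R]_N | `|x| <= r].
have mB : measurable B by exact: measurable_norm_le.
pose kI : measurableTypeR R -> R := k \_ I.
have mkI : measurable_fun setT kI by apply/(measurable_restrictT _ _).1.
pose f (z : measurableTypeR R * 'rV[R]_N) : R := w z * kI z.1 * rho z.2.
have mr : measurable_fun setT rho by exact: continuous_measurable_rV.
have mf : measurable_fun setT f.
  apply: measurable_funM; last exact: measurableT_comp.
  by apply: measurable_funM; [exact: measurable_spacetime|exact: measurableT_comp].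
have [C [C0 rC]] := continuous_supp_bounded crho rho_supp.
have kIK s : I s -> `|kI s| <= K by move=> Is; rewrite /kI patchE mem_set//; exact: kK.
have iF : (leb \x mu)%E.-integrable setT (EFin \o f).
  have -> : EFin \o f = (EFin \o f) \_ (I `*` B).
    apply/funext => -[s x]; rewrite patchE; case: ifPn => // /negP h /=.
    rewrite /f/= /kI patchE; case: ifPn => [/set_mem Is|]; last by rewrite mulr0 mul0r.
    rewrite rho_supp ?mulr0// ltNge; apply/negP => xr; apply: h.
    by rewrite inE.
  apply/(integrable_mkcond _ (measurableX mI mB)).1.
  apply: measurable_bounded_integrable; first exact: measurableX.
  - suff : ((leb \x mu)%E (I `*` B) < +oo)%E by [].
    rewrite product_measure1E//.
    by rewrite lte_mul_pinfty// ?ge0_fin_numE//; exact: norm_le_finite.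
  - exact: measurable_funTS.
  - exists (M * K * C); split; first exact: num_real.
    move=> c Mc [s x] /= [Is _]; apply: le_trans (ltW Mc); rewrite /f !normrM.
    apply: ler_pM => //.
    by apply: ler_pM => //; exact: kIK.
have E := @Fubini _ _ _ _ _ leb mu _ iF.
rewrite /Rintegral; congr fine.
rewrite integral_mkcond; transitivity (\int[leb]_s \int[mu]_y (EFin \o f) (s, y))%E.
  apply: eq_integral => s _; rewrite patchE; case: ifPn => Is.
    rewrite /space_average /Rintegral EFinM fineK; last first.
      exact: integrable_fin_num (integrable_space s).
    rewrite muleC -integralZl//; last exact: integrable_space.
    by apply: eq_integral => x _; rewrite /f /kI /= patchE Is -EFinM; congr EFin; ring.
  rewrite integral0_eq// => x _; rewrite /f /kI /= patchE (negPf Is).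
  by rewrite mulr0 mul0r.
rewrite E; apply: eq_integral => x _.
have iwk : leb.-integrable I (EFin \o (fun s => w (s, x) * k s)).
  apply: measurable_bounded_integrable => //.
    apply: measurable_funM => //; apply: measurable_funTS.
    exact: (measurable_fun_pair1 x measurable_spacetime).
  exists (M * K); split; first exact: num_real.
  move=> c Mc s Is; apply: le_trans (ltW Mc); rewrite normrM.
  by apply: ler_pM => //; exact: kK.
rewrite /Rintegral EFinM fineK; last exact: integrable_fin_num iwk.
rewrite muleC -integralZl// integral_mkcond; apply: eq_integral => s _.
rewrite /f /kI /= !patchE; case: ifP => _; last by rewrite mulr0 mul0r.
by rewrite -EFinM; congr EFin; ring.
Qed.

End space_average.

Section time_average.
Variables (T : R) (k : R -> R) (K : R).
Hypothesis mk : measurable_fun (`]0, T[ : set R) k.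
Hypothesis kK : forall s, s \in `]0, T[ -> `|k s| <= K.

(** The indicator of [s < t] keeps the domain fixed, so that [t] is a parameter of the integrand
    alone. *)
Definition time_average t x : R :=
  \int[leb]_(s in `]0, T[) (w (s, x) * (k s * (s < t)%R%:R)).

Lemma measurable_before t : measurable_fun (`]0, T[ : set R) (fun s => (s < t)%R%:R : R).
Proof.
apply: (@measurable_fun_cvg _ _ _ _ (fun n => chi t n)) => [n|s _]; last exact: chi_lim.
by apply: measurable_itv_continuous => s _; exact: chi_continuous.
Qed.

Let mint t x : measurable_fun (`]0, T[ : set R) (fun s => w (s, x) * (k s * (s < t)%R%:R)).
Proof.
apply: measurable_funM.
  apply: measurable_funTS; exact: (measurable_fun_pair1 x measurable_spacetime).
exact: measurable_funM mk (measurable_before t).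
Qed.

Let intK t x s : s \in `]0, T[ -> `|w (s, x) * (k s * (s < t)%R%:R)| <= M * K.
Proof.
move=> sT; rewrite normrM ler_pM// normrM -[leRHS]mulr1 ler_pM ?kK//.
by case: (s < t); rewrite ?normr0 ?normr1.
Qed.

Lemma integrable_time t x :
  leb.-integrable `]0, T[ (EFin \o (fun s => w (s, x) * (k s * (s < t)%R%:R))).
Proof.
apply: measurable_bounded_integrable.
- exact: measurable_itv.
- suff : (lebesgue_measure (`]0%R, T[%classic : set R) < +oo)%E by [].
  rewrite lebesgue_measure_itv/=; case: ifP => _; last exact: ltry.
  by rewrite -EFinB ltry.
- exact: mint.
exists (M * K); split; first exact: num_real.
by move=> c Mc s Is; apply: le_trans (ltW Mc); exact: intK.
Qed.

Lemma time_average_continuous : continuous (fun z => time_average z.1 z.2).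
Proof.
move=> [t x]; apply: seq_continuous => u utx.
have u1 : (u n).1 @[n --> \oo] --> t by exact: (cvg_comp u fst utx cvg_fst).
have u2 : (u n).2 @[n --> \oo] --> x by exact: (cvg_comp u snd utx cvg_snd).
apply: (@cvg_Rintegral _ _ _ _ _ _ _ (cst (M * K))) => //.
- by move=> n; exact: mint.
- exact: mint.
(* The indicators of [s < (u n).1] may fail to converge at [s = t], a single point and thus a null
   set. *)
- have nt : leb.-negligible [set t] by exists [set t]; split => //; exact: lebesgue_measure_set1.
  apply: negligibleS nt => s /= H; apply: contrapT => st; apply: H => _; apply: cvgM.
    exact: (cvg_comp _ (fun x => w (s, x)) u2 (@continuous_slice s x)).
  apply: cvgM; first exact: cvg_cst.
  apply: cvg_near_cst; have [lst|lts|//] := ltgtP s t.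
    near=> n; suff -> : (s < (u n).1) by [].
    by near: n; exact: cvgr_gt u1 _ lst.
  near=> n; suff : ((u n).1 < s) by move=> /ltW; rewrite leNgt => /negbTE ->.
  by near: n; exact: cvgr_lt u1 _ lts.
- exact: (@integrable_itv_bounded R T (cst (M * K)) `|M * K|).
- by move=> n s Is; exact: intK.
Unshelve. all: by end_near. Qed.

End time_average.

End bounded_spacetime.

(** * The weak formulation *)

Section Linfty.
Context d (T : measurableType d) (R : realType) (mu : {measure set T -> \bar R}).

Lemma Linfty_pos_bounded (D : set T) (f : T -> R) : measurable D ->
  Linfty_pos mu D f ->
  measurable_fun D f /\
  exists M, 0 <= M /\ {ae mu, forall x, D x -> 0 <= f x <= M}.
Proof.
move=> mD [/andP[/set_mem mf /set_mem /= ff] f0].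
split; first exact/(measurable_restrictT f mD).
have [M [M0 fM]] : exists M, 0 <= M /\ {ae mu, forall x, D x -> f x <= M}; last first.
  by exists M; split=> //; apply: filterS2 f0 fM => x f0 fM Dx; rewrite f0// fM.
(* The norm of exponent [+oo] is an essential supremum only when the whole space has positive
   measure; otherwise every property holds almost everywhere. *)
move: ff; rewrite /finite_norm unlock; case: ifPn => [muT ff|/negP muT _]; last first.
  exists 0; split=> //; exists setT; split=> //.
  by apply/eqP; rewrite eq_le measure_ge0 andbT leNgt; exact/negP.
have [M [M0 HM]] : exists M : R, 0 <= M /\ (ess_sup_inf.ess_sup mu (abse \o (EFin \o f \_ D)) <= M%:E)%E.
  have := ff; case: (ess_sup_inf.ess_sup _ _) => [a _|//|_]; last by exists 0; split; rewrite ?leNye.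
  by exists `|a|; split=> //; rewrite lee_fin ler_norm.
exists M; split=> //; have /ess_sup_inf.ess_supP := HM.
apply: filterS => x /= fM Dx; move: fM; rewrite patchE mem_set//= lee_fin.
exact: le_trans (ler_norm _).
Qed.

End Linfty.

Section product_ae.
Context {R : realType} {N : nat}.
Local Notation mu := (lebesgue_rV R N).
Local Notation leb := (@lebesgue_measure R).
Local Notation prodm := (@spacetime_measure R N).

(** By the definition of the product measure, a null set has total section measure zero, so almost
    all of its sections are null. *)
Lemma ae_section (P : R * 'rV[R]_N -> Prop) :
  {ae prodm, forall z, P z} -> {ae leb, forall s, {ae mu, forall x, P (s, x)}}.
Proof.
move=> [A [mA A0 PA]].
have mx : measurable_fun setT (mu \o xsection A) by exact: measurable_fun_xsection.
have : ae_eq leb setT (mu \o xsection A) (cst 0%E).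
  apply/ae_eq_integral_abs => //.
  transitivity (\int[leb]_s (mu (xsection A s)))%E; last exact: A0.
  by apply: eq_integral => s _; rewrite gee0_abs.
apply: filterS => s /(_ I) /= sA0.
exists (xsection A s); split => //; first exact: measurable_xsection.
by move=> x /= nP; rewrite /xsection/= inE; exact: PA.
Qed.

Lemma ball_spacetime_gt0 s x e : 0 < e ->
  (0 < prodm (ball s e `*` ball x e))%E.
Proof.
move=> e0.
suff -> : prodm (ball s e `*` ball x e) = ((e *+ 2)%:E * ((e *+ 2) ^+ N)%:E)%E.
  by rewrite -EFinM lte_fin mulr_gt0 ?exprn_gt0 ?pmulrn_lgt0.
rewrite -(lebesgue_rV_ball x e0) -(lebesgue_measure_ball s (ltW e0)).
apply: product_measure1E; first exact: measurable_ball.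
by apply: open_measurable_rV; exact: ball_open.
Qed.

(** By continuity a violation at one point persists on a product of balls, which has positive
    measure. It turns essential bounds on [u] into pointwise ones on its continuous
    representative. *)
Lemma ae_positive_times_le (f : R * 'rV[R]_N -> R) (c : R) :
  (forall z, positive_times z -> {for z, continuous f}) ->
  {ae prodm, forall z, positive_times z -> f z <= c} ->
  forall z, positive_times z -> f z <= c.
Proof.
move=> cf [A [mA A0 fA]] z z0; rewrite leNgt; apply/negP => fz.
have h1 := near_gt_continuous (cf z z0) fz.
have h2 : \forall y \near z, positive_times y.
  by apply: open_nbhs_nbhs; split => //; exact: open_positive_times.
have /nbhs_ballP[e /= e0 he] : nbhs z [set y | c < f y /\ positive_times y].
  by near=> y; split; near: y.
have sub : ball z.1 e `*` ball z.2 e `<=` A.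
  move=> y [y1 y2]; apply: fA => /= H.
  have [] : c < f y /\ positive_times y by apply: he; split.
  by move=> cy /H; rewrite leNgt cy.
have : (prodm (ball z.1 e `*` ball z.2 e) <= prodm A)%E.
  apply: le_measure => //; rewrite inE//; apply: measurableX; first exact: measurable_ball.
  by apply: open_measurable_rV; exact: ball_open.
by rewrite A0 leNgt ball_spacetime_gt0.
Unshelve. all: by end_near. Qed.

End product_ae.

(** * Test functions that separate time and space *)

Section product_test.
Context {R : realType} {N : nat}.
Variables (theta dtheta : R -> R) (rho : 'rV[R]_N -> R).
Hypothesis dtP : forall s, is_derive s (1 : R) theta (dtheta s).
Hypothesis cdt : continuous dtheta.
Hypothesis trho : is_test rho.

Let zeta (z : R * 'rV[R]_N) := theta z.1 * rho z.2.

Let derive_fst (f : R -> R) v z : 'D_v (fun z : R * 'rV[R]_N => f z.1) z = 'D_(v.1) f z.1.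
Proof. by []. Qed.

Let derive_snd (f : 'rV[R]_N -> R) v z :
  'D_v (fun z : R * 'rV[R]_N => f z.2) z = 'D_(v.2) f z.2.
Proof. by []. Qed.

Let dth s : differentiable theta s.
Proof. by apply/derivable1_diffP; have [] := dtP s. Qed.

Let Dth s v : 'D_v theta s = v * dtheta s.
Proof.
have [_ h] := dtP s; rewrite -h !deriveE// -[v in LHS]mulr1 -[v * 1]/(v *: 1 : R).
by rewrite linearZ.
Qed.

Let C1fst : Ck 1 (fun z : R * 'rV[R]_N => theta z.1).
Proof.
split=> [z|v].
  apply: (@differentiable_comp _ _ _ _ fst theta) => //.
  by apply: linear_differentiable => y; exact: cvg_fst.
move=> z; rewrite (_ : 'D_v _ = (fun z => v.1 * dtheta z.1)); last first.
  by apply/funext => y; rewrite derive_fst Dth.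
have c1 : {for z, continuous (fun z : R * 'rV[R]_N => dtheta z.1)}.
  by apply: (@continuous_comp _ _ _ fst dtheta); [exact: cvg_fst|exact: cdt].
exact: (continuousM (@cst_continuous _ _ v.1 z) c1).
Qed.

Let C1snd : Ck 1 (fun z : R * 'rV[R]_N => rho z.2).
Proof.
have [dr cr] := trho.1 1%N.
split=> [z|v].
  apply: (@differentiable_comp _ _ _ _ snd rho) => //.
  by apply: linear_differentiable => y; exact: cvg_snd.
move=> z; apply: (@continuous_comp _ _ _ snd ('D_v.2 rho)); first exact: cvg_snd.
exact: cr.
Qed.

Lemma time_partial_product z : time_partial zeta z = dtheta z.1 * rho z.2.
Proof.
have [d1 _] := C1fst; have [d2 _] := C1snd.
rewrite /time_partial /zeta (_ : (fun z => _) = (fun z => theta z.1) * (fun z : R * 'rV[R]_N => rho z.2))//.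
rewrite deriveM; [|exact/diff_derivable|exact/diff_derivable].
rewrite derive_fst derive_snd/= Dth mul1r derive0.
by rewrite /GRing.scale/= mulr0 add0r mulrC.
Qed.

Lemma space_partial_product i z : space_partial i zeta z = theta z.1 * partial i rho z.2.
Proof.
have [d1 _] := C1fst; have [d2 _] := C1snd.
rewrite /space_partial /zeta (_ : (fun z => _) = (fun z => theta z.1) * (fun z : R * 'rV[R]_N => rho z.2))//.
rewrite deriveM; [|exact/diff_derivable|exact/diff_derivable].
rewrite derive_fst derive_snd/= Dth mul0r.
by rewrite /GRing.scale/= mulr0 addr0.
Qed.

(** Test functions are defined on the whole time axis, so compactness of the support also needs a
    lower end [a]; the support lies in [[a, t]] times a ball. *)
Lemma test_function_product a t T : t < T -> (forall s, s <= a -> theta s = 0) ->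
  (forall s, t <= s -> theta s = 0) -> test_function T zeta.
Proof.
move=> tT ta tt; have [_ [r hr]] := trho.
pose B : set (R * 'rV[R]_N) := `[a, t]%classic `*` [set x | `|x| <= r].
have cB : compact B by apply: compact_setX; [exact: segment_compact|exact: compact_norm_le].
have clB : closed B by apply: compact_closed => //.
have sB : tsupport zeta `<=` B.
  rewrite [X in _ `<=` X](closure_id _).1//; apply: closure_subset => -[s x] /= sx; split=> /=.
    rewrite in_itv/= !leNgt; apply/andP; split; apply/negP => h; move: sx; rewrite /zeta/=.
      by rewrite ta ?(ltW h)// mul0r eqxx.
    by rewrite tt ?(ltW h)// mul0r eqxx.
  by rewrite leNgt; apply/negP => h; move: sx; rewrite /zeta/= hr// mulr0 eqxx.
split.
- exact: (CkM C1fst C1snd).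
- by apply: (subclosed_compact _ cB sB); exact: closed_closure.
- by move=> z /sB[/=]; rewrite in_itv/= => /andP[_ zt] _; exact: le_lt_trans tT.
Qed.

End product_test.

Section H1loc.
Context {R : realType} {N : nat}.
Local Notation mu := (lebesgue_rV R N).
Implicit Types (f F rho phi : 'rV[R]_N -> R) (g : 'rV[R]_N -> 'rV[R]_N).

Lemma continuous_enorm_powR (a : R) : 0 < a -> continuous (fun x : 'rV[R]_N => enorm x `^ a).
Proof.
move=> a0; rewrite (_ : (fun x => _) = (fun x : 'rV[R]_N => sqn x `^ (a / 2))).
  by apply: continuous_sqn_powR; rewrite divr_gt0.
by apply/funext => x; rewrite enorm_powR.
Qed.

Lemma sqr_enorm (x : 'rV[R]_N) : enorm x ^+ 2 = sqn x.
Proof. by rewrite sqr_sqrtr// sqn_ge0. Qed.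

(** [phi] is bounded with bounded support, and [|a| <= 1 + a^2] reduces the claim to the local
    square integrability of the gradient. *)
Lemma H1loc_integrable f g phi i : H1loc f g -> is_test phi ->
  mu.-integrable setT (EFin \o (fun x => g x ord0 i * phi x)).
Proof.
move=> [mf mg fin _] tphi; have [_ [r hr]] := tphi.
have cphi := is_test_continuous tphi.
have [C [C0 HC]] := continuous_supp_bounded cphi hr.
pose K := [set x : 'rV[R]_N | `|x| <= r].
have mK : measurable K by exact: measurable_norm_le.
pose h x := f x ^+ 2 + enorm (g x) ^+ 2.
have mgi j : measurable_fun setT (fun x => g x ord0 j).
  exact: measurableT_comp (measurable_coord j) mg.
have mh : measurable_fun setT h.
  apply: measurable_funD; first exact: measurable_funX.
  rewrite (_ : (fun x => _) = (fun x => \sum_(j < N) g x ord0 j ^+ 2)); last first.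
    by apply/funext => x; rewrite sqr_enorm.
  by apply: measurable_sum => j; exact: measurable_funX.
have h0 x : 0 <= h x by rewrite addr_ge0 ?sqr_ge0.
have ih : mu.-integrable K (EFin \o h).
  apply/integrableP; split; first by apply/measurable_EFinP; exact: measurable_funTS.
  under eq_integral => x _ do rewrite gee0_abs ?lee_fin//.
  by apply: fin; exact: compact_norm_le.
have i1 : mu.-integrable K (EFin \o cst 1).
  apply: measurable_bounded_integrable => //; first exact: norm_le_finite.
  by exists 1; split; [exact: num_real|move=> c c1 x _ /=; rewrite normr1 ltW].
have id : mu.-integrable K (EFin \o (fun x => C * (1 + h x))).
  have := integrableZl mK C (integrableD mK i1 ih).
  by apply: eq_integrable => // x _.
have -> : EFin \o (fun x => g x ord0 i * phi x) = (EFin \o (fun x => g x ord0 i * phi x)) \_ K.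
  apply/funext => x; rewrite patchE; case: ifPn => // /negP hK /=.
  by rewrite hr ?mulr0// ltNge; apply/negP => xr; apply: hK; rewrite inE.
apply/(integrable_mkcond _ mK).1; apply: (le_integrable mK _ _ id).
  apply/measurable_EFinP; apply: measurable_funTS; apply: measurable_funM => //.
  exact: continuous_measurable_rV.
move=> x _ /=; rewrite lee_fin normrM mulrC [leRHS]ger0_norm; last first.
  by rewrite mulr_ge0// addr_ge0.
apply: ler_pM => //.
have : g x ord0 i ^+ 2 <= h x.
  by rewrite /h sqr_enorm (le_trans (coord_sqn _ i))// lerDr sqr_ge0.
rewrite -[g x ord0 i ^+ 2]real_normK ?num_real// => H.
by have := sqr_ge0 (`|g x ord0 i| - 1); rewrite expr2 in H *; move: H; set a := `|_|; set b := h x; nra.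
Qed.

(** The weak gradient is tested with each [partial i rho], which moves the second derivative onto
    [rho]. With the continuous version [F] of [f], the right-hand side is integrable because [rho]
    has bounded support. *)
Lemma H1loc_laplacian f F g rho : H1loc f g -> is_test rho -> continuous F ->
  {ae mu, forall x, f x = F x} ->
  mu.-integrable setT (EFin \o (fun x => \sum_(i < N) g x ord0 i * partial i rho x)) /\
  \int[mu]_x (\sum_(i < N) g x ord0 i * partial i rho x) =
  - \int[mu]_x (F x * laplacian rho x).
Proof.
move=> fg trho cF fF; have [mf mg _ wg] := fg.
have tp i : is_test (partial i rho) by exact: is_test_derive.
have tpp i : is_test (partial i (partial i rho)) by exact: is_test_derive.
have ig i := H1loc_integrable i fg (tp i).
have iF i := integrable_test cF (tpp i).
split.
  rewrite (_ : EFin \o _ = (fun x => \sum_(i < N) (g x ord0 i * partial i rho x)%:E)%E); last first.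
    by apply/funext => x /=; rewrite sumEFin.
  by apply: integrable_sum => // i _; exact: ig.
transitivity (\sum_(i < N) \int[mu]_x (g x ord0 i * partial i rho x)).
  exact: (Rintegral_sum _ ig).
transitivity (- \sum_(i < N) \int[mu]_x (F x * partial i (partial i rho) x)); last first.
  rewrite -(Rintegral_sum _ iF); congr (- _); apply: eq_Rintegral => x _.
  by rewrite mulr_sumr.
rewrite -sumrN; apply: eq_bigr => i _.
have [cp1 _] := tp i.
have E := wg i _ cp1 (is_test_compact (tp i)).
rewrite /Rintegral -[in LHS](oppeK (integral _ _ _)) -E fineN; congr (- fine _).
apply: ae_eq_integral => //.
- apply/measurable_EFinP; apply: measurable_funM => //.
  by apply: continuous_measurable_rV; exact: is_test_continuous.
- exact: measurable_int (iF i).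
- by apply: filterS fF => x /= -> _.
Qed.

Variables (m q sigma M : R).
Hypotheses (m0 : 0 < m) (q0 : 0 < q) (sigma0 : 0 < sigma).

(** Here [a] and [c] stand for the values at a fixed time of the derivative of [theta] and of
    [theta]. The gradient disappears, and [u0], [us] are replaced by their bounded and continuous
    versions. *)
Lemma weak_slice (u0 b us F : 'rV[R]_N -> R) g rho (a c : R) :
  measurable_fun setT u0 -> measurable_fun setT b -> (forall x, `|b x| <= M) ->
  {ae mu, forall x, u0 x = b x} ->
  measurable_fun setT us -> continuous F -> (forall x, 0 <= F x) ->
  {ae mu, forall x, us x = F x} ->
  H1loc (fun x => us x `^ m) g -> is_test rho ->
  (\int[mu]_x ((u0 x - us x) * (a * rho x)
      + \sum_(i < N) g x ord0 i * (c * partial i rho x)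
      + enorm x `^ sigma * us x `^ q * (c * rho x))%:E =
   ((\int[mu]_x (b x * rho x) - \int[mu]_x (F x * rho x)) * a
    + (\int[mu]_x (F x `^ q * (enorm x `^ sigma * rho x)) -
       \int[mu]_x (F x `^ m * laplacian rho x)) * c)%:E)%E.
Proof.
move=> mu0 mb bM u0b mus cF F0 usF Hg trho.
have crho := is_test_continuous trho.
have cpow e : 0 < e -> continuous (fun x => F x `^ e).
  move=> e0 x; apply: continuous_powR => //; last exact: cF.
  by near=> y; exact: F0.
have mrho : measurable_fun setT rho by exact: continuous_measurable_rV.
have men : measurable_fun setT (fun x : 'rV[R]_N => enorm x `^ sigma).
  by apply: continuous_measurable_rV; exact: continuous_enorm_powR.
have usmF : {ae mu, forall x, us x `^ m = F x `^ m}.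
  by apply: filterS usF => x ->.
have [iG EG] := H1loc_laplacian Hg trho (cpow m m0) usmF.
have [_ [r hr]] := trho.
have ib : mu.-integrable setT (EFin \o (fun x => b x * rho x)).
  have [C [C0 HC]] := continuous_supp_bounded crho hr.
  apply: (@integrable_bounded_supp _ _ _ r (M * C)) => [|x|x rx].
  - exact: measurable_funM.
  - by rewrite normrM ler_pM.
  - by rewrite hr ?mulr0.
have iF := integrable_test cF trho.
have iq : mu.-integrable setT (EFin \o (fun x => F x `^ q * (enorm x `^ sigma * rho x))).
  apply: (@integrable_continuous_supp _ _ _ r) => [x|x rx]; last by rewrite hr ?mulr0.
  apply: (continuousM (cpow q q0 x)).
  exact: (continuousM (@continuous_enorm_powR _ sigma0 x) (crho x)).
pose G x := \sum_(i < N) g x ord0 i * partial i rho x.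
pose H x := (b x * rho x - F x * rho x) * a + (F x `^ q * (enorm x `^ sigma * rho x) + G x) * c.
have i1 : mu.-integrable setT (EFin \o (fun x => (b x * rho x - F x * rho x) * a)).
  have := integrableZl measurableT a (integrableB measurableT ib iF).
  by apply: eq_integrable => // x _ /=; rewrite -EFinM; congr EFin; rewrite mulrC.
have i2 : mu.-integrable setT (EFin \o (fun x => (F x `^ q * (enorm x `^ sigma * rho x) + G x) * c)).
  have := integrableZl measurableT c (integrableD measurableT iq iG).
  by apply: eq_integrable => // x _ /=; rewrite -EFinM; congr EFin; rewrite mulrC.
have iH : mu.-integrable setT (EFin \o H).
  by have := integrableD measurableT i1 i2; apply: eq_integrable => // x _.
transitivity (\int[mu]_x (H x)%:E)%E.
  have EG0 x : \sum_(i < N) g x ord0 i * (c * partial i rho x) = G x * c.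
    by rewrite /G mulr_suml; apply: eq_bigr => i _; ring.
  apply: ae_eq_integral => //.
  - apply/measurable_EFinP; apply: measurable_funD; first apply: measurable_funD.
    + apply: measurable_funM; first exact: measurable_funB.
      exact: measurable_funM.
    + under eq_fun do rewrite EG0.
      by apply: measurable_funM => //; apply/measurable_EFinP; exact: measurable_int iG.
    + apply: measurable_funM; last exact: measurable_funM.
      apply: measurable_funM => //.
      exact: (measurableT_comp (@measurable_powR _ q) mus).
  - exact: measurable_int iH.
  - apply: filterS2 u0b usF => x /= -> -> _; congr EFin.
    by rewrite EG0 /H; ring.
rewrite -[LHS]fineK; last exact: integrable_fin_num iH.
congr EFin; rewrite -/(Rintegral mu setT H) /H (RintegralD measurableT i1 i2).
have iB := integrableB measurableT ib iF.
have iD := integrableD measurableT iq iG.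
rewrite (RintegralZr _ measurableT iB) (RintegralZr _ measurableT iD).
by rewrite (RintegralB measurableT ib iF) (RintegralD measurableT iq iG) EG.
Unshelve. all: by end_near. Qed.

End H1loc.

(** The integrand has no sign and no integrability, so Tonelli is applied to its positive and
    negative parts separately. *)
Lemma measurable_slice_integral {R : realType} {N : nat}
    (f : measurableTypeR R * 'rV[R]_N -> \bar R) : measurable_fun setT f ->
  measurable_fun setT (fun s => \int[lebesgue_rV R N]_x f (s, x))%E.
Proof.
move=> mf.
have mp : measurable_fun setT (f^\+)%E by exact: measurable_funepos.
have mn : measurable_fun setT (f^\-)%E by exact: measurable_funeneg.
have h1 := measurable_fun_fubini_tonelli_F (m2 := lebesgue_rV R N) _ mp (funepos_ge0 f).
have h2 := measurable_fun_fubini_tonelli_F (m2 := lebesgue_rV R N) _ mn (funeneg_ge0 f).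
rewrite (_ : (fun s => _) = (fubini_F (lebesgue_rV R N) f^\+ \- fubini_F (lebesgue_rV R N) f^\-)%E).
  exact: (emeasurable_funB h1 h2).
apply/funext => s; rewrite [LHS]integralE.
under eq_integral do rewrite funepos_comp/=.
by under [X in (_ - X = _)%E]eq_integral do rewrite funeneg_comp/=.
Qed.

Definition spacetime_powR {R : realType} {N : nat} (w : R * 'rV[R]_N -> R) p z := w z `^ p.

Section weak_product.
Context {R : realType} {N : nat}.
Local Notation mu := (lebesgue_rV R N).
Local Notation leb := (@lebesgue_measure R).
Variables (m q sigma : R).
Hypotheses (m0 : 0 < m) (q0 : 0 < q) (sigma0 : 0 < sigma).
Variables (u0 b : 'rV[R]_N -> R) (u w : R * 'rV[R]_N -> R) (M : R).
Hypotheses (mu0 : measurable_fun setT u0) (mb : measurable_fun setT b).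
Hypotheses (bM : forall x, `|b x| <= M) (u0b : {ae mu, forall x, u0 x = b x}).
Hypothesis usol : weak_solution m q sigma u0 u.
Hypothesis uw : {ae @spacetime_measure R N, forall z, positive_times z -> w z = u z}.
Hypothesis cw : forall s x, 0 < s -> {for (s, x), continuous w}.
Hypothesis w0 : forall s x, s <= 0 -> w (s, x) = 0.
Hypothesis wge0 : forall z, 0 <= w z.
Hypothesis wM : forall z, `|w z| <= M.

Local Notation wp := (spacetime_powR w).

Lemma continuous_spacetime_powR p s x : 0 < p -> 0 < s -> {for (s, x), continuous (wp p)}.
Proof.
move=> p0 s0; apply: continuous_powR => //; last exact: cw.
by near=> z; exact: wge0.
Unshelve. all: by end_near. Qed.

Lemma spacetime_powR0 p s x : 0 < p -> s <= 0 -> wp p (s, x) = 0.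
Proof. by move=> p0 s0; rewrite /spacetime_powR w0// powR0// gt_eqF. Qed.

Lemma spacetime_powR_bounded p z : 0 <= p -> `|wp p z| <= M `^ p.
Proof.
move=> p0; have wz : w z <= M by apply: le_trans (wM z); exact: ler_norm.
rewrite ger0_norm ?powR_ge0//; apply: ge0_ler_powR => //; rewrite nnegrE//.
exact: le_trans wz.
Qed.

Lemma weak_product (T a t : R) (theta dtheta : R -> R) rho : 0 < T -> t < T ->
  (forall s, is_derive s (1 : R) theta (dtheta s)) -> continuous dtheta ->
  (forall s, s <= a -> theta s = 0) -> (forall s, t <= s -> theta s = 0) ->
  is_test rho ->
  \int[leb]_(s in `]0, T[)
    ((\int[mu]_x (b x * rho x) - space_average w rho s) * dtheta s
     + (space_average (wp q) (fun x => (enorm x `^ sigma * rho x)) s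
        - space_average (wp m) (laplacian rho) s) * theta s) = 0.
Proof.
move=> T0 tT dt cdt ta tt trho.
have [uinf /(_ T T0)[g [[mum mg Hae _] weak]]] := usol.
have tz := test_function_product dt cdt trho tT ta tt.
have mpos : measurable (@positive_times R N : set (measurableTypeR R * 'rV[R]_N)).
  by apply: open_measurable_prod; exact: open_positive_times.
have [mu_ _] := Linfty_pos_bounded mpos uinf.
have crho := is_test_continuous trho.
have cth : continuous theta.
  move=> s; apply/differentiable_continuous/derivable1_diffP.
  by have [] := dt s.
pose D : set (measurableTypeR R * 'rV[R]_N) := `]0%R, T[%classic `*` setT.
have mI : measurable (`]0%R, T[%classic : set (measurableTypeR R)) by exact: measurable_itv.
have mD : measurable D by exact: measurableX.
have Dpos : D `<=` @positive_times R N by move=> [s x] [/=]; rewrite in_itv/= => /andP[].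
pose G (z : measurableTypeR R * 'rV[R]_N) := (u0 z.2 - u z) * (dtheta z.1 * rho z.2)
  + \sum_(i < N) g z ord0 i * (theta z.1 * partial i rho z.2)
  + enorm z.2 `^ sigma * u z `^ q * (theta z.1 * rho z.2).
have mfst (f : R -> R) : continuous f -> measurable_fun D (fun z => f z.1).
  move=> cf; apply: measurable_funTS.
  by apply: (measurableT_comp (f := f)) => //; exact: continuous_measurable_fun.
have msnd (f : 'rV[R]_N -> R) : measurable_fun setT f -> measurable_fun D (fun z => f z.2).
  move=> mf; apply: measurable_funTS.
  exact: (measurableT_comp (f := f)).
have muD : measurable_fun D u by exact: measurable_funS mu_.
have mG : measurable_fun D G.
  apply: measurable_funD; first apply: measurable_funD.
  - apply: measurable_funM; first by apply: measurable_funB => //; exact: msnd.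
    by apply: measurable_funM; [exact: mfst|apply: msnd; exact: continuous_measurable_rV].
  - apply: measurable_sum => i; apply: measurable_funM.
      exact: (measurableT_comp (measurable_coord i) mg).
    apply: measurable_funM; [exact: mfst|apply: msnd; apply: continuous_measurable_rV].
    by apply: is_test_continuous; exact: is_test_derive.
  - apply: measurable_funM.
      apply: measurable_funM.
        apply: (msnd (fun x => enorm x `^ sigma)).
        by apply: continuous_measurable_rV; exact: continuous_enorm_powR.
      exact: (measurableT_comp (@measurable_powR _ q) muD).
    by apply: measurable_funM; [exact: mfst|apply: msnd; exact: continuous_measurable_rV].
(* The space integral of the weak form agrees with the continuous function [K] at almost every time
   only, and comparing their time integrals calls for measurability of both. *)
have mI2 : measurable_fun (`]0%R, T[%classic : set R) (fun s => \int[mu]_x (G (s, x))%:E)%E.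
  have mGT : measurable_fun setT (EFin \o (G \_ D)).
    by apply/measurable_EFinP; apply/(measurable_restrictT _ _).1.
  have := measurable_slice_integral mGT.
  move=> /(measurable_funTS (D := `]0%R, T[%classic)); apply: eq_measurable_fun => s sT.
  by apply: eq_integral => x _ /=; rewrite patchE mem_set//; split => //; rewrite inE in sT.
pose K s := (\int[mu]_x (b x * rho x) - space_average w rho s) * dtheta s
  + (space_average (wp q) (fun x => (enorm x `^ sigma * rho x)) s
     - space_average (wp m) (laplacian rho) s) * theta s.
rewrite -[LHS]/(\int[leb]_(s in `]0, T[) K s).
have [_ [r hr]] := trho.
have cen : continuous (fun x => enorm x `^ sigma * rho x).
  by move=> x; exact: (continuousM (@continuous_enorm_powR _ _ _ sigma0 x) (crho x)).
have [_ [r' hr']] := is_test_laplacian trho.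
have cl := is_test_continuous (is_test_laplacian trho).
have hen x : r < `|x| -> enorm x `^ sigma * rho x = 0 by move=> rx; rewrite hr ?mulr0.
have cK s : 0 < s -> {for s, continuous K}.
  move=> s0; have sac p := @space_average_continuous _ _ (wp p) (M `^ p).
  have c1 := space_average_continuous cw w0 wM crho hr s0.
  have c2 := sac q (fun s x => @continuous_spacetime_powR q s x q0) (fun s x => @spacetime_powR0 q s x q0)
    (fun z => spacetime_powR_bounded z (ltW q0)) _ _ cen hen _ s0.
  have c3 := sac m (fun s x => @continuous_spacetime_powR m s x m0) (fun s x => @spacetime_powR0 m s x m0)
    (fun z => spacetime_powR_bounded z (ltW m0)) _ _ cl hr' _ s0.
  apply: cvgD; apply: cvgM; [apply: cvgB => //; exact: cvg_cst|exact: cdt|exact: cvgB|exact: cth].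
(* Both the spatial [H1loc] regularity and the equality of [u (s, x)] and [w (s, x)] for almost
   every [x] are available for almost every [s] only. *)
have Eae : {ae leb, forall s, s \in `]0, T[ -> (K s)%:E = (\int[mu]_x
    ((u0 x - u (s, x)) * time_partial (fun z => theta z.1 * rho z.2) (s, x)
     + \sum_(i < N) g (s, x) ord0 i * space_partial i (fun z => theta z.1 * rho z.2) (s, x)
     + enorm x `^ sigma * u (s, x) `^ q * (theta s * rho x))%R%:E)%E}.
  have aw := ae_section uw; apply: (@filterS2 _ _ (ae_filter_ringOfSetsType leb) _ _ _ _ Hae aw) => s Hs us sT.
  have s0 : 0 < s by move: sT; rewrite in_itv/= => /andP[].
  have {}Hs := Hs sT.
  have us' : {ae mu, forall x, u (s, x) = w (s, x)}.
    by move: us; apply: filterS => x /= ->.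
  have mus : measurable_fun setT (fun x => u (s, x)).
    have mup : measurable_fun setT ((u : measurableTypeR R * 'rV[R]_N -> R) \_ (@positive_times R N)).
      by apply/(measurable_restrictT _ _).1.
    have := measurable_fun_pair2 s mup; apply: eq_measurable_fun => x _.
    by rewrite patchE mem_set.
  rewrite /K -(@weak_slice _ _ m q sigma M m0 q0 sigma0 _ _ _ _ _ _ _ _ mu0 mb bM u0b mus (@continuous_slice _ _ w cw w0 s) _ us' Hs trho)//.
  apply: eq_integral => x _.
  rewrite (time_partial_product dt cdt trho)/=; congr EFin; congr (_ + _ + _).
  by apply: eq_bigr => i _; rewrite (space_partial_product dt cdt trho).
have H : (\int[leb]_(s in `]0%R, T[) (K s)%:E = 0)%E.
  rewrite -(weak _ tz); apply: ae_eq_integral => //.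
  - apply/measurable_EFinP; apply: measurable_itv_continuous; exact: cK.
  - move: mI2; apply: eq_measurable_fun => s _; apply: eq_integral => x _.
    rewrite /G (time_partial_product dt cdt trho)/=; congr EFin; congr (_ + _ + _).
    by apply: eq_bigr => i _; rewrite (space_partial_product dt cdt trho).
by rewrite /Rintegral H.
Qed.

End weak_product.

Definition exp_ratio {R : realType} (h s : R) : R := expR (s / h).

(** * The weak form averaged with an exponential weight *)

Section averaged_weak_form.
Context {R : realType} {N : nat}.
Local Notation mu := (lebesgue_rV R N).
Local Notation leb := (@lebesgue_measure R).
Variables (m q sigma : R).
Hypotheses (m0 : 0 < m) (q0 : 0 < q) (sigma0 : 0 < sigma).
Variables (u0 b : 'rV[R]_N -> R) (u w : R * 'rV[R]_N -> R) (M : R).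
Hypotheses (mu0 : measurable_fun setT u0) (mb : measurable_fun setT b).
Hypotheses (bM : forall x, `|b x| <= M) (u0b : {ae mu, forall x, u0 x = b x}).
Hypothesis usol : weak_solution m q sigma u0 u.
Hypothesis uw : {ae @spacetime_measure R N, forall z, positive_times z -> w z = u z}.
Hypothesis cw : forall s x, 0 < s -> {for (s, x), continuous w}.
Hypothesis w0 : forall s x, s <= 0 -> w (s, x) = 0.
Hypothesis wge0 : forall z, 0 <= w z.
Hypothesis wM : forall z, `|w z| <= M.
Local Notation wp := (spacetime_powR w).
Variables (h T : R).
Hypothesis h0 : 0 < h.

Local Notation ex := (exp_ratio h).

Let dex s : is_derive s (1 : R) ex (ex s / h).
Proof.
have dl : is_derive s (1 : R) (fun s : R => s / h) h^-1.
  have -> : (fun s : R => s / h) = h^-1 *: id by apply/funext => t; rewrite /= [RHS]mulrC.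
  by apply: (is_derive_eq (is_deriveZ h^-1 (is_derive_id s 1))); rewrite /GRing.scale/= mulr1.
exact: (is_derive1_comp (f := expR) (g := fun s : R => s / h) (is_derive_expR _) dl).
Qed.

Let cex : continuous ex.
Proof.
move=> s; apply/differentiable_continuous/derivable1_diffP.
by have [] := dex s.
Qed.

Let exT s : s \in `]0, T[ -> `|ex s| <= ex T.
Proof.
rewrite in_itv/= => /andP[_ sT]; rewrite ger0_norm ?expR_ge0// /exp_ratio ler_expR.
by rewrite ler_pM2r ?invr_gt0// ltW.
Qed.

Let mex : measurable_fun (`]0, T[ : set R) ex.
Proof. by apply: measurable_itv_continuous => s _; exact: cex. Qed.

Lemma Rintegral_exp_before t : 0 < t -> t < T ->
  \int[leb]_(s in `]0, T[) (ex s * (s < t)%R%:R) = h * (ex t - 1).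
Proof.
move=> t0 tT.
have E : (\int[leb]_(s in `]0%R, T[) (ex s * (s < t)%R%:R)%:E = \int[leb]_(s in `]0%R, t[) (ex s)%:E)%E.
  rewrite [LHS]integral_mkcond [RHS]integral_mkcond; apply: eq_integral => s _.
  rewrite !patchE !mem_setE !in_itv/=; case: (ltP 0 s) => //= s0.
  have [st|ts] := ltP s t; first by rewrite (lt_trans st tT) mulr1.
  by rewrite mulr0 if_same.
have mexD D : measurable_fun D (EFin \o ex).
  apply/measurable_EFinP; apply: measurable_funTS.
  by apply: continuous_measurable_fun; exact: cex.
rewrite /Rintegral E -(integral_itv_bndoo true false (mexD _)).
rewrite (@continuous_FTC2 _ ex (fun s => h * ex s)) //=.
- by rewrite /exp_ratio mul0r expR0 mulr1 mulrBr mulr1.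
- by apply: continuous_subspaceT; exact: cex.
- have cN : continuous (fun s => h * ex s).
    by move=> s; apply: cvgM; [exact: cvg_cst|exact: cex].
  split.
  + by move=> s _; have [] := is_deriveZ h (dex s).
  + exact/cvg_at_right_filter/cN.
  + exact/cvg_at_left_filter/cN.
- move=> s _; rewrite derive1E.
  have [_ ->] := is_deriveZ h (dex s).
  by rewrite /GRing.scale/= mulrCA divff ?mulr1// gt_eqF.
Qed.

(** The factor [step (s + 2)] vanishes for [s <= -2] and equals 1 for [s >= -1]: it gives compact
    support in time without changing anything at positive times. *)
Let theta t n s := ex s * chi t n s * step (s + 2).

Let dtheta t n s := ex s / h * chi t n s * step (s + 2)
  - ex s * dchi t n s * step (s + 2) + ex s * chi t n s * dstep (s + 2).

Let theta_deriv t n s : is_derive s (1 : R) (theta t n) (dtheta t n s).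
Proof.
have hB : is_derive s (1 : R) (fun s : R => s + 2) 1.
  by apply: (is_derive_eq (is_deriveD (is_derive_id s 1) (is_derive_cst (2 : R) s 1))); rewrite addr0.
have hS := is_derive1_comp (f := step) (g := fun s : R => s + 2) (is_derive_step _) hB.
have := is_deriveM (is_deriveM (dex s) (is_derive_chi t n s)) hS.
move=> H; apply: (is_derive_eq H).
rewrite -[(ex * chi t n) s]/(ex s * chi t n s) -[(step \o _) s]/(step (s + 2)).
by rewrite /GRing.scale/= /dtheta; ring.
Qed.

Let cdtheta t n : continuous (dtheta t n).
Proof.
have cs2 (f : R -> R) : continuous f -> continuous (fun s : R => f (s + 2)).
  by move=> cf s; apply: cvg_comp; last exact: cf; apply: cvgD => //; exact: cvg_cst.
have cstp : continuous (@step R).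
  move=> s; apply/differentiable_continuous/derivable1_diffP.
  by have [] := is_derive_step s.
move=> s; have c1 := cs2 _ cstp s; have c2 := cs2 _ dstep_continuous s.
have c3 := @chi_continuous _ t n s; have c4 := @dchi_continuous _ t n s.
have c5 := @cex s.
apply: cvgD; first apply: cvgB.
- apply: cvgM => //; apply: cvgM => //; apply: cvgM => //; exact: cvg_cst.
- by apply: cvgM => //; apply: cvgM.
- by apply: cvgM => //; apply: cvgM.
Qed.

Let theta_pos t n s : 0 < s -> theta t n s = ex s * chi t n s.
Proof. by move=> s0; rewrite /theta step_ge1 ?mulr1//; lra. Qed.

Let dtheta_pos t n s : 0 < s -> dtheta t n s = ex s / h * chi t n s - ex s * dchi t n s.
Proof.
move=> s0; rewrite /dtheta step_ge1 ?dstep_out; first by ring.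
  by right; lra.
by lra.
Qed.

Variable rho : 'rV[R]_N -> R.
Hypothesis trho : is_test rho.

Local Notation B0 := (\int[mu]_x (b x * rho x)).
Local Notation b1 := (space_average w rho).
Local Notation bm := (space_average (wp m) (laplacian rho)).
Local Notation bq := (space_average (wp q) (fun x => enorm x `^ sigma * rho x)).

(** On positive times the derivative of [theta] is [ex s / h * chi t n s - ex s * dchi t n s]. As
    [n] grows, the first term becomes an integral over [s < t], and the second concentrates into the
    value at [t]. *)
Lemma weak_time_identity t : 0 < t -> t < T ->
  \int[leb]_(s in `]0, T[)
    (ex s * ((B0 - b1 s) / h + bq s - bm s) * (s < t)%R%:R) = ex t * (B0 - b1 t).
Proof.
move=> t0 tT.
have T0 : 0 < T by exact: lt_trans tT.
have [_ [r hr]] := trho; have crho := is_test_continuous trho.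
have cl := is_test_continuous (is_test_laplacian trho).
have [_ [r' hr']] := is_test_laplacian trho.
have cen : continuous (fun x => enorm x `^ sigma * rho x).
  by move=> x; exact: (continuousM (@continuous_enorm_powR _ _ _ sigma0 x) (crho x)).
have hen x : r < `|x| -> enorm x `^ sigma * rho x = 0 by move=> rx; rewrite hr ?mulr0.
have cq s x := @continuous_spacetime_powR _ _ w cw wge0 q s x q0.
have cm s x := @continuous_spacetime_powR _ _ w cw wge0 m s x m0.
have q00 s x := @spacetime_powR0 _ _ w w0 q s x q0.
have m00 s x := @spacetime_powR0 _ _ w w0 m s x m0.
have qM z := @spacetime_powR_bounded _ _ w M wge0 wM q z (ltW q0).
have mM z := @spacetime_powR_bounded _ _ w M wge0 wM m z (ltW m0).
have c1 s (s0 : 0 < s) := @space_average_continuous _ _ w M cw w0 wM _ _ crho hr s s0.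
have c2 s (s0 : 0 < s) := @space_average_continuous _ _ _ _ cq q00 qM _ _ cen hen s s0.
have c3 s (s0 : 0 < s) := @space_average_continuous _ _ _ _ cm m00 mM _ _ cl hr' s s0.
pose C1 := \int[mu]_x (M * `|rho x|).
have B1 : forall s, `|b1 s| <= C1 := @space_average_bounded _ _ w M cw w0 wM _ _ crho hr.
pose C2 := \int[mu]_x (M `^ q * `|enorm x `^ sigma * rho x|).
have B2 : forall s, `|bq s| <= C2 := @space_average_bounded _ _ _ _ cq q00 qM _ _ cen hen.
pose C3 := \int[mu]_x (M `^ m * `|laplacian rho x|).
have B3 : forall s, `|bm s| <= C3 := @space_average_bounded _ _ _ _ cm m00 mM _ _ cl hr'.
pose a1 s := ex s * ((B0 - b1 s) / h + bq s - bm s).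
pose a2 s := ex s * (B0 - b1 s).
have ca1 s : 0 < s -> {for s, continuous a1}.
  move=> s0; apply: cvgM; first exact: cex.
  apply: cvgB; last exact: c3; apply: cvgD; last exact: c2.
  by apply: cvgM; [apply: cvgB; [exact: cvg_cst|exact: c1]|exact: cvg_cst].
have ca2 s : 0 < s -> {for s, continuous a2}.
  by move=> s0; apply: cvgM; [exact: cex|apply: cvgB; [exact: cvg_cst|exact: c1]].
have ba1 s : s \in `]0, T[ -> `|a1 s| <= ex T * ((`|B0| + C1) / h + C2 + C3).
  move=> sT; rewrite normrM ler_pM ?exT//.
  apply: (le_trans (ler_normB _ _)); rewrite lerD ?B3//.
  apply: (le_trans (ler_normD _ _)); rewrite lerD ?B2//.
  rewrite normrM [`|h^-1|]gtr0_norm ?invr_gt0// ler_pM2r ?invr_gt0//.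
  by apply: (le_trans (ler_normB _ _)); rewrite lerD2l B1.
have ba2 s : s \in `]0, T[ -> `|a2 s| <= ex T * (`|B0| + C1).
  move=> sT; rewrite normrM ler_pM ?exT//.
  by apply: (le_trans (ler_normB _ _)); rewrite lerD2l B1.
have l1 := @cvg_integral_chi _ t T a1 _ ca1 ba1.
have l2 := @cvg_integral_dchi _ t T a2 _ t0 tT ca2 ba2.
have E n : \int[leb]_(s in `]0, T[) (a1 s * chi t n s) =
    \int[leb]_(s in `]0, T[) (a2 s * dchi t n s).
  have i1 : leb.-integrable `]0, T[ (EFin \o (fun s => a1 s * chi t n s)).
    apply: (@integrable_itv_bounded _ _ _ (ex T * ((`|B0| + C1) / h + C2 + C3) * 1)).
      by apply: measurable_itv_continuous => s s0; apply: cvgM; [exact: ca1|exact: chi_continuous].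
    move=> s sT; rewrite normrM ler_pM ?ba1//.
    by rewrite ger0_norm ?chi_ge0// chi_le1.
  have i2 : leb.-integrable `]0, T[ (EFin \o (fun s => a2 s * dchi t n s)).
    apply: (@integrable_itv_bounded _ _ _ (ex T * (`|B0| + C1) * (n.+1%:R * 2))).
      by apply: measurable_itv_continuous => s s0; apply: cvgM; [exact: ca2|exact: dchi_continuous].
    by move=> s sT; rewrite normrM ler_pM ?ba2 ?dchi_bounded.
  apply/eqP; rewrite -subr_eq0 -(RintegralB _ i1 i2)//; apply/eqP.
  have := @weak_product _ _ m q sigma m0 q0 sigma0 u0 b u w M mu0 mb bM u0b usol uw cw w0 wge0 wM
    T (-2) t (theta t n) (dtheta t n) rho T0 tT (theta_deriv t n) (@cdtheta t n).
  move=> W; rewrite -[RHS]W//.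
  - apply: eq_Rintegral => s; rewrite mem_setE in_itv/= => /andP[s0 _].
    by rewrite theta_pos// dtheta_pos// /a1 /a2; ring.
  - by move=> s s2; rewrite /theta step_le0 ?mulr0//; lra.
  - by move=> s ts; rewrite /theta /chi step_le0 ?mulr0 ?mul0r// mulr_ge0_le0// subr_le0.
apply: (cvg_unique _ l1); first exact: Rhausdorff.
by rewrite (funext E).
Qed.

Local Notation J f t := (time_average f T ex t).

Let mbefore t : measurable_fun (`]0, T[ : set R) (fun s => ex s * (s < t)%R%:R).
Proof. exact: measurable_funM mex (@measurable_before _ _ _). Qed.

Let bbefore t s : s \in `]0, T[ -> `|ex s * (s < t)%R%:R| <= ex T.
Proof.
move=> sT; rewrite normrM -[leRHS]mulr1 ler_pM ?exT//.
by case: (s < t); rewrite ?normr0 ?normr1.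
Qed.

(** Fubini exchanges the averages. The weight integrates to [h * (ex t - 1)], so the initial term
    contributes [B0 * (ex t - 1)]; subtracting it from [ex t * B0] leaves the single [B0]. *)
Lemma averaged_identity t : 0 < t -> t < T ->
  ex t * b1 t = B0 + h^-1 * \int[mu]_x (J w t x * rho x)
    - \int[mu]_x (J (wp q) t x * (enorm x `^ sigma * rho x))
    + \int[mu]_x (J (wp m) t x * laplacian rho x).
Proof.
move=> t0 tT; have := weak_time_identity t0 tT.
have T0 : 0 < T by exact: lt_trans tT.
have [_ [r hr]] := trho; have crho := is_test_continuous trho.
have cl := is_test_continuous (is_test_laplacian trho).
have [_ [r' hr']] := is_test_laplacian trho.
have cen : continuous (fun x => enorm x `^ sigma * rho x).
  by move=> x; exact: (continuousM (@continuous_enorm_powR _ _ _ sigma0 x) (crho x)).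
have hen x : r < `|x| -> enorm x `^ sigma * rho x = 0 by move=> rx; rewrite hr ?mulr0.
have cq s x := @continuous_spacetime_powR _ _ w cw wge0 q s x q0.
have cm s x := @continuous_spacetime_powR _ _ w cw wge0 m s x m0.
have q00 s x := @spacetime_powR0 _ _ w w0 q s x q0.
have m00 s x := @spacetime_powR0 _ _ w w0 m s x m0.
have qM z := @spacetime_powR_bounded _ _ w M wge0 wM q z (ltW q0).
have mM z := @spacetime_powR_bounded _ _ w M wge0 wM m z (ltW m0).
pose k s := ex s * (s < t)%R%:R.
have mk : measurable_fun (`]0, T[ : set R) k by exact: mbefore.
have kK s : s \in `]0, T[ -> `|k s| <= ex T by exact: bbefore.
have avg (f : R * 'rV[R]_N -> R) Mf (cf : forall s x, 0 < s -> {for (s, x), continuous f})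
    (f0 : forall s x, s <= 0 -> f (s, x) = 0) (fM : forall z, `|f z| <= Mf) phi r0
    (cphi : continuous phi) (hphi : forall x, r0 < `|x| -> phi x = 0) :
    leb.-integrable `]0, T[ (EFin \o (fun s => space_average f phi s * k s)) /\
    \int[leb]_(s in `]0, T[) (space_average f phi s * k s) =
    \int[mu]_x (J f t x * phi x).
  split; last exact: (Rintegral_space_average cf f0 fM cphi hphi mk kK).
  apply: (@integrable_itv_bounded _ _ _ (\int[mu]_x (Mf * `|phi x|) * ex T)).
    apply: measurable_funM => //; apply: measurable_itv_continuous => s s0.
    exact: (space_average_continuous cf f0 fM cphi hphi s0).
  move=> s sT; rewrite normrM ler_pM ?kK//.
  exact: (space_average_bounded cf f0 fM cphi hphi).
have [i1 e1] := avg w M cw w0 wM rho r crho hr.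
have [i2 e2] := avg _ _ cq q00 qM _ r cen hen.
have [i3 e3] := avg _ _ cm m00 mM _ r' cl hr'.
have ik : leb.-integrable `]0, T[ (EFin \o k) by exact: integrable_itv_bounded mk kK.
have mI : measurable (`]0, T[%classic : set R) by exact: measurable_itv.
have i0 : leb.-integrable `]0, T[ (EFin \o (fun s => B0 / h * k s)) by exact: (integrableZl _ (B0 / h) ik).
have i1' : leb.-integrable `]0, T[ (EFin \o (fun s => h^-1 * (b1 s * k s))) by exact: (integrableZl _ h^-1 i1).
have iA : leb.-integrable `]0, T[ (EFin \o (fun s => B0 / h * k s - h^-1 * (b1 s * k s))).
  exact: (integrableB _ i0 i1').
have iB : leb.-integrable `]0, T[ (EFin \o (fun s => bq s * k s - bm s * k s)).
  exact: (integrableB _ i2 i3).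
rewrite (_ : \int[leb]_(s in `]0, T[) _ = \int[leb]_(s in `]0, T[)
  ((B0 / h * k s - h^-1 * (b1 s * k s)) + (bq s * k s - bm s * k s))); last first.
  by apply: eq_Rintegral => s _; rewrite /k; ring.
rewrite (RintegralD _ iA iB)// (RintegralB _ i0 i1')// (RintegralB _ i2 i3)//.
rewrite (RintegralZl _ _ ik)// (RintegralZl _ _ i1)// e1 e2 e3 (Rintegral_exp_before t0 tT).
set B := B0; set X1 := \int[mu]_x (J w _ _ * _); set X2 := \int[mu]_x (J (wp q) _ _ * _).
set X3 := \int[mu]_x (J (wp m) _ _ * _).
rewrite (_ : B / h * (h * (ex t - 1)) = B * (ex t - 1)); last by field; rewrite gt_eqF.
move=> H; have -> : ex t * b1 t = ex t * B - ex t * (B - b1 t) by ring.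
by rewrite -H; ring.
Qed.

Let cJ (f : R * 'rV[R]_N -> R) Mf (cf : forall s x, 0 < s -> {for (s, x), continuous f})
    (f0 : forall s x, s <= 0 -> f (s, x) = 0) (fM : forall z, `|f z| <= Mf) t :
  continuous (J f t).
Proof.
move=> x; have c := @time_average_continuous _ _ f Mf cf f0 fM T ex (ex T) mex exT (t, x).
apply: (@continuous_comp _ _ _ (fun x => (t, x)) (fun z => J f z.1 z.2)); last exact: c.
exact: (@cvg_pair _ _ _ (nbhs x) (nbhs t) (nbhs x) _ _ _ (cst t) idfun (@cst_continuous _ _ t x) cvg_id).
Qed.

(** The initial datum enters [averaged_identity] only through [B0], which [b <= U] and [0 <= rho]
    bound by the integral of [U x * rho x]. *)
Lemma averaged_subsolution (U : 'rV[R]_N -> R) t : 0 < t -> t < T ->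
  continuous U -> (forall x, b x <= U x) -> (forall x, 0 <= rho x) ->
  \int[mu]_x ((ex t * w (t, x) - U x - h^-1 * J w t x + enorm x `^ sigma * J (wp q) t x) * rho x)
  <= \int[mu]_x (J (wp m) t x * laplacian rho x).
Proof.
move=> t0 tT cU bU rho0; have := averaged_identity t0 tT.
have cq s x := @continuous_spacetime_powR _ _ w cw wge0 q s x q0.
have q00 s x := @spacetime_powR0 _ _ w w0 q s x q0.
have qM z := @spacetime_powR_bounded _ _ w M wge0 wM q z (ltW q0).
have [_ [r hr]] := trho; have crho := is_test_continuous trho.
have i1 := integrable_test (@continuous_slice _ _ w cw w0 t) trho.
have i2 := integrable_test cU trho.
have i3 := integrable_test (@cJ w M cw w0 wM t) trho.
have c4 : continuous (fun x => enorm x `^ sigma * J (wp q) t x).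
  move=> x; exact: (continuousM (@continuous_enorm_powR _ _ _ sigma0 x) (@cJ _ _ cq q00 qM t x)).
have i4 := integrable_test c4 trho.
have ib : mu.-integrable setT (EFin \o (fun x => b x * rho x)).
  have [C [C0 HC]] := continuous_supp_bounded crho hr.
  apply: (@integrable_bounded_supp _ _ _ r (M * C)) => [|x|x rx].
  - by apply: measurable_funM => //; exact: continuous_measurable_rV.
  - by rewrite normrM ler_pM.
  - by rewrite hr ?mulr0.
have bUr : B0 <= \int[mu]_x (U x * rho x).
  by apply: le_Rintegral => // x _; rewrite ler_wpM2r.
have j1 : mu.-integrable setT (EFin \o (fun x => ex t * (w (t, x) * rho x))).
  exact: (integrableZl measurableT _ i1).
have j3 : mu.-integrable setT (EFin \o (fun x => h^-1 * (J w t x * rho x))).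
  exact: (integrableZl measurableT _ i3).
have jA : mu.-integrable setT (EFin \o (fun x => ex t * (w (t, x) * rho x) - U x * rho x)).
  exact: (integrableB measurableT j1 i2).
have jB : mu.-integrable setT (EFin \o (fun x => enorm x `^ sigma * J (wp q) t x * rho x - h^-1 * (J w t x * rho x))).
  exact: (integrableB measurableT i4 j3).
rewrite [in X in _ -> X](_ : \int[mu]_x (_ * rho x) = \int[mu]_x
  ((ex t * (w (t, x) * rho x) - U x * rho x)
   + (enorm x `^ sigma * J (wp q) t x * rho x - h^-1 * (J w t x * rho x)))); last first.
  by apply: eq_Rintegral => x _; ring.
rewrite (RintegralD measurableT jA jB) (RintegralB measurableT j1 i2) (RintegralB measurableT i4 j3).
rewrite (RintegralZl _ measurableT i1) (RintegralZl _ measurableT i3).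
rewrite (_ : \int[mu]_x (J (wp q) t x * _) = \int[mu]_x (enorm x `^ sigma * J (wp q) t x * rho x)); last first.
  by apply: eq_Rintegral => x _; ring.
rewrite -/(b1 t).
move: bUr; set B := B0; set X1 := h^-1 * _; set X2 := \int[mu]_x (_ * J (wp q) _ _ * _).
set X3 := \int[mu]_x (J (wp m) _ _ * _); set V := \int[mu]_x (U x * _); set Y := ex t * _.
clearbody B X1 X2 X3 V Y; clear => BV H; rewrite H.
by rewrite -subr_ge0 (_ : _ - _ = V - B) ?subr_ge0//; ring.
Qed.

End averaged_weak_form.

(** * Comparison *)

Section exp_average.
Context {R : realType} {N : nat}.
Local Notation mu := (lebesgue_rV R N).
Local Notation leb := (@lebesgue_measure R).
Variables (h T : R).
Hypothesis h0 : 0 < h.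
Local Notation ex := (exp_ratio h).
Local Notation J f t := (time_average f T ex t).

Lemma exp_ratio_gt0 s : 0 < ex s. Proof. exact: expR_gt0. Qed.

Lemma exp_ratio_bounded s : s \in `]0, T[ -> `|ex s| <= ex T.
Proof.
rewrite in_itv/= => /andP[_ sT]; rewrite gtr0_norm ?exp_ratio_gt0// ler_expR.
by rewrite ler_pM2r ?invr_gt0// ltW.
Qed.

Lemma exp_ratio_continuous : continuous ex.
Proof.
move=> s; apply: (cvg_comp (fun s => s / h) expR); last exact: continuous_expR.
by apply: cvgM => //; exact: cvg_cst.
Qed.

Lemma measurable_exp_ratio : measurable_fun (`]0, T[ : set R) ex.
Proof. by apply: measurable_itv_continuous => s _; exact: exp_ratio_continuous. Qed.

Lemma time_average0 (f : R * 'rV[R]_N -> R) x : J f 0 x = 0.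
Proof.
rewrite /time_average [LHS](_ : _ = \int[leb]_(s in `]0, T[) cst 0 s).
  by rewrite Rintegral_cst// mul0r.
apply: eq_Rintegral => s; rewrite mem_setE in_itv/= => /andP[s0 _].
by rewrite ltNge (ltW s0)/= !mulr0.
Qed.

Lemma Rintegral_exp_ratio t : 0 <= t -> t < T ->
  \int[leb]_(s in `]0, T[) (ex s * (s < t)%R%:R) = h * (ex t - 1).
Proof.
rewrite le_eqVlt => /orP[/eqP <- _|]; last exact: Rintegral_exp_before.
rewrite /exp_ratio mul0r expR0 subrr mulr0 [LHS](_ : _ = \int[leb]_(s in `]0, T[) cst 0 s).
  by rewrite Rintegral_cst// mul0r.
apply: eq_Rintegral => s; rewrite mem_setE in_itv/= => /andP[s0 _].
by rewrite ltNge (ltW s0)/= !mulr0.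
Qed.

Let ik t : leb.-integrable `]0, T[ (EFin \o (fun s => ex s * (s < t)%R%:R)).
Proof.
apply: (@integrable_itv_bounded _ _ _ (ex T)).
  exact: measurable_funM measurable_exp_ratio (@measurable_before _ _ _).
move=> s sT; rewrite normrM -[leRHS]mulr1 ler_pM ?exp_ratio_bounded//.
by case: (s < t); rewrite ?normr0 ?normr1.
Qed.

Section one_function.
Variables (f : R * 'rV[R]_N -> R) (M : R).
Hypothesis cf : forall s x, 0 < s -> {for (s, x), continuous f}.
Hypothesis f0 : forall s x, s <= 0 -> f (s, x) = 0.
Hypothesis fM : forall z, `|f z| <= M.

Lemma integrable_exp_average t x :
  leb.-integrable `]0, T[ (EFin \o (fun s => f (s, x) * (ex s * (s < t)%R%:R))).
Proof. exact: (integrable_time cf f0 fM measurable_exp_ratio exp_ratio_bounded). Qed.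

Lemma exp_average_continuous : continuous (fun z => J f z.1 z.2).
Proof. exact: (time_average_continuous cf f0 fM measurable_exp_ratio exp_ratio_bounded). Qed.

Let diffE t1 t2 x : \int[leb]_(s in `]0, T[)
    (f (s, x) * (ex s * (s < t2)%R%:R) - f (s, x) * (ex s * (s < t1)%R%:R)) =
  J f t2 x - J f t1 x.
Proof. exact: (RintegralB _ (integrable_exp_average t2 x) (integrable_exp_average t1 x)). Qed.

Let idiff t1 t2 x : leb.-integrable `]0, T[ (EFin \o (fun s =>
  f (s, x) * (ex s * (s < t2)%R%:R) - f (s, x) * (ex s * (s < t1)%R%:R))).
Proof. exact: (integrableB _ (integrable_exp_average t2 x) (integrable_exp_average t1 x)). Qed.

Let ikd t1 t2 c : leb.-integrable `]0, T[ (EFin \o (fun s =>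
  c * (ex s * (s < t2)%R%:R - ex s * (s < t1)%R%:R))).
Proof. exact: (integrableZl _ c (integrableB _ (ik t2) (ik t1))). Qed.

Let ikdE t1 t2 c : 0 <= t1 -> t1 <= t2 -> t2 < T -> \int[leb]_(s in `]0, T[)
  (c * (ex s * (s < t2)%R%:R - ex s * (s < t1)%R%:R)) = c * (h * (ex t2 - ex t1)).
Proof.
move=> t10 t12 t2T.
rewrite (RintegralZl _ _ (integrableB _ (ik t2) (ik t1)))// (RintegralB _ (ik t2) (ik t1))//.
rewrite !Rintegral_exp_ratio ?(le_trans t10)//; last exact: le_lt_trans t2T.
by congr (_ * _); ring.
Qed.

(** The weight has mass [h * (ex t2 - ex t1)] on [[t1, t2[]. This and its counterpart from below
    replace the time derivative of the average by finite increments. *)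
Lemma exp_average_diff_le t1 t2 x c : 0 <= t1 -> t1 <= t2 -> t2 < T ->
  (forall s, t1 <= s -> s < t2 -> f (s, x) <= c) ->
  J f t2 x - J f t1 x <= c * (h * (ex t2 - ex t1)).
Proof.
move=> t10 t12 t2T fc; rewrite -diffE -(ikdE c t10 t12 t2T).
apply: le_Rintegral => // s _.
rewrite -mulrBr; have [st1|t1s] := ltP s t1.
  by rewrite (lt_le_trans st1 t12) subrr !mulr0.
rewrite mulr0 subr0; have [st2|t2s] := ltP s t2; last by rewrite !mulr0.
by rewrite mulr1 ler_wpM2r ?(ltW (exp_ratio_gt0 _))// fc.
Qed.

Lemma exp_average_diff_ge t1 t2 x c : 0 <= t1 -> t1 <= t2 -> t2 < T ->
  (forall s, t1 <= s -> s < t2 -> c <= f (s, x)) ->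
  c * (h * (ex t2 - ex t1)) <= J f t2 x - J f t1 x.
Proof.
move=> t10 t12 t2T fc; rewrite -diffE -(ikdE c t10 t12 t2T).
apply: le_Rintegral => // s _.
rewrite -[leRHS]mulrBr; have [st1|t1s] := ltP s t1.
  by rewrite (lt_le_trans st1 t12) subrr !mulr0.
rewrite mulr0 subr0; have [st2|t2s] := ltP s t2; last by rewrite !mulr0.
by rewrite mulr1 ler_wpM2r ?(ltW (exp_ratio_gt0 _))// fc.
Qed.

End one_function.

Variables (m q : R) (w : R * 'rV[R]_N -> R) (M : R).
Hypotheses (m1 : 1 < m) (q0 : 0 < q) (q1 : q < 1).
Hypothesis cw : forall s x, 0 < s -> {for (s, x), continuous w}.
Hypothesis w0 : forall s x, s <= 0 -> w (s, x) = 0.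
Hypothesis wge0 : forall z, 0 <= w z.
Hypothesis wM : forall z, `|w z| <= M.
Local Notation wp := (spacetime_powR w).

Lemma integrable_exp_average_powR p t x : 0 < p ->
  leb.-integrable `]0, T[ (EFin \o (fun s => wp p (s, x) * (ex s * (s < t)%R%:R))).
Proof.
move=> p0; apply: (@integrable_exp_average _ (M `^ p)) => [s y|s y|z].
- exact: continuous_spacetime_powR.
- exact: spacetime_powR0.
- by apply: spacetime_powR_bounded => //; exact: ltW.
Qed.

(* The tangent line inequality at [phi], averaged over the probability measure
   that defines the exponential mean, where [phi ^ m] is the mean of the m-th powers. *)
Lemma tangent_exp_average (c phi U0 t : R) x : 0 < t -> t < T -> 0 < phi -> 0 <= c ->
  c * (m - q) <= (m - 1) * phi `^ (1 - q) -> 0 <= U0 ->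
  ex t * phi `^ m = U0 `^ m + h^-1 * J (wp m) t x ->
  U0 + h^-1 * J w t x + c * (ex t * phi `^ q - (U0 `^ q + h^-1 * J (wp q) t x)) <=
  ex t * phi.
Proof.
move=> t0 tT phi0 c0 cphi U00 mean.
have m0 : 0 < m by exact: lt_trans m1.
(* [kap] is the coefficient in [tangent_powR]. With it, [A + bet * r^m + c * r^q] lies above [r] and
   touches it at [r = phi]. *)
pose kap := (1 - q * (c * phi `^ (q - 1))) * phi / m.
pose A := phi - c * phi `^ q - kap.
pose bet := kap / phi `^ m.
have P0 : phi `^ m != 0 by rewrite gt_eqF// powR_gt0.
have tl r : 0 <= r -> r <= A + bet * r `^ m + c * r `^ q.
  move=> r0; have := @tangent_powR _ m q c phi r (ltW q0) q1 m1 phi0 c0 cphi r0.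
  rewrite -/kap powRM ?invr_ge0 ?(ltW phi0)// -[phi^-1 `^ m]/(_ ) => H.
  have E : (phi^-1) `^ m = (phi `^ m)^-1 by rewrite -powR_inv1 ?ltW// -!powRrM mulN1r powRN.
  rewrite E in H; rewrite -subr_ge0; rewrite -subr_ge0 in H.
  by rewrite (_ : _ - _ = phi - r - c * (phi `^ q - r `^ q) - kap * (1 - r `^ m / phi `^ m))// /A /bet; ring.
have Jle : J w t x <= A * (h * (ex t - 1)) + bet * J (wp m) t x + c * J (wp q) t x.
  have iw := integrable_exp_average cw w0 wM t x.
  have im := integrable_exp_average_powR t x m0.
  have iq := integrable_exp_average_powR t x q0.
  have iA : leb.-integrable `]0, T[ (EFin \o (fun s => A * (ex s * (s < t)%R%:R))).
    exact: (integrableZl _ A (ik t)).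
  have iB : leb.-integrable `]0, T[ (EFin \o (fun s => bet * (wp m (s, x) * (ex s * (s < t)%R%:R)))).
    exact: (integrableZl _ bet im).
  have iC : leb.-integrable `]0, T[ (EFin \o (fun s => c * (wp q (s, x) * (ex s * (s < t)%R%:R)))).
    exact: (integrableZl _ c iq).
  have iAB : leb.-integrable `]0, T[ (EFin \o (fun s => A * (ex s * (s < t)%R%:R)
      + bet * (wp m (s, x) * (ex s * (s < t)%R%:R)))).
    exact: (integrableD _ iA iB).
  have iABC : leb.-integrable `]0, T[ (EFin \o (fun s => A * (ex s * (s < t)%R%:R)
      + bet * (wp m (s, x) * (ex s * (s < t)%R%:R)) + c * (wp q (s, x) * (ex s * (s < t)%R%:R)))).
    exact: (integrableD _ iAB iC).
  rewrite -(Rintegral_exp_ratio (ltW t0) tT) /time_average.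
  rewrite -(RintegralZl _ _ (ik t))// -(RintegralZl _ _ im)// -(RintegralZl _ _ iq)//.
  rewrite -(RintegralD _ iA iB)// -(RintegralD _ iAB iC)//.
  apply: le_Rintegral => // s _.
  rewrite !mulrA -!mulrDl; apply: ler_wpM2r => //.
  apply: ler_wpM2r; first exact: ltW (exp_ratio_gt0 s).
  exact: tl.
have hJ : h^-1 * J w t x <= A * (ex t - 1) + bet * (h^-1 * J (wp m) t x) + c * (h^-1 * J (wp q) t x).
  have h0' : h != 0 by rewrite gt_eqF.
  rewrite (_ : A * _ + _ + _ = h^-1 * (A * (h * (ex t - 1)) + bet * J (wp m) t x + c * J (wp q) t x)).
    by rewrite ler_wpM2l// invr_ge0 ltW.
  by field.
have hU := tl _ U00.
have kE : bet * (ex t * phi `^ m) = kap * ex t by rewrite /bet; field.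
rewrite -subr_ge0; set E := ex t in hJ kE *.
(* The atom at [U0] has weight 1 and the density has mass [E - 1]. The hypothesis [mean] makes the
   [bet] terms sum to [kap * E], which cancels the [kap] inside [A], so only the two integrated
   defects remain. *)
have -> : E * phi - (U0 + h^-1 * J w t x + c * (E * phi `^ q - (U0 `^ q + h^-1 * J (wp q) t x))) =
   (A + bet * U0 `^ m + c * U0 `^ q - U0) +
   (A * (E - 1) + bet * (h^-1 * J (wp m) t x) + c * (h^-1 * J (wp q) t x) - h^-1 * J w t x).
  have -> : h^-1 * J (wp m) t x = E * phi `^ m - U0 `^ m by rewrite mean; ring.
  by rewrite (mulrBr bet) kE /A; ring.
by rewrite addr_ge0 ?subr_ge0.
Qed.

End exp_average.

Lemma laplacianZ {R : realType} {N : nat} (c : R) (f : 'rV[R]_N -> R) x : Ck 2 f ->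
  laplacian (fun y => c * f y) x = c * laplacian f x.
Proof.
move=> [df Df]; rewrite /laplacian mulr_sumr; apply: eq_bigr => i _.
have -> : partial i (fun y => c * f y) = c *: partial i f.
  apply/funext => y; rewrite -[LHS]/('D_(basis_rV i) (c *: f) y) deriveZ//.
  exact: diff_derivable.
have [dDf _] := Df (basis_rV i).
by rewrite [LHS]deriveZ//; exact: diff_derivable.
Qed.

Lemma half_min {R : realFieldType} (a b : R) : 0 < a -> 0 < b ->
  exists tau, [/\ 0 < tau, tau <= a & tau < b].
Proof.
move=> a0 b0; have c0 : 0 < Num.min a b by rewrite lt_min a0.
have [ca cb] : Num.min a b <= a /\ Num.min a b <= b by rewrite !ge_min !lexx orbT.
by exists (Num.min a b / 2); split; lra.
Qed.

Section comparison.
Context {R : realType} {N : nat}.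
Local Notation mu := (lebesgue_rV R N).
Variables (m q sigma : R).
Hypotheses (m1 : 1 < m) (q0 : 0 < q) (q1 : q < 1).
Hypothesis sigmaP : 2 * (1 - q) / (m - 1) < sigma.
Local Notation U := (@profile R N m q sigma).
Variables (w : R * 'rV[R]_N -> R) (M : R).
Hypothesis cw : forall s x, 0 < s -> {for (s, x), continuous w}.
Hypothesis w0 : forall s x, s <= 0 -> w (s, x) = 0.
Hypothesis wge0 : forall z, 0 <= w z.
Hypothesis wM : forall z, `|w z| <= M.
Local Notation wp := (spacetime_powR w).
Variables (h T r : R).
Hypothesis h0 : 0 < h.
Local Notation ex := (exp_ratio h).
Local Notation J f t := (time_average f T ex t).
Hypothesis Ur : forall x, r <= `|x| -> M <= U x.
Hypothesis absorption : forall x : 'rV[R]_N, `|x| <= r ->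
  h * enorm x `^ sigma * (m - q) <= (m - 1) * U x `^ (1 - q).
Hypothesis subsolution : forall t rho, 0 < t -> t < T -> is_test rho ->
  (forall x, 0 <= rho x) ->
  \int[mu]_x ((ex t * w (t, x) - U x - h^-1 * J w t x + enorm x `^ sigma * J (wp q) t x) * rho x)
  <= \int[mu]_x (J (wp m) t x * laplacian rho x).

Let m0 : 0 < m. Proof. exact: lt_trans m1. Qed.
Let sigma0 : 0 < sigma. Proof. exact: profile_sigma_gt0 m1 q1 sigmaP. Qed.

Let cp p (p0 : 0 < p) s x := @continuous_spacetime_powR _ _ w cw wge0 p s x p0.
Let p00 p (p0 : 0 < p) s x := @spacetime_powR0 _ _ w w0 p s x p0.
Let pM p (p0 : 0 < p) z := @spacetime_powR_bounded _ _ w M wge0 wM p z (ltW p0).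

Let cJ p t : 0 < p -> continuous (J (wp p) t).
Proof.
move=> p0 x; have c := @exp_average_continuous _ _ h T h0 _ _ (cp p0) (p00 p0) (pM p0) (t, x).
apply: (@continuous_comp _ _ _ (fun x => (t, x)) (fun z => J (wp p) z.1 z.2)); last exact: c.
exact: (@cvg_pair _ _ _ (nbhs x) (nbhs t) (nbhs x) _ _ _ (cst t) idfun (@cst_continuous _ _ t x) cvg_id).
Qed.

Let cJ1 t : continuous (J w t).
Proof.
move=> x; have c := @exp_average_continuous _ _ h T h0 _ _ cw w0 wM (t, x).
apply: (@continuous_comp _ _ _ (fun x => (t, x)) (fun z => J w z.1 z.2)); last exact: c.
exact: (@cvg_pair _ _ _ (nbhs x) (nbhs t) (nbhs x) _ _ _ (cst t) idfun (@cst_continuous _ _ t x) cvg_id).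
Qed.

(** The function [F] of the overview. *)
Definition exp_mean t x := (ex t)^-1 * (U x `^ m + h^-1 * J (wp m) t x).

Let ex0 t : 0 < ex t. Proof. exact: expR_gt0. Qed.

Let ex_ge1 t : 0 <= t -> 1 <= ex t.
Proof. by move=> t0; rewrite -expR0 ler_expR divr_ge0// ltW. Qed.

Let J_ge0 t x : 0 <= t -> t < T -> 0 <= J (wp m) t x.
Proof.
move=> t0 tT.
have := @exp_average_diff_ge _ _ h T h0 _ _ (cp m0) (p00 m0) (pM m0) 0 t x 0 (lexx 0) t0 tT
  (fun s _ _ => powR_ge0 _ _).
by rewrite mul0r time_average0// subr0.
Qed.

(** Where [U] exceeds the bound [M] of [w], all the values averaged in [exp_mean] are at most
    [U x ^ m]. *)
Lemma exp_mean_far t x : 0 <= t -> t < T -> r <= `|x| -> exp_mean t x <= U x `^ m.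
Proof.
move=> t0 tT rx.
have := @exp_average_diff_le _ _ h T h0 _ _ (cp m0) (p00 m0) (pM m0) 0 t x (U x `^ m) (lexx 0) t0 tT.
have H s : 0 <= s -> s < t -> wp m (s, x) <= U x `^ m.
  move=> _ _; apply: ge0_ler_powR; rewrite ?nnegrE ?(ltW m0)// ?profile_ge0//.
  by apply: le_trans (Ur rx); apply: le_trans (wM _); exact: ler_norm.
move=> /(_ H); rewrite time_average0// subr0 /exp_ratio mul0r expR0 -/(ex t) => JU.
rewrite /exp_mean mulrC ler_pdivrMr//.
rewrite -lerBrDl (_ : _ - _ = h^-1 * (U x `^ m * (h * (ex t - 1)))); last first.
  by field; rewrite gt_eqF.
by rewrite ler_wpM2l// invr_ge0 ltW.
Qed.

(** The elliptic inequality at the maximum bounds [w (t, x0)] in terms of the averages of [w] and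
    its q-th power; the averaged tangent inequality at [phi], the m-th root of [F], bounds these in
    turn. *)
Lemma max_bound t x0 : 0 < t -> t < T -> `|x0| <= r ->
  (forall x, exp_mean t x - U x `^ m <= exp_mean t x0 - U x0 `^ m) ->
  U x0 `^ m < exp_mean t x0 -> w (t, x0) `^ m <= exp_mean t x0.
Proof.
move=> t0 tT xr maxx Fgt.
have F0 : 0 < exp_mean t x0 by apply: le_lt_trans Fgt; exact: powR_ge0.
pose phi := exp_mean t x0 `^ m^-1.
have phi0 : 0 < phi by exact: powR_gt0.
have phim : phi `^ m = exp_mean t x0 by rewrite /phi -powRrM mulVf ?gt_eqF// powRr1// ltW.
have U00 := profile_ge0 m q sigma x0.
have Uphi : U x0 <= phi.
  rewrite leNgt; apply/negP => H; move: Fgt; rewrite -phim ltNge.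
  by rewrite ge0_ler_powR ?nnegrE ?(ltW m0)// ltW.
pose c := h * enorm x0 `^ sigma.
have c0 : 0 <= c by rewrite mulr_ge0 ?powR_ge0// ltW.
(* The smallness condition is assumed at [U x0] and carries over to the larger [phi]. *)
have cphi : c * (m - q) <= (m - 1) * phi `^ (1 - q).
  apply: (le_trans (absorption xr)); rewrite ler_wpM2l ?subr_ge0 ?(ltW m1)//.
  by rewrite ge0_ler_powR ?nnegrE ?subr_ge0 ?(ltW q1)// ltW.
have mean : ex t * phi `^ m = U x0 `^ m + h^-1 * J (wp m) t x0.
  by rewrite phim /exp_mean mulrA divff ?mul1r// gt_eqF.
have tang := tangent_exp_average h0 m1 q0 q1 cw w0 wge0 wM t0 tT phi0 c0 cphi U00 mean.
(* Chosen so that [J (wp m) t - W] equals [h * ex t] times [F - U^m]: both differences have the same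
   maximum points. *)
pose W x := h * (ex t - 1) * U x `^ m.
pose psi x := ex t * w (t, x) - U x - h^-1 * J w t x + enorm x `^ sigma * J (wp q) t x.
have cU := @profile_continuous R N m q sigma m1 q1 sigmaP.
have C2U := Ck2_profile_powR N m1 q0 q1 sigmaP.
have cpsi : continuous psi.
  move=> x; have c1 : {for x, continuous (fun x => ex t * w (t, x))}.
    exact: (continuousM (@cst_continuous _ _ (ex t) x) (@continuous_slice _ _ w cw w0 t x)).
  have c3 : {for x, continuous (fun x => h^-1 * J w t x)}.
    exact: (continuousM (@cst_continuous _ _ h^-1 x) (@cJ1 t x)).
  have c4 : {for x, continuous (fun x => enorm x `^ sigma * J (wp q) t x)}.
    exact: (continuousM (@continuous_enorm_powR _ _ _ sigma0 x) (@cJ q t q0 x)).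
  exact: (continuousD (continuousB (continuousB c1 (@cU x)) c3) c4).
have C2W : Ck 2 W by exact: (CkM (@Ck_cst _ _ _ _) C2U).
have key : psi x0 <= laplacian W x0.
  apply: (viscosity_subsolution (@cJ m t m0) _ cpsi C2W) => [x|x|rho trho rho0].
  - by apply: J_ge0 => //; exact: ltW.
  - have E y : J (wp m) t y - W y = h * ex t * (exp_mean t y - U y `^ m).
      by rewrite /exp_mean /W; field; rewrite !gt_eqF.
    by rewrite !E ler_wpM2l// mulr_ge0// ltW.
  - exact: subsolution.
rewrite (laplacianZ (h * (ex t - 1)) x0 C2U) (laplacian_profile m1 q0 q1 sigmaP) in key.
(* Adding [key] and [tang], the time averages cancel since [h^-1 * c] is the absorption weight; what
   is left is [c * ex t] times [U^q - phi^q], nonpositive by [Uphi]. *)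
have wphi : w (t, x0) <= phi.
  rewrite -(ler_pM2l (ex0 t)).
  have Uq : c * ex t * (U x0 `^ q) <= c * ex t * (phi `^ q).
    apply: ler_wpM2l; first by apply: mulr_ge0 => //; exact: ltW.
    by apply: ge0_ler_powR; rewrite ?nnegrE ?(ltW q0)// ltW.
  have E : h * (ex t - 1) * (enorm x0 `^ sigma * U x0 `^ q) - psi x0 =
     c * ex t * U x0 `^ q - c * U x0 `^ q - (ex t * w (t, x0) - U x0 - h^-1 * J w t x0
      + h^-1 * c * J (wp q) t x0).
    by rewrite /psi /c; field; rewrite gt_eqF.
  rewrite -subr_ge0 E in key; rewrite -subr_ge0 in tang; rewrite -subr_ge0 in Uq.
  rewrite -subr_ge0.
  have -> : ex t * phi - ex t * w (t, x0) =
     (c * ex t * U x0 `^ q - c * U x0 `^ q - (ex t * w (t, x0) - U x0 - h^-1 * J w t x0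
      + h^-1 * c * J (wp q) t x0)) +
     (ex t * phi - (U x0 + h^-1 * J w t x0 + c * (ex t * phi `^ q - (U x0 `^ q + h^-1 * J (wp q) t x0))))
     + (c * ex t * (phi `^ q) - c * ex t * (U x0 `^ q)) by ring.
  exact: addr_ge0 (addr_ge0 key tang) Uq.
by rewrite -phim; apply: ge0_ler_powR; rewrite ?nnegrE ?(ltW m0)// ltW.
Qed.

Let cmean : continuous (fun z => exp_mean z.1 z.2 - U z.2 `^ m).
Proof.
move=> z.
have C2U := Ck_continuous (Ck2_profile_powR N m1 q0 q1 sigmaP).
have c1 : {for z, continuous (fun z : R * 'rV[R]_N => U z.2 `^ m)}.
  by apply: (@continuous_comp _ _ _ snd (fun x => U x `^ m)); [exact: cvg_snd|exact: C2U].
have c2 : {for z, continuous (fun z : R * 'rV[R]_N => (ex z.1)^-1)}.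
  apply: (@continuous_comp _ _ _ fst (fun s => (ex s)^-1)); first exact: cvg_fst.
  by apply: cvgV; [rewrite gt_eqF|exact: exp_ratio_continuous].
have c3 := @exp_average_continuous _ _ h T h0 _ _ (cp m0) (p00 m0) (pM m0) z.
have c4 : {for z, continuous (fun z : R * 'rV[R]_N => h^-1 * J (wp m) z.1 z.2)}.
  exact: (continuousM (@cst_continuous _ _ h^-1 z) c3).
exact: (continuousB (continuousM c2 (continuousD c1 c4)) c1).
Qed.

(** Subtracting [L * t] from [F - U^m] forces, at a maximum in space and time, an increase of [F] by
    at least [L * tau] over every short interval before it. But [max_bound] says that the averaged
    quantity does not exceed [F] there, up to [eta]. *)
Lemma comparison t1 x1 : 0 <= t1 -> t1 < T -> exp_mean t1 x1 <= U x1 `^ m.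
Proof.
move=> t10 t1T; rewrite leNgt; apply/negP => gt1.
have start x : exp_mean 0 x = U x `^ m.
  rewrite /exp_mean time_average0// mulr0 addr0 /exp_ratio mul0r expR0 invr1 mul1r//.
have t1pos : 0 < t1.
  by rewrite lt_neqAle t10 andbT; apply/eqP => E; move: gt1; rewrite -E start ltxx.
pose D t x := exp_mean t x - U x `^ m.
have D1 : 0 < D t1 x1 by rewrite subr_gt0.
(* Half of the excess survives at [(t1, x1)], so the maximum of [G] is positive; hence it occurs at
   a positive time, with positive [D]. *)
pose L := D t1 x1 / (2 * t1).
have L0 : 0 < L by rewrite divr_gt0// mulr_gt0.
pose G (z : R * 'rV[R]_N) := D z.1 z.2 - L * z.1.
pose K : set (R * 'rV[R]_N) := `[0, t1]%classic `*` [set x | `|x| <= r].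
have cK : compact K by apply: compact_setX; [exact: segment_compact|exact: compact_norm_le].
have near_r t x : 0 <= t -> t < T -> 0 < D t x -> `|x| <= r.
  move=> t0 tT; rewrite leNgt subr_gt0 => H; apply/negP => /ltW rx; move: H.
  by rewrite ltNge exp_mean_far.
have K1 : K (t1, x1) by split => /=; [rewrite in_itv/= t10 lexx|exact: near_r D1].
have cG : {within K, continuous G}.
  apply: continuous_subspaceT => z.
  have c1 : {for z, continuous (fun z : R * 'rV[R]_N => L * z.1)}.
    by apply: (continuousM (@cst_continuous _ _ L z)); exact: cvg_fst.
  exact: (continuousB (@cmean z) c1).
have [[ts xs] /set_mem[/= tsI xsr] maxG] := compact_EVT_max (ex_intro _ _ K1) cK cG.
move: tsI; rewrite in_itv/= => /andP[ts0 tst1].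
have tsT : ts < T by exact: le_lt_trans t1T.
have Gs : 0 < G (ts, xs).
  apply: lt_le_trans (maxG _ (mem_set K1)).
  rewrite /G/= (_ : _ - _ = D t1 x1 / 2) ?divr_gt0//.
  by rewrite /L; field; rewrite gt_eqF.
have Ds : 0 < D ts xs by apply: lt_le_trans Gs _; rewrite /G/= gerBl mulr_ge0// ltW.
have tspos : 0 < ts.
  by rewrite lt_neqAle ts0 andbT; apply/eqP => E; move: Ds; rewrite -E /D start subrr ltxx.
have maxx x : D ts x <= D ts xs.
  have [xr|xr] := leP `|x| r; last first.
    by apply: le_trans (ltW Ds); rewrite subr_le0 exp_mean_far// ltW.
  have : G (ts, x) <= G (ts, xs) by apply: maxG; rewrite inE; split => //=; rewrite in_itv/= ts0.
  by rewrite /G/= lerD2r.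
have wle : w (ts, xs) `^ m <= exp_mean ts xs by apply: max_bound => //; rewrite -subr_gt0.
(* Tuned so that, with [exp(-tau/h) >= 1 - tau/h], the error [eta * (ex ts - ex (ts - tau))] is at
   most half of [L * tau]. *)
pose eta := L * h / (2 * ex ts).
have eta0 : 0 < eta by apply: divr_gt0; apply: mulr_gt0.
have wlt : w (ts, xs) `^ m < exp_mean ts xs + eta by apply: (le_lt_trans wle); rewrite ltrDl.
have ct : {for ts, continuous (fun s => wp m (s, xs))}.
  exact: (@continuous_time _ _ _ (cp m0) ts xs tspos).
have /nbhs_ballP[d /= d0 hd] := near_lt_continuous ct wlt.
have [tau [tau0 tauts taud]] := half_min tspos d0.
have ts'0 : 0 <= ts - tau by rewrite subr_ge0.
have ts'ts : ts - tau <= ts by rewrite gerBl ltW.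
have wbound s : ts - tau <= s -> s < ts -> wp m (s, xs) <= exp_mean ts xs + eta.
  move=> s1 s2; apply/ltW/hd; rewrite -ball_normE/= gtr0_norm ?subr_gt0//.
  by apply: le_lt_trans taud; rewrite lerBlDl -lerBlDr.
have dJ := @exp_average_diff_le _ _ h T h0 _ _ (cp m0) (p00 m0) (pM m0) _ _ xs _ ts'0 ts'ts tsT wbound.
have Gtau : G (ts - tau, xs) <= G (ts, xs).
  apply: maxG; rewrite inE; split => //=; rewrite in_itv/= ts'0/=.
  exact: le_trans tst1.
have Ltau : L * tau <= exp_mean ts xs - exp_mean (ts - tau) xs.
  move: Gtau; rewrite /G /D/=; rewrite -subr_ge0 => H; rewrite -subr_ge0.
  by apply: le_trans H _; rewrite le_eqVlt; apply/orP; left; apply/eqP; ring.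
have E1 : h^-1 * (J (wp m) ts xs - J (wp m) (ts - tau) xs) =
    ex ts * exp_mean ts xs - ex (ts - tau) * exp_mean (ts - tau) xs.
  by rewrite /exp_mean; field; rewrite !gt_eqF.
have E2 : ex (ts - tau) * (exp_mean ts xs - exp_mean (ts - tau) xs) <= eta * (ex ts - ex (ts - tau)).
  have : h^-1 * (J (wp m) ts xs - J (wp m) (ts - tau) xs) <=
     (exp_mean ts xs + eta) * (ex ts - ex (ts - tau)).
    rewrite ler_pdivrMl//; apply: (le_trans dJ).
    by rewrite le_eqVlt; apply/orP; left; apply/eqP; ring.
  rewrite E1 -subr_ge0 => H; rewrite -subr_ge0; apply: le_trans H _.
  by rewrite le_eqVlt; apply/orP; left; apply/eqP; ring.
have E3 : ex ts - ex (ts - tau) <= tau / h * ex ts.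
  have := expR_ge1Dx (- tau / h); rewrite -(ler_pM2r (ex0 ts)).
  have -> : expR (- tau / h) * ex ts = ex (ts - tau).
    by rewrite /exp_ratio -expRD; congr expR; ring.
  by rewrite -subr_ge0 => H; rewrite -subr_ge0; apply: le_trans H _; rewrite le_eqVlt; apply/orP; left; apply/eqP; field; rewrite gt_eqF.
have E4 : eta * (ex ts - ex (ts - tau)) <= L * tau / 2.
  apply: (le_trans (ler_wpM2l (ltW eta0) E3)).
  by rewrite /eta le_eqVlt; apply/orP; left; apply/eqP; field; rewrite !gt_eqF.
have E5 : L * tau <= ex (ts - tau) * (exp_mean ts xs - exp_mean (ts - tau) xs).
  apply: (le_trans Ltau); rewrite ler_peMl ?ex_ge1//.
  by apply: le_trans Ltau; rewrite mulr_ge0 ?ltW.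
have := le_trans E5 (le_trans E2 E4).
by rewrite ler_pdivlMr// mulr_natr mulr2n gerDl leNgt mulr_gt0.
Qed.

(** Comparison at the origin gives [J (wp m) s 0 <= 0]. If [w (t, 0)] were positive, continuity
    would make the integrand positive just before [t], and the average would increase strictly from
    a nonnegative value. *)
Lemma zero_at_origin t : 0 < t -> t < T -> w (t, 0) = 0.
Proof.
move=> t0 tT; apply/eqP; rewrite eq_le wge0 andbT leNgt; apply/negP => wt.
have Jle s : 0 <= s -> s < T -> J (wp m) s 0 <= 0.
  move=> s0 sT; have := comparison 0 s0 sT.
  rewrite /exp_mean (profile0 N m1 q1 sigmaP) powR0 ?gt_eqF// add0r pmulr_rle0 ?invr_gt0//.
  by rewrite pmulr_rle0// invr_gt0.
pose c := w (t, 0) `^ m / 2.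
have c0 : 0 < c by rewrite divr_gt0// powR_gt0.
have cw2 : c < wp m (t, 0) by rewrite /c ltr_pdivrMr// mulr_natr mulr2n ltrDl powR_gt0.
have ct : {for t, continuous (fun s => wp m (s, 0))}.
  exact: (@continuous_time _ _ _ (cp m0) t 0 t0).
have /nbhs_ballP[d /= d0 hd] := near_gt_continuous ct cw2.
have [tau [tau0 taut taud]] := half_min t0 d0.
have t'0 : 0 <= t - tau by rewrite subr_ge0.
have t't : t - tau <= t by rewrite gerBl ltW.
have wbound s : t - tau <= s -> s < t -> c <= wp m (s, 0).
  move=> s1 s2; apply/ltW/hd; rewrite -ball_normE/= gtr0_norm ?subr_gt0//.
  by apply: le_lt_trans taud; rewrite lerBlDl -lerBlDr.
have dJ := @exp_average_diff_ge _ _ h T h0 _ _ (cp m0) (p00 m0) (pM m0) _ _ 0 _ t'0 t't tT wbound.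
have : 0 < J (wp m) t 0 - J (wp m) (t - tau) 0.
  apply: lt_le_trans dJ; apply: mulr_gt0 => //; apply: mulr_gt0 => //.
  rewrite subr_gt0 ltr_expR.
  by rewrite ltr_pM2r ?invr_gt0// gtrBl.
by rewrite ltNge subr_le0 (le_trans (Jle _ (ltW t0) tT))// J_ge0// (le_lt_trans t't tT).
Qed.

End comparison.

Theorem proposition5p1 (R : realType) (N : nat) (m q sigma : R) :
  (1 <= N)%N -> 1 < m -> 0 < q -> q < 1 -> 2 * (1 - q) / (m - 1) < sigma ->
  let U := @profile R N m q sigma in
  [/\ classical_solution m q sigma (fun z => U z.2),
      ~ bounded_fun U
    & U 0 = 0] /\
  forall (u0 : 'rV[R]_N -> R) (u v : R * 'rV[R]_N -> R),
    Linfty_pos (lebesgue_rV R N) setT u0 ->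
    {ae lebesgue_rV R N, forall x, u0 x <= U x} ->
    weak_solution m q sigma u0 u ->
    continuous_representative u v ->
    forall t : R, 0 < t -> v (t, 0) = 0.
Proof.
move=> N1 m1 q0 q1 sigmaP U; split.
  split; first exact: profile_classical.
  - by apply: profile_unbounded => //.
  - exact: profile0.
move=> u0 u v Hu0 u0U usol [cv vu] t t0.
have m0 : 0 < m by exact: lt_trans m1.
have sigma0 : 0 < sigma by exact: profile_sigma_gt0 m1 q1 sigmaP.
have [mu0 [M0 [M00 u0M]]] := Linfty_pos_bounded measurableT Hu0.
have mpos : measurable (@positive_times R N : set (measurableTypeR R * 'rV[R]_N)).
  by apply: open_measurable_prod; exact: open_positive_times.
have [_ [M1 [M10 uM]]] := Linfty_pos_bounded mpos usol.1.
have ae_st := ae_filter_ringOfSetsType (@spacetime_measure R N).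
have vM z : positive_times z -> v z <= M1.
  apply: ae_positive_times_le => //.
  by apply: (@filterS2 _ _ ae_st _ _ _ _ vu uM) => y vy uy y0; rewrite vy//; case/andP: (uy y0).
have v0 z : positive_times z -> 0 <= v z.
  rewrite -oppr_le0; apply: (@ae_positive_times_le _ _ (fun z => - v z)) => [y y0|].
    exact: (continuousN (cv y y0)).
  by apply: (@filterS2 _ _ ae_st _ _ _ _ vu uM) => y vy uy y0; rewrite vy// oppr_le0; case/andP: (uy y0).
pose M := M0 + M1.
(* The extension by 0 makes sign and bound valid at all times, while continuity is claimed at
   positive times only. [M] bounds both the solution and the initial datum. *)
pose w (z : R * 'rV[R]_N) := if 0 < z.1 then v z else 0.
have cw s x : 0 < s -> {for (s, x), continuous w}.
  move=> s0; have c := cv (s, x) s0.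
  apply/near_dist_continuous => e e0.
  have h1 := (near_dist_continuous v (s, x)).1 c e e0.
  have h2 : \forall y \near (s, x), positive_times y.
    by apply: open_nbhs_nbhs; split => //; exact: open_positive_times.
  near=> y; rewrite /w/= s0 ifT; first by near: y.
  by near: y.
have w0 s x : s <= 0 -> w (s, x) = 0 by rewrite /w/= ltNge => ->.
have wge0 z : 0 <= w z by rewrite /w; case: ifP => // z0; exact: v0.
have wM z : `|w z| <= M.
  rewrite ger0_norm// /w /M; case: ifP => z0; last by rewrite addr_ge0.
  by rewrite (le_trans (vM _ z0))// lerDr.
have wu : {ae @spacetime_measure R N, forall z, positive_times z -> w z = u z}.
  by apply: (@filterS _ _ ae_st _ _ _ vu) => z vz z0; rewrite /w ifT// vz.
have U0 x : 0 <= U x by exact: profile_ge0.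
have cU : continuous U by exact: profile_continuous m1 q1 sigmaP.
(* [u0] is at most [U] only almost everywhere; [b] is a bounded version that is so everywhere. *)
pose b x := Num.min (Num.max 0 (Num.min (u0 x) M)) (U x).
have mb : measurable_fun setT b.
  apply: measurable_minr; last exact: continuous_measurable_rV.
  by apply: measurable_maxr => //; exact: measurable_minr.
have bM x : `|b x| <= M.
  rewrite ger0_norm; last by rewrite /b le_min le_max lexx/= U0.
  by rewrite /b ge_min ge_max addr_ge0//= ge_min lexx orbT.
have bU x : b x <= U x by rewrite /b ge_min lexx orbT.
have u0b : {ae lebesgue_rV R N, forall x, u0 x = b x}.
  apply: filterS2 u0M u0U => x /(_ I)/andP[u00 uM0] uU.
  rewrite /b (min_l (_ : u0 x <= M)); last by rewrite (le_trans uM0)// lerDl.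
  by rewrite max_r// min_l.
have [r r0 Ur] := profile_coercive N m1 q0 q1 sigmaP M.
have [h h0 absorption] := profile_absorption N m1 q0 q1 sigmaP r.
(* The averages live on []0, T[] and need a horizon beyond [t]; [t + 1] serves. *)
have tT : t < t + 1 by rewrite ltrDl.
have := @zero_at_origin R N m q sigma m1 q0 q1 sigmaP w M cw w0 wge0 wM h (t + 1) r h0 Ur absorption.
rewrite /w/= => /(_ _ t t0 tT); rewrite t0; apply=> s rho s0 sT trho rho0.
exact: (averaged_subsolution m0 q0 sigma0 mu0 mb bM u0b usol wu cw w0 wge0 wM h0 trho s0 sT cU bU rho0).
Unshelve. all: by end_near. Qed.
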